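(* Let $T>0$ and let $u$ be a bounded mild solution on $\mathbb{R}^3\times[0,T]$ of the unforced Navier--Stokes equations $$\partial_t u-\Delta u+(u\cdot\nabla)u+\nabla p=0,\qquad \nabla\cdot u=0.$$ If $u(\cdot,T)$ is an axi-symmetric vector field without swirl, then $u(\cdot,t)$ is axi-symmetric and swirl-free for all $t\in[0,T]$.
   Context: $e^{t\Delta}$ is the heat semigroup on $\mathbb{R}^3$ and $\mathbb{P}=I+\nabla(-\Delta)^{-1}(\nabla\cdot)$ is the Leray projection. A bounded ($L^\infty$) mild solution (with zero force) is a function $u\in L^\infty_{t,x}(\mathbb{R}^3\times[0,T];\mathbb{R}^3)$ that satisfies the equations in the distributional sense and satisfies $$u(t)=e^{(t-s)\Delta}u(s)-\int_s^t e^{(t-\tau)\Delta}\,\mathbb{P}\big[\nabla\cdot(u\otimes u)(\cdot,\tau)\big]\,d\tau,\qquad 0\le s\le t\le T,$$ where $e^{t\Delta}\mathbb{P}\nabla\cdot$ acts by convolution with its (integrable) kernel. The pressure is given by $\nabla p=\nabla(-\Delta)^{-1}\partial_i\partial_j(u^iu^j)$. A vector field $u$ on $\mathbb{R}^3$ is axi-symmetric if $u(x)=u^re_r+u^\theta e_\theta+u^ze_z$, where $(r,\theta,z)$ are cylindrical coordinates ($r=\sqrt{x_1^2+x_2^2}$, $\theta=\arctan(x_2/x_1)$, $z=x_3$), $e_r,e_\theta,e_z$ is the associated orthonormal frame, and $u^r,u^\theta,u^z$ are functions of $(r,z)$ that do not depend on $\theta$. It is without swirl (swirl-free) if moreover $u^\theta\equiv0$.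 *)

(* Defs.v *)
From HB Require Import structures.
From mathcomp Require Import all_boot all_order all_algebra.
From mathcomp Require Import all_classical all_reals all_analysis.

Set Implicit Arguments.
Unset Strict Implicit.
Unset Printing Implicit Defensive.

Import Order.TTheory GRing.Theory Num.Theory.
Import numFieldNormedType.Exports.
Local Open Scope classical_set_scope.
Local Open Scope ring_scope.

(* Points of R^3 are row vectors, which carry the normed-space structure used
   for derivatives; row vectors carry no measurable structure, so measurability
   and integration go through the coordinates in R * R * R. *)
Notation mR3 R := (measurableTypeR R * measurableTypeR R * measurableTypeR R)%type.

Definition vec3 (R : realType) (p : mR3 R) : 'rV[R]_3 :=
  \row_(i < 3) [:: p.1.1; p.1.2; p.2]`_i.

Definition leb3 (R : realType) :
    {measure set (mR3 R) -> \bar R} :=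
  ((@lebesgue_measure R \x @lebesgue_measure R) \x @lebesgue_measure R)%E.

(* space-time points are (x, t) *)
Definition leb4 (R : realType) :
    {measure set (mR3 R * measurableTypeR R)%type -> \bar R} :=
  (leb3 R \x @lebesgue_measure R)%E.

Definition slab (R : realType) (T : R) :
    set (mR3 R * measurableTypeR R)%type :=
  [set q | 0 <= q.2 <= T].

(* The library norm on row vectors is the sup norm. *)
Definition enorm (R : realType) (x : 'rV[R]_3) : R :=
  Num.sqrt (\sum_i x 0 i ^+ 2).

Definition partial (R : realType) (i : 'I_3) (f : 'rV[R]_3 -> R)
    (x : 'rV[R]_3) : R := 'D_(delta_mx 0 i) f x.

Definition grad (R : realType) (f : 'rV[R]_3 -> R) (x : 'rV[R]_3) : 'rV[R]_3 :=
  \row_i partial i f x.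

Definition divergence (R : realType) (v : 'rV[R]_3 -> 'rV[R]_3)
    (x : 'rV[R]_3) : R := \sum_i partial i (fun y => v y 0 i) x.

Definition laplacian (R : realType) (f : 'rV[R]_3 -> R) (x : 'rV[R]_3) : R :=
  \sum_i partial i (partial i f) x.

(* (-Delta)^{-1}, as convolution with the Newtonian kernel 1/(4 pi |x|) *)
Definition inv_neg_laplacian (R : realType) (f : 'rV[R]_3 -> R)
    (x : 'rV[R]_3) : R :=
  \int[leb3 R]_p (f (vec3 p) / (4 * pi * enorm (x - vec3 p))).

(* P = I + grad (-Delta)^{-1} div *)
Definition leray (R : realType) (v : 'rV[R]_3 -> 'rV[R]_3)
    (x : 'rV[R]_3) : 'rV[R]_3 :=
  v x + grad (inv_neg_laplacian (divergence v)) x.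

Definition heat_kernel (R : realType) (t : R) (x : 'rV[R]_3) : R :=
  (4 * pi * t) `^ (- (3 / 2)) * expR (- (enorm x ^+ 2 / (4 * t))).

(* e^{t Delta}, acting componentwise *)
Definition heat (R : realType) (t : R) (v : 'rV[R]_3 -> 'rV[R]_3)
    (x : 'rV[R]_3) : 'rV[R]_3 :=
  if t == 0 then v x
  else \row_i \int[leb3 R]_p (heat_kernel t (x - vec3 p) * v (vec3 p) 0 i).

(* The kernel of e^{t Delta} P div is the operator applied to the Dirac mass;
   as e^{t Delta} commutes with P and with derivatives, its (j, k) column is
   P (d_k Gamma_t e_j), with Gamma_t the heat kernel. *)
Definition oseen_kernel (R : realType) (t : R) (j k : 'I_3) :
    'rV[R]_3 -> 'rV[R]_3 :=
  leray (fun y => partial k (heat_kernel t) y *: delta_mx 0 j).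

(* e^{t Delta} P div F, for t > 0 and (div F)_j = sum_k d_k F_jk *)
Definition heat_leray_div (R : realType) (t : R) (F : 'rV[R]_3 -> 'M[R]_3)
    (x : 'rV[R]_3) : 'rV[R]_3 :=
  \row_i \int[leb3 R]_p
    (\sum_j \sum_k oseen_kernel t j k (x - vec3 p) 0 i * F (vec3 p) j k).

(* u (x) u *)
Definition tensor (R : realType) (v : 'rV[R]_3 -> 'rV[R]_3)
    (x : 'rV[R]_3) : 'M[R]_3 := (v x)^T *m v x.

(* C^k, through iterated directional derivatives *)
Fixpoint Ck (R : realType) (V : normedModType R) (k : nat) (f : V -> R) : Prop :=
  match k with
  | 0 => continuous f
  | k'.+1 => continuous f /\
      forall v : V, (forall x, derivable f x v) /\ Ck k' (fun x => 'D_v f x)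
  end.

(* C^infty, with compact support in R^3 x (0, T) *)
Definition test_function (R : realType) (T : R) (f : R -> 'rV[R]_3 -> R) : Prop :=
  (forall k, Ck k (fun q : 'rV[R]_3 * R => f q.2 q.1)) /\
  exists K : set ('rV[R]_3 * R)%type,
    [/\ compact K,
        K `<=` [set q | 0 < q.2 < T] &
        forall q, ~ K q -> f q.2 q.1 = 0].

Definition test_field (R : realType) (T : R)
    (phi : R -> 'rV[R]_3 -> 'rV[R]_3) : Prop :=
  forall i, test_function T (fun t x => phi t x 0 i).

(* The pairing <grad p, phi> with grad p = grad (-Delta)^{-1} d_i d_j (u^i u^j),
   all derivatives and (-Delta)^{-1} being moved onto phi.  The function
   d_i d_j (-Delta)^{-1} div phi decays like |x|^{-4}, so it is integrable
   against bounded u^i u^j. *)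
Definition grad_pressure (R : realType) (T : R) (u : R -> 'rV[R]_3 -> 'rV[R]_3)
    (phi : R -> 'rV[R]_3 -> 'rV[R]_3) : R :=
  - (\int[leb4 R]_(q in slab T)
       (\sum_i \sum_j tensor (u q.2) (vec3 q.1) i j *
          partial i (partial j (inv_neg_laplacian (divergence (phi q.2))))
            (vec3 q.1))).

(* d_t u - Delta u + (u . grad) u + grad p = 0 in D', with (u . grad) u written
   as div (u (x) u) *)
Definition distributional_momentum (R : realType) (T : R)
    (u : R -> 'rV[R]_3 -> 'rV[R]_3) : Prop :=
  forall phi, test_field T phi ->
    - (\int[leb4 R]_(q in slab T)
         (\sum_i u q.2 (vec3 q.1) 0 i *
           (derive1 (fun s => phi s (vec3 q.1) 0 i) q.2
            + laplacian (fun y => phi q.2 y 0 i) (vec3 q.1))))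
    - (\int[leb4 R]_(q in slab T)
         (\sum_i \sum_j tensor (u q.2) (vec3 q.1) i j *
           partial j (fun y => phi q.2 y 0 i) (vec3 q.1)))
    + grad_pressure T u phi = 0.

Definition distributional_divfree (R : realType) (T : R)
    (u : R -> 'rV[R]_3 -> 'rV[R]_3) : Prop :=
  forall psi, test_function T psi ->
    (\int[leb4 R]_(q in slab T)
      (\sum_i u q.2 (vec3 q.1) 0 i * partial i (psi q.2) (vec3 q.1))) = 0.

(* u is in L^infty(R^3 x [0, T]).  As the mild formula evaluates u at every
   time, each slice u(t) is required to be in L^infty(R^3) too. *)
Definition bounded_field (R : realType) (T : R)
    (u : R -> 'rV[R]_3 -> 'rV[R]_3) : Prop :=
  [/\ forall i, measurable_fun (slab T) (fun q => u q.2 (vec3 q.1) 0 i),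
      ('N[leb4 R]_+oo[EFin \o
         ((fun q => enorm (u q.2 (vec3 q.1))) \_ (slab T))] < +oo)%E &
      forall t : R, 0 <= t <= T ->
        ('N[leb3 R]_+oo[EFin \o (fun p => enorm (u t (vec3 p)))] < +oo)%E].

(* an identity between L^infty(R^3) functions, hence almost everywhere in x *)
Definition mild_formula (R : realType) (T : R)
    (u : R -> 'rV[R]_3 -> 'rV[R]_3) : Prop :=
  forall s t : R, 0 <= s -> s <= t -> t <= T ->
    {ae leb3 R, forall p,
      u t (vec3 p) = heat (t - s) (u s) (vec3 p)
        - \row_i (\int[@lebesgue_measure R]_(tau in `[s, t])
            heat_leray_div (t - tau) (tensor (u tau)) (vec3 p) 0 i)}.

Definition bounded_mild_solution (R : realType) (T : R)
    (u : R -> 'rV[R]_3 -> 'rV[R]_3) : Prop :=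
  [/\ bounded_field T u,
      distributional_momentum T u,
      distributional_divfree T u &
      mild_formula T u].

Definition cyl_r (R : realType) (x : 'rV[R]_3) : R :=
  Num.sqrt (x 0 0 ^+ 2 + x 0 1 ^+ 2).

Definition cyl_z (R : realType) (x : 'rV[R]_3) : R := x 0 2.

(* On the axis r = 0, which is a null set, e_r and e_theta evaluate to 0. *)
Definition e_r (R : realType) (x : 'rV[R]_3) : 'rV[R]_3 :=
  \row_(i < 3) [:: x 0 0 / cyl_r x; x 0 1 / cyl_r x; 0]`_i.

Definition e_theta (R : realType) (x : 'rV[R]_3) : 'rV[R]_3 :=
  \row_(i < 3) [:: - (x 0 1 / cyl_r x); x 0 0 / cyl_r x; 0]`_i.

Definition e_z (R : realType) : 'rV[R]_3 := delta_mx 0 2.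

(* Velocity slices are L^infty functions, so the symmetry is an a.e. notion. *)
Definition axisymmetric (R : realType) (v : 'rV[R]_3 -> 'rV[R]_3) : Prop :=
  exists vr vtheta vz : R -> R -> R,
    {ae leb3 R, forall p, let x := vec3 p in
      v x = vr (cyl_r x) (cyl_z x) *: e_r x
            + vtheta (cyl_r x) (cyl_z x) *: e_theta x
            + vz (cyl_r x) (cyl_z x) *: e_z R}.

(* v^theta = v . e_theta *)
Definition swirl (R : realType) (v : 'rV[R]_3 -> 'rV[R]_3) (x : 'rV[R]_3) : R :=
  \sum_i v x 0 i * e_theta x 0 i.

Definition swirl_free (R : realType) (v : 'rV[R]_3 -> 'rV[R]_3) : Prop :=
  {ae leb3 R, forall p, swirl v (vec3 p) = 0}.

(* Main.v *)
Require Import Defs.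
From HB Require Import structures.
From mathcomp Require Import all_boot all_order all_algebra.
From mathcomp Require Import all_classical all_reals all_analysis measurable_realfun.
From mathcomp Require Import ring lra.
Set Implicit Arguments.
Unset Strict Implicit.
Unset Printing Implicit Defensive.
Import Order.TTheory GRing.Theory Num.Theory.
Import numFieldNormedType.Exports.
Local Open Scope classical_set_scope.
Local Open Scope ring_scope.

(** An axi-symmetric field without swirl is a field invariant under the
    reflections in all vertical planes through the axis.  Such a reflection maps
    bounded mild solutions to bounded mild solutions ([reflected_mild]), so it
    suffices that a bounded mild solution is determined by its final slice: the
    solution and its mirror images agree at time [T], hence at all times.

    Backward uniqueness ([backward_uniqueness]) comes from analyticity in time.
    A solution started at time [s] is followed through the function
    [m |-> (1 + m)^(-1/2) u (s + h / (1 + m))] of a parameter [m >= 0], where [m = 0]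
    is the final time of a short interval.  In rescaled time the heat and Oseen
    kernels depend on [m] only through polynomials in [1 + m] and factors
    [exp (- m rho)], against Gaussians [exp (- rho)] with [rho = |x - y|^2 / 4t].
    Their Taylor expansions in [m] therefore obey the same integral bounds as the
    kernels themselves, and the Picard iteration for the mild formula may be run
    in an algebra of jets in [m], normed by [jnorm] ([jnormM]).  It yields an
    expansion of the solution in powers of [m], with bounded coefficients
    ([analytic]).  If two solutions agree at the final time and the first [k]
    coefficients of their difference [w] vanish, then [w = O(m^k)], and the mild
    formula between [m] and [0] shows that the heat flow of [w] over a time
    comparable to [m h] is of size [O(m^(k + 1/2))]; hence the heat flow makes
    the coefficient of order [k] arbitrarily small at arbitrarily small times.  A
    bounded function with this property is zero ([determined]), because the heat
    flow is an approximate identity when tested on bounded open sets.  So all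
    coefficients vanish, and [w] vanishes on a time interval reaching backwards
    by a fixed proportion ([difference_vanishes]); such steps exhaust the interval
    of existence.

    The bounds need the Oseen kernel in closed form ([oseen_kernelE]).  Writing the
    Newtonian kernel as a superposition of Gaussians turns the potential of the
    Hessian of the heat kernel into an integral, over one real variable, of
    Gaussians times quadratic polynomials.  From it one reads off the
    bound [C / sqrt t] for the integral of the kernel ([integral_oseen_bound]) and
    its covariance under reflections ([oseen_quad_refl]).

    Since the slices of the solution are only defined up to null sets, the solution is
    first replaced by a jointly measurable and everywhere bounded field with the
    same slices ([bounded_version]), and the conclusion is reached through Fubini in the
    angle: for almost every point the velocity, turned back to a fixed meridian
    plane, is almost everywhere constant in the angle, and that constant provides
    the profiles ([axial_profiles]); one reflection then excludes swirl
    ([no_swirl]). *)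

(** * Jets in the time parameter *)

Section jets.
Context (R : realType).
Implicit Types (a b : nat -> R) (r m : R) (N n : nat).

(** A jet [a] stands for an analytic function of [m] near [0]: [a 0] is its value at
    the given [m], and [a n.+1] its Taylor coefficient of order [n] at [0], which does not
    depend on [m].  The norm measures the coefficients of order below [N] and the
    Taylor remainder at [m] against the radius [r]. *)
Definition jpoly N a m : R := \sum_(n < N) a n.+1 * m ^+ n.

Definition jnorm r m N a : R :=
  \sum_(n < N) r ^+ n * `|a n.+1| + (r / m) ^+ N * `|a 0%N - jpoly N a m|.

Definition jmul a b : nat -> R := fun n =>
  if n is n'.+1 then \sum_(i < n'.+1) a i.+1 * b (n' - i).+1 else a 0%N * b 0%N.

(** The jet of [exp (- m rho)]. *)
Definition jexp m (rho : R) : nat -> R := fun n =>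
  if n is n'.+1 then (- rho) ^+ n' / n'`!%:R else expR (- (m * rho)).

Definition jone_plus m : nat -> R := fun n =>
  match n with 0%N => 1 + m | 1%N => 1 | 2%N => 1 | _ => 0 end.

Lemma jnorm0n r m a : jnorm r m 0 a = `|a 0%N|.
Proof. by rewrite /jnorm /jpoly !big_ord0 expr0 mul1r add0r subr0. Qed.

Section fixed.
Variables (r m : R).
Hypotheses (m0 : 0 < m) (mr : m <= r).
Let r0 : 0 < r. Proof. exact: lt_le_trans mr. Qed.
Let rm1 : 1 <= r / m. Proof. by rewrite ler_pdivlMr// mul1r. Qed.

Lemma eq_jnorm N a b : (forall n, (n <= N)%N -> a n = b n) ->
  jnorm r m N a = jnorm r m N b.
Proof.
move=> ab; rewrite /jnorm; have -> : jpoly N a m = jpoly N b m.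
  by apply: eq_bigr => i _; rewrite ab.
by rewrite ab//; congr (_ + _); apply: eq_bigr => i _; rewrite ab.
Qed.

Lemma jnorm_ge0 N a : 0 <= jnorm r m N a.
Proof.
rewrite addr_ge0 ?mulr_ge0 ?exprn_ge0 ?divr_ge0 ?(ltW r0) ?(ltW m0)//.
by apply: sumr_ge0 => i _; rewrite mulr_ge0 ?exprn_ge0 ?(ltW r0).
Qed.

Lemma jnorm0 N : jnorm r m N (fun=> 0) = 0.
Proof.
rewrite /jnorm /jpoly !big1 ?subrr ?normr0 ?mulr0 ?addr0// => i _;
 by rewrite ?normr0 ?mulr0 ?mul0r.
Qed.

Lemma jpolyD N a b : jpoly N (fun n => a n + b n) m = jpoly N a m + jpoly N b m.
Proof. by rewrite /jpoly -big_split; apply: eq_bigr => i _; rewrite mulrDl. Qed.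

Lemma jpolyZ N (c : R) a : jpoly N (fun n => c * a n) m = c * jpoly N a m.
Proof. by rewrite /jpoly mulr_sumr; apply: eq_bigr => i _; rewrite mulrA. Qed.

Lemma jnormD N a b :
  jnorm r m N (fun n => a n + b n) <= jnorm r m N a + jnorm r m N b.
Proof.
rewrite /jnorm jpolyD addrACA lerD//.
  rewrite -big_split ler_sum//= => i _.
  by rewrite -mulrDr ler_wpM2l ?exprn_ge0 ?(ltW r0)// ler_normD.
rewrite -mulrDr ler_wpM2l ?exprn_ge0 ?divr_ge0 ?(ltW r0) ?(ltW m0)//.
by rewrite opprD addrACA ler_normD.
Qed.

Lemma jnormZ N (c : R) a : jnorm r m N (fun n => c * a n) = `|c| * jnorm r m N a.
Proof.
rewrite /jnorm jpolyZ -mulrBr normrM mulrDr; congr (_ + _); last by rewrite mulrCA.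
by rewrite mulr_sumr; apply: eq_bigr => i _; rewrite normrM mulrCA.
Qed.

Lemma jnormN N a : jnorm r m N (fun n => - a n) = jnorm r m N a.
Proof.
rewrite -[RHS]mul1r -(normrN1 R) -jnormZ; apply: eq_jnorm => n _.
by rewrite mulN1r.
Qed.

Lemma jnormB N a b :
  jnorm r m N (fun n => a n - b n) <= jnorm r m N a + jnorm r m N b.
Proof. by rewrite -[jnorm _ _ _ b]jnormN; exact: jnormD. Qed.

Lemma jnorm_sum_seq (I : Type) (s : seq I) N (F : I -> nat -> R) :
  jnorm r m N (fun n => \sum_(i <- s) F i n) <= \sum_(i <- s) jnorm r m N (F i).
Proof.
elim: s => [|i s IH].
  rewrite (@eq_jnorm _ _ (fun=> 0)) ?jnorm0 ?big_nil// => n _.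
  by rewrite big_nil.
rewrite (@eq_jnorm _ _ (fun n => F i n + \sum_(j <- s) F j n)); last first.
  by move=> n _; rewrite big_cons.
by rewrite big_cons (le_trans (jnormD _ _ _))// lerD2l.
Qed.

Lemma jnorm_coef N a n : (n < N)%N -> r ^+ n * `|a n.+1| <= jnorm r m N a.
Proof.
move=> nN; rewrite /jnorm (bigD1 (Ordinal nN))//= -addrA lerDl.
rewrite addr_ge0 ?mulr_ge0 ?exprn_ge0 ?divr_ge0 ?(ltW r0) ?(ltW m0)//.
by apply: sumr_ge0 => i _; rewrite mulr_ge0 ?exprn_ge0 ?(ltW r0).
Qed.

Lemma jnorm_rem N a : `|a 0%N - jpoly N a m| <= jnorm r m N a * (m / r) ^+ N.
Proof.
rewrite -ler_pdivrMr ?exprn_gt0 ?divr_gt0// -exprVn invf_div mulrC /jnorm.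
by rewrite lerDr sumr_ge0// => i _; rewrite mulr_ge0 ?exprn_ge0 ?(ltW r0).
Qed.

Lemma jnorm_jpoly N a : `|jpoly N a m| <= \sum_(n < N) r ^+ n * `|a n.+1|.
Proof.
rewrite (le_trans (ler_norm_sum _ _ _))// ler_sum// => i _.
rewrite normrM mulrC ler_wpM2r// normrX gtr0_norm//.
by apply: lerXn2r => //; rewrite nnegrE ltW.
Qed.

Lemma jnorm_val N a : `|a 0%N| <= jnorm r m N a.
Proof.
rewrite -[a 0%N](subrK (jpoly N a m)) addrC (le_trans (ler_normD _ _))//.
rewrite lerD ?jnorm_jpoly// ler_peMl//.
exact: exprn_ege1.
Qed.

Let sumpoly N (c : nat -> R) : {poly R} := \poly_(i < N) c i.

Let absM (c d : nat -> R) N n :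
  `|(sumpoly N c * sumpoly N d)`_n| <=
  (sumpoly N (fun i => `|c i|) * sumpoly N (fun i => `|d i|))`_n.
Proof.
rewrite !coefM (le_trans (ler_norm_sum _ _ _))// ler_sum// => i _.
rewrite normrM !coef_poly; case: ifP => _; case: ifP => _;
 by rewrite ?normr0 ?mul0r ?mulr0.
Qed.

Let hornerM_sum (c d : nat -> R) N (x : R) :
  (\sum_(i < N) c i * x ^+ i) * (\sum_(i < N) d i * x ^+ i) =
  \sum_(n < N + N) (sumpoly N c * sumpoly N d)`_n * x ^+ n.
Proof.
rewrite -(horner_poly N c) -(horner_poly N d) -hornerM.
have sz : (size (sumpoly N c * sumpoly N d)%R <= N + N)%N.
  rewrite (leq_trans (size_polyMleq _ _))//.
  by rewrite (leq_trans (leq_pred _))// leq_add// size_poly.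
exact: (horner_coef_wide x sz).
Qed.

(** The norm is submultiplicative: the products of degree at least [N] are
   carried into the remainder, and there [m <= r] absorbs the excess degree. *)
Lemma jnormM N a b : jnorm r m N (jmul a b) <= jnorm r m N a * jnorm r m N b.
Proof.
pose a' i := a i.+1; pose b' i := b i.+1.
pose d n := (sumpoly N a' * sumpoly N b')`_n.
pose D n := (sumpoly N (fun i => `|a' i|) * sumpoly N (fun i => `|b' i|))`_n.
have dE n : (n < N)%N -> jmul a b n.+1 = d n.
  move=> nN; rewrite /d coefM /=; apply: eq_bigr => i _.
  rewrite !coef_poly (leq_ltn_trans _ nN) ?(leq_ltn_trans _ nN)//.
    exact: leq_subr.
  by rewrite -ltnS.
have dD n : `|d n| <= D n by exact: absM.
have D0 n : 0 <= D n by rewrite (le_trans _ (dD n)).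
set sa := \sum_(n < N) r ^+ n * `|a n.+1|.
set sb := \sum_(n < N) r ^+ n * `|b n.+1|.
have sE : sa * sb = \sum_(n < N + N) D n * r ^+ n.
  rewrite -(hornerM_sum (fun i => `|a' i|) (fun i => `|b' i|)).
  by congr (_ * _); apply: eq_bigr => i _; rewrite mulrC.
pose Ra := a 0%N - jpoly N a m; pose Rb := b 0%N - jpoly N b m.
have rem : jmul a b 0%N - jpoly N (jmul a b) m =
    \sum_(n < N) d (N + n)%N * m ^+ (N + n) +
    (jpoly N a m * Rb + Ra * jpoly N b m + Ra * Rb).
  have -> : jpoly N (jmul a b) m = \sum_(n < N) d n * m ^+ n.
    by apply: eq_bigr => i _; rewrite dE.
  have : jpoly N a m * jpoly N b m = \sum_(n < N) d n * m ^+ n +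
    \sum_(n < N) d (N + n)%N * m ^+ (N + n).
    by have := hornerM_sum a' b' N m; rewrite big_split_ord/=; exact.
  by rewrite /jmul /Ra /Rb => E; lra.
have le1 : \sum_(n < N) r ^+ n * `|jmul a b n.+1| <= \sum_(n < N) D n * r ^+ n.
  apply: ler_sum => i _; rewrite dE// mulrC ler_wpM2r//.
  by rewrite exprn_ge0// ltW.
have rmN0 : 0 <= (r / m) ^+ N by rewrite exprn_ge0// divr_ge0// ltW.
have le2 : (r / m) ^+ N * `|\sum_(n < N) d (N + n)%N * m ^+ (N + n)| <=
   \sum_(n < N) D (N + n)%N * r ^+ (N + n).
  rewrite (le_trans (ler_wpM2l rmN0 (ler_norm_sum _ _ _)))// mulr_sumr.
  apply: ler_sum => i _; rewrite normrM mulrCA ler_pM ?mulr_ge0//.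
  rewrite normrX (gtr0_norm m0) !exprD mulrA -exprMn divfK ?gt_eqF//.
  rewrite ler_wpM2l ?exprn_ge0 ?(ltW r0)//.
  by apply: lerXn2r => //; rewrite nnegrE ltW.
rewrite {1}/jnorm rem.
apply: (@le_trans _ _ (sa * sb + (r / m) ^+ N *
   `|jpoly N a m * Rb + Ra * jpoly N b m + Ra * Rb|)).
  have -> : sa * sb = \sum_(n < N) D n * r ^+ n +
     \sum_(n < N) D (N + n)%N * r ^+ (N + n) by rewrite sE big_split_ord.
  rewrite -[leRHS]addrA; apply: lerD; first exact: le1.
  rewrite (le_trans (ler_wpM2l rmN0 (ler_normD _ _)))// mulrDr.
  by apply: lerD; first exact: le2.
have -> : jnorm r m N a = sa + (r / m) ^+ N * `|Ra| by [].
have -> : jnorm r m N b = sb + (r / m) ^+ N * `|Rb| by [].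
set q := (r / m) ^+ N.
have q1 : 1 <= q by exact: exprn_ege1.
have la : `|jpoly N a m| <= sa := jnorm_jpoly N a.
have lb : `|jpoly N b m| <= sb := jnorm_jpoly N b.
have sa0 : 0 <= sa by rewrite (le_trans _ la).
have h1 : `|jpoly N a m * Rb| <= sa * `|Rb| by rewrite normrM ler_wpM2r.
have h2 : `|Ra * jpoly N b m| <= `|Ra| * sb by rewrite normrM ler_wpM2l.
have h3 : `|Ra * Rb| <= q * (`|Ra| * `|Rb|).
  by rewrite normrM ler_peMl// mulr_ge0.
have h : q * `|jpoly N a m * Rb + Ra * jpoly N b m + Ra * Rb| <=
    q * (sa * `|Rb| + `|Ra| * sb + q * (`|Ra| * `|Rb|)).
  rewrite ler_wpM2l// (le_trans (ler_normD _ _))// lerD//.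
  by rewrite (le_trans (ler_normD _ _))// lerD.
apply: (le_trans (lerD (lexx _) h)).
by rewrite le_eqVlt; apply/orP; left; apply/eqP; ring.
Qed.

Lemma jnorm_one_plus N : jnorm r m N (jone_plus m) <= 1 + r.
Proof.
rewrite /jnorm /jpoly.
case: N => [|[|N]].
- rewrite !big_ord0 expr0 mul1r add0r subr0 /= ger0_norm; first by rewrite lerD2l.
  by rewrite addr_ge0// ltW.
- rewrite !big_ord1/= !expr0 expr1 !mul1r normr1 lerD2l addrAC subrr add0r.
  by rewrite gtr0_norm// divfK// gt_eqF.
- rewrite !big_ord_recl/= !expr0 !expr1 !mul1r normr1 mulr1 !big1 ?addr0.
  + by rewrite opprD addrACA !subrr addr0 normr0 mulr0 addr0.
  + by move=> i _; rewrite mul0r.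
  + by move=> i _; rewrite normr0 mulr0.
Qed.

Let absorb N i : (r / m) ^+ N * m ^+ (N + i) <= r ^+ (N + i).
Proof.
rewrite !exprD mulrA -exprMn divfK ?gt_eqF// ler_wpM2l ?exprn_ge0 ?(ltW r0)//.
by apply: lerXn2r => //; rewrite nnegrE ltW.
Qed.

(** The remainder of the exponential series at [m <= r] is dominated by the tail of
    the series of [exp (r rho)]. *)
Lemma jnorm_exp N (rho : R) : 0 <= rho -> jnorm r m N (jexp m rho) <= expR (r * rho).
Proof.
move=> rho0.
have rmN0 : 0 <= (r / m) ^+ N by rewrite exprn_ge0// divr_ge0// ltW.
pose S M : R := \sum_(i < M) (- (m * rho)) ^+ i / i`!%:R.
pose P M : R := \sum_(i < M) (r * rho) ^+ i / i`!%:R.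
have Pn0 i : 0 <= (r * rho) ^+ i / i`!%:R.
  by rewrite divr_ge0// exprn_ge0// mulr_ge0// ltW.
have PE : series (exp_coeff (r * rho)) = P.
  by apply/funext => M; rewrite /series/= big_mkord; apply: eq_bigr.
have SE : series (exp_coeff (- (m * rho))) = S.
  by apply/funext => M; rewrite /series/= big_mkord; apply: eq_bigr.
have cP : P @ \oo --> expR (r * rho).
  by rewrite -PE; exact: (is_cvg_series_exp_coeff (r * rho)).
have cS : S @ \oo --> expR (- (m * rho)).
  by rewrite -SE; exact: (is_cvg_series_exp_coeff (- (m * rho))).
have PleE M : P M <= expR (r * rho).
  rewrite -(cvg_lim _ cP)//; apply: nondecreasing_cvgn_le; last first.
    by apply/cvg_ex; exists (expR (r * rho)).
  by apply/nondecreasing_seqP => n; rewrite /P big_ord_recr/= lerDl.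
have jS : jpoly N (jexp m rho) m = S N.
  apply: eq_bigr => i _ /=; rewrite mulrAC; congr (_ / _).
  by rewrite -exprMn mulNr mulrC.
have -> : jnorm r m N (jexp m rho) =
    P N + (r / m) ^+ N * `|expR (- (m * rho)) - S N|.
  rewrite /jnorm jS /=; congr (_ + _); apply: eq_bigr => i _.
  rewrite normrM normrX normrN (ger0_norm rho0) exprMn mulrA; congr (_ * _).
  by rewrite ger0_norm// invr_ge0.
have key M : P N + (r / m) ^+ N * `|S (N + M)%N - S N| <= expR (r * rho).
  apply: le_trans (PleE (N + M)%N); rewrite /P /S !big_split_ord/= lerD2l.
  rewrite addrAC subrr add0r (le_trans (ler_wpM2l rmN0 (ler_norm_sum _ _ _)))//.
  rewrite mulr_sumr; apply: ler_sum => i _.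
  rewrite normrM normrX normrN mulrA.
  rewrite (@ger0_norm _ _^-1) ?invr_ge0// ler_wpM2r ?invr_ge0//.
  rewrite ger0_norm ?mulr_ge0 ?(ltW m0)// !exprMn mulrA.
  by rewrite ler_wpM2r ?exprn_ge0 -?exprMn ?absorb.
have cK : P N + (r / m) ^+ N * `|S (N + M)%N - S N| @[M --> \oo] -->
   P N + (r / m) ^+ N * `|expR (- (m * rho)) - S N|.
  apply: cvgD; first exact: cvg_cst.
  apply: cvgM; first exact: cvg_cst.
  apply: cvg_norm; apply: cvgB; last exact: cvg_cst.
  by apply: (cvg_comp (addn N) S) cS; exact: cvg_addnl.
rewrite -(cvg_lim _ cK)//; apply: limr_le.
  by apply/cvg_ex; eexists; exact: cK.
by apply: nearW.
Qed.

End fixed.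
End jets.

(** * Complements on product measures and integrals *)

Section prodm.
Context d1 d2 (T1 : measurableType d1) (T2 : measurableType d2) (R : realType)
  (m1 : {sigma_finite_measure set T1 -> \bar R})
  (m2 : {sigma_finite_measure set T2 -> \bar R}).

(** The product measure carries only a measure structure; the copy [prodm] is again
    sigma-finite, so that products can be iterated. *)
Definition prodm : set (T1 * T2) -> \bar R := (m1 \x m2)%E.

HB.instance Definition _ := Measure.on prodm.

Let prodm_sigma_finite : sigma_finite setT prodm.
Proof.
have /sigma_finiteP[F [TF ndF Foo]] := sigma_finiteT m1.
have /sigma_finiteP[G [TG ndG Goo]] := sigma_finiteT m2.
exists (fun n => F n `*` G n).
  rewrite -setXTT TF TG predeqE => -[x y]; split.
    move=> [/= [n _ Fnx] [k _ Gky]]; exists (maxn n k) => //; split.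
    - by move: x Fnx; exact/subsetPset/ndF/leq_maxl.
    - by move: y Gky; exact/subsetPset/ndG/leq_maxr.
  by move=> [n _ []/= ? ?]; split; exists n.
move=> k; have [? ?] := Foo k; have [? ?] := Goo k.
split; first exact: measurableX.
by rewrite /prodm product_measure1E// lte_mul_pinfty// ge0_fin_numE.
Qed.

HB.instance Definition _ :=
  Measure_isSigmaFinite.Build _ _ _ prodm prodm_sigma_finite.

End prodm.

Section pushforward.
Context d1 d2 (T1 : measurableType d1) (T2 : measurableType d2) (R : realType)
  (mu : {measure set T1 -> \bar R}) (phi : T1 -> T2) (mphi : measurable_fun setT phi).

Definition pushm : {measure set T2 -> \bar R}.
Proof. by refine (pushforward mu phi : {measure set T2 -> \bar R}). Defined.

Lemma ge0_integral_pushm (f : T2 -> \bar R) :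
  measurable_fun setT f -> (forall y, 0 <= f y)%E ->
  (\int[pushm]_y f y = \int[mu]_x f (phi x))%E.
Proof. by move=> mf f0; rewrite ge0_integral_pushforward. Qed.

End pushforward.

Section integral_bounds.
Context d (T : measurableType d) (R : realType) (mu : {measure set T -> \bar R}).
Implicit Types (f g : T -> R) (C : R).

Lemma integrable_le f g C : measurable_fun setT f -> measurable_fun setT g ->
  (forall x, `|f x| <= g x) -> (\int[mu]_x (g x)%:E <= C%:E)%E ->
  mu.-integrable setT (EFin \o f).
Proof.
move=> mf mg fg gC; apply/integrableP; split; first exact/measurable_EFinP.
apply: (@le_lt_trans _ _ (\int[mu]_x (g x)%:E)%E); last first.
  by rewrite (le_lt_trans gC)// ltry.
apply: ge0_le_integral => //.
- apply: measurableT_comp => //; exact/measurable_EFinP.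
- exact/measurable_EFinP.
- by move=> x _; rewrite lee_fin.
Qed.

Lemma Rintegral_le f C : measurable_fun setT f ->
  (\int[mu]_x (`|f x|)%:E <= C%:E)%E -> `|\int[mu]_x f x| <= C.
Proof.
move=> mf fC.
have If : mu.-integrable setT (EFin \o f).
  by apply: (@integrable_le f (fun x => `|f x|) C) => //; exact: measurableT_comp.
by rewrite -lee_fin (EFin_normr_Rintegral _ If)// (le_trans _ fC)// le_abse_integral//;
  exact/measurable_EFinP.
Qed.

Lemma integrableRD f g : mu.-integrable setT (EFin \o f) ->
  mu.-integrable setT (EFin \o g) ->
  mu.-integrable setT (EFin \o (fun x => f x + g x)).
Proof. by move=> If Ig; have := integrableD measurableT If Ig. Qed.

Lemma integrableRB f g : mu.-integrable setT (EFin \o f) ->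
  mu.-integrable setT (EFin \o g) ->
  mu.-integrable setT (EFin \o (fun x => f x - g x)).
Proof. by move=> If Ig; have := integrableB measurableT If Ig. Qed.

Lemma integrableRZ (k : R) f : mu.-integrable setT (EFin \o f) ->
  mu.-integrable setT (EFin \o (fun x => k * f x)).
Proof. by move=> If; have := integrableZl measurableT k If. Qed.

Lemma Rintegral_sum (I : Type) (s : seq I) (F : I -> T -> R) :
  (forall i, mu.-integrable setT (EFin \o F i)) ->
  mu.-integrable setT (EFin \o (fun x => \sum_(i <- s) F i x)) /\
  \int[mu]_x (\sum_(i <- s) F i x) = \sum_(i <- s) \int[mu]_x F i x.
Proof.
move=> IF; elim: s => [|i s [IH1 IH2]].
  have e x : \sum_(i <- [::]) F i x = 0 by rewrite big_nil.
  split.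
    apply: (@eq_integrable _ _ _ _ _ _ (cst 0%E)) => //; last exact: integrable0.
    by move=> x _; rewrite /= e.
  by under eq_Rintegral do rewrite e; rewrite big_nil Rintegral_cst// mul0r.
have e x : \sum_(j <- i :: s) F j x = F i x + \sum_(j <- s) F j x by rewrite big_cons.
split.
  rewrite (_ : (fun x => _) = fun x => F i x + \sum_(j <- s) F j x).
    exact: integrableRD.
  by apply/funext.
by under eq_Rintegral do rewrite e; rewrite RintegralD// IH2 big_cons.
Qed.

Lemma measurable_jnorm (r m : R) N (f : T -> nat -> R) :
  (forall n, measurable_fun setT (f ^~ n)) ->
  measurable_fun setT (fun x => jnorm r m N (f x)).
Proof.
move=> mf; rewrite /jnorm /jpoly; apply: measurable_funD.
  apply: measurable_sum => i; apply: measurable_funM; first exact: measurable_cst.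
  exact: measurableT_comp.
apply: measurable_funM; first exact: measurable_cst.
apply: measurableT_comp => //; apply: measurable_funB => //.
by apply: measurable_sum => i; apply: measurable_funM => //; exact: measurable_cst.
Qed.

(** Minkowski's inequality: [jnorm] is a sum of absolute values of linear forms. *)
Lemma jnorm_integral (r m : R) N (f : T -> nat -> R) C :
  0 < m -> m <= r ->
  (forall n, measurable_fun setT (f ^~ n)) ->
  (\int[mu]_x (jnorm r m N (f x))%:E <= C%:E)%E ->
  (forall n, (n <= N)%N -> mu.-integrable setT (EFin \o f ^~ n)) /\
  jnorm r m N (fun n => \int[mu]_x f x n) <= C.
Proof.
move=> m0 mr mf fC; have r0 : 0 < r by exact: lt_le_trans mr.
have mj := measurable_jnorm r m N mf.
have Ij : mu.-integrable setT (EFin \o (fun x => jnorm r m N (f x))).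
  apply: (integrable_le (g := fun x => jnorm r m N (f x)) _ _ _ fC) => // x.
  by rewrite ger0_norm ?jnorm_ge0.
have If n : (n <= N)%N -> mu.-integrable setT (EFin \o f ^~ n).
  case: n => [_|n nN].
    apply: (integrable_le _ _ _ fC) => // x; exact: jnorm_val.
  have := integrableZl (measurableT) ((r ^+ n)^-1) Ij.
  apply: le_integrable => //; first exact/measurable_EFinP.
  move=> x _ /=; rewrite lee_fin [leRHS]ger0_norm ?mulr_ge0 ?invr_ge0 ?exprn_ge0 ?jnorm_ge0 ?(ltW r0)//.
  by rewrite mulrC ler_pdivlMr ?exprn_gt0// mulrC jnorm_coef.
split=> //.
pose g x := f x 0%N - jpoly N (f x) m.
have Ipoly : mu.-integrable setT (EFin \o (fun x => jpoly N (f x) m)) /\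
   \int[mu]_x jpoly N (f x) m = jpoly N (fun n => \int[mu]_x f x n) m.
  have [|I1 I2] := @Rintegral_sum _ (index_enum 'I_N) (fun i x => f x i.+1 * m ^+ i).
    move=> i; rewrite (_ : _ \o _ = (fun x => (f x i.+1)%:E * (m ^+ i)%:E)%E)//.
    by apply: integrableZr => //; exact: If.
  split => //; rewrite I2; apply: eq_bigr => i _.
  by rewrite RintegralZr//; exact: If.
have Ig : mu.-integrable setT (EFin \o g).
  by apply: integrableRB => //; [exact: If|case: Ipoly].
have gE : \int[mu]_x g x = \int[mu]_x f x 0%N - jpoly N (fun n => \int[mu]_x f x n) m.
  by rewrite /g RintegralB//; [case: Ipoly => _ ->|exact: If|case: Ipoly].
have IF i : mu.-integrable setT (EFin \o (fun x => r ^+ i * `|f x i.+1|)) \/ (N <= i)%N.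
  case: (leqP N i) => iN; [by right|left].
  rewrite (_ : _ \o _ = (fun x => (r ^+ i)%:E * (`|f x i.+1|)%:E)%E)//.
  by apply: integrableZl => //; apply: integrable_norm; exact: If.
have [|J1 J2] := @Rintegral_sum _ (index_enum 'I_N) (fun i x => r ^+ i * `|f x i.+1|).
  by move=> i; case: (IF i) => //; rewrite leqNgt ltn_ord.
have J3 : mu.-integrable setT (EFin \o (fun x => (r / m) ^+ N * `|g x|)).
  rewrite (_ : _ \o _ = (fun x => ((r / m) ^+ N)%:E * (`|g x|)%:E)%E)//.
  by apply: integrableZl => //; apply: integrable_norm.
have -> : jnorm r m N (fun n => \int[mu]_x f x n) =
   \sum_(i < N) r ^+ i * `|\int[mu]_x f x i.+1| + (r / m) ^+ N * `|\int[mu]_x g x|.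
  by rewrite gE.
apply: (@le_trans _ _ (\int[mu]_x jnorm r m N (f x))).
  rewrite (_ : \int[mu]_x jnorm r m N (f x) =
    \sum_(i < N) \int[mu]_x (r ^+ i * `|f x i.+1|) +
    \int[mu]_x ((r / m) ^+ N * `|g x|)); last first.
    by rewrite -J2 -(RintegralD measurableT J1 J3).
  apply: lerD.
    apply: ler_sum => i _; rewrite RintegralZl//; last first.
      by apply: integrable_norm; exact: If.
    rewrite ler_wpM2l ?exprn_ge0 ?(ltW r0)//; apply: le_normr_Rintegral => //; exact: If.
  rewrite RintegralZl//; last exact: integrable_norm.
  rewrite ler_wpM2l ?exprn_ge0 ?divr_ge0 ?(ltW r0) ?(ltW m0)//.
  exact: le_normr_Rintegral.
rewrite (le_trans (ler_norm _))// Rintegral_le//.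
by under eq_integral do rewrite ger0_norm ?jnorm_ge0//.
Qed.

End integral_bounds.

Section parametric.
Context d1 d2 (T1 : measurableType d1) (T2 : measurableType d2) (R : realType)
  (m1 : {sigma_finite_measure set T1 -> \bar R})
  (m2 : {sigma_finite_measure set T2 -> \bar R}).

Lemma measurable_Rintegral1 (f : T1 * T2 -> R) : measurable_fun setT f ->
  measurable_fun setT (fun x => \int[m2]_y f (x, y)).
Proof.
move=> mf.
have mE : measurable_fun setT (EFin \o f) by exact/measurable_EFinP.
apply: measurableT_comp; first exact: fine_measurable.
pose Fp x := (\int[m2]_y (EFin \o f)^\+ (x, y))%E.
pose Fm x := (\int[m2]_y (EFin \o f)^\- (x, y))%E.
rewrite (_ : (fun x => _) = Fp \- Fm)%E.
  apply: emeasurable_funB; apply: measurable_fun_fubini_tonelli_F => //.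
  - exact: measurable_funepos.
  - exact: measurable_funeneg.
apply/funext => x; rewrite integralE /Fp /Fm.
by congr (_ - _)%E; apply: eq_integral => y _; rewrite ?funeposE ?funenegE.
Qed.

(** Tonelli bound for a double integral, the second variable outermost. *)
Lemma prodm_integral_le (f : T1 * T2 -> R) (C : R) (g : T2 -> R) :
  measurable_fun setT f -> (forall z, 0 <= f z) -> measurable_fun setT g ->
  (forall y, (\int[m1]_x (f (x, y))%:E <= (g y)%:E)%E) ->
  (\int[m2]_y (g y)%:E <= C%:E)%E ->
  (\int[prodm m1 m2]_z (f z)%:E <= C%:E)%E.
Proof.
move=> mf f0 mg fg gC; apply: le_trans gC.
have mE : measurable_fun setT (EFin \o f) by exact/measurable_EFinP.
have -> : (\int[prodm m1 m2]_z (f z)%:E = \int[m2]_y \int[m1]_x (f (x, y))%:E)%E.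
  by apply: (fubini_tonelli2 (EFin \o f)) => // z; rewrite lee_fin.
apply: ge0_le_integral => //.
- by move=> y _; apply: integral_ge0 => x _; rewrite lee_fin.
- apply: (measurable_fun_fubini_tonelli_G (EFin \o f)) => // z.
- exact/measurable_EFinP.
Qed.

Lemma integrable_prodm2 (f : T1 * T2 -> R) :
  (prodm m1 m2).-integrable setT (EFin \o f) ->
  (forall y, m1.-integrable setT (fun x => (f (x, y))%:E)) ->
  m2.-integrable setT (EFin \o (fun y => \int[m1]_x f (x, y))).
Proof.
move=> If Iy.
have mf : measurable_fun setT (EFin \o f) := measurable_int _ If.
have mG := measurable_fubini_G If.
apply: (@eq_integrable _ _ _ m2 _ _ (fubini_G m1 (EFin \o f))) => //.
  by move=> y _; rewrite /fubini_G /= /Rintegral fineK//; exact: integrable_fin_num.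
apply/integrableP; split => //.
have fin := (@integrable21ltyP _ _ _ _ _ m1 m2 _ mf).1 If.
apply: le_lt_trans fin; apply: ge0_le_integral => //.
- exact: measurableT_comp.
- apply: (measurable_fun_fubini_tonelli_G (abse \o (EFin \o f))).
  + exact: measurableT_comp.
  + by move=> z; exact: abse_ge0.
- move=> y _; apply: le_abse_integral => //.
  by have /integrableP[] := Iy y.
Qed.

Lemma prodm_Rintegral (f : T1 * T2 -> R) :
  (prodm m1 m2).-integrable setT (EFin \o f) ->
  (forall y, m1.-integrable setT (fun x => (f (x, y))%:E)) ->
  \int[m2]_y (\int[m1]_x f (x, y)) = \int[prodm m1 m2]_z f z.
Proof.
move=> If Iy; rewrite [RHS]/Rintegral -[X in _ = fine X](integral21_prod_meas1 If).
congr fine; apply: eq_integral => y _.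
by rewrite /fubini_G /Rintegral fineK//; exact: integrable_fin_num.
Qed.

End parametric.

(** * Lebesgue measure on the line *)

Section line.
Context (R : realType).
Local Notation lam := (@lebesgue_measure R).

Let phi (s a : R) (x : measurableTypeR R) : measurableTypeR R := s + a * (x : R).

Let mphi s a : measurable_fun setT (phi s a).
Proof. by apply: measurable_funD => //; apply: measurable_funM. Qed.

(* Both sides agree on half-open intervals, which determines the measure. *)
Let lebesgue_affine s (a : {nonneg R}) : 0 < a%:num -> forall A, measurable A ->
  lam A = mscale a (pushm lam (mphi s a%:num)) A.
Proof.
move=> a0; apply: lebesgue_measure_unique => _ [[c d]] _ <-.
change (lam `]c, d]%classic =
  a%:num%:E * lam (phi s a%:num @^-1` `]c, d]%classic))%E.
have -> : phi s a%:num @^-1` `]c, d] = `](c - s) / a%:num, (d - s) / a%:num]%classic.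
  apply/seteqP; split => x /=; rewrite !in_itv/= ltr_pdivrMr// ler_pdivlMr//;
    rewrite /phi; lra.
have := lebesgue_measure_itv `]c, d]; rewrite /= => ->.
have := lebesgue_measure_itv `](c - s) / a%:num, (d - s) / a%:num]; rewrite /= => ->.
rewrite !lte_fin ltr_pM2r ?invr_gt0// ltrD2r; case: ifP => _; last by rewrite mule0.
by rewrite -!EFinD -EFinM; congr EFin; field; rewrite gt_eqF.
Qed.

Lemma ge0_integral_affine_pos (s a : R) (f : R -> \bar R) : 0 < a ->
  measurable_fun setT f -> (forall x, 0 <= f x)%E ->
  (\int[lam]_x f x = a%:E * \int[lam]_x f (s + a * x)%R)%E.
Proof.
move=> a0 mf f0.
pose a' := NngNum (ltW a0).
rewrite (eq_measure_integral (mscale a' (pushm lam (mphi s a)))); last first.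
  by move=> A mA _; exact: (lebesgue_affine s (a := a') a0 mA).
by rewrite ge0_integral_mscale//= ge0_integral_pushm.
Qed.

Lemma ge0_integral_opp (f : R -> \bar R) :
  measurable_fun setT f -> (forall x, 0 <= f x)%E ->
  (\int[lam]_x f x = \int[lam]_x f (- x)%R)%E.
Proof.
move=> mf f0.
have mN : measurable_fun setT (-%R : measurableTypeR R -> measurableTypeR R) by [].
rewrite -(ge0_integral_pushm _ mN)//.
by apply: eq_measure_integral => //= A mA _; exact/esym/lebesgue_measureN.
Qed.

Lemma ge0_integral_affine (s a : R) (f : R -> \bar R) : a != 0 ->
  measurable_fun setT f -> (forall x, 0 <= f x)%E ->
  (\int[lam]_x f x = `|a|%:E * \int[lam]_x f (s + a * x)%R)%E.
Proof.
move=> a0 mf f0; have [ap|an|] := ltgtP 0 a; last by move/eqP; rewrite eq_sym (negbTE a0).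
  by rewrite gtr0_norm// -ge0_integral_affine_pos.
rewrite ltr0_norm// [in RHS]ge0_integral_opp//; last first.
  apply: (measurableT_comp mf); exact: (mphi s a).
under [in RHS]eq_integral do rewrite mulrN -mulNr.
by rewrite -ge0_integral_affine_pos// oppr_gt0.
Qed.

Lemma Rintegral_affine (s a : R) (f : R -> R) : a != 0 ->
  measurable_fun setT f -> lam.-integrable setT (fun x => (f (s + a * x))%:E) ->
  lam.-integrable setT (EFin \o f) /\
  \int[lam]_x f x = `|a| * \int[lam]_x f (s + a * x).
Proof.
move=> a0 mf If.
have mE : measurable_fun setT (EFin \o f) by exact/measurable_EFinP.
split.
  apply/integrableP; split => //.
  rewrite (ge0_integral_affine s a0)//; last exact: measurableT_comp.
  by move/integrableP : If => [_ If]; rewrite lte_mul_pinfty.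
rewrite /Rintegral [in LHS]integralE [in RHS]integralE.
have Pp := integrable_pos_fin_num measurableT If.
have Pm := integrable_neg_fin_num measurableT If.
have -> : (\int[lam]_x (EFin \o f)^\+ x =
   `|a|%:E * \int[lam]_x ((fun x => (f (s + a * x))%:E)^\+ x))%E.
  rewrite (ge0_integral_affine s a0)//; last exact: measurable_funepos.
  by congr (_ * _)%E; apply: eq_integral => x _; rewrite !funeposE.
have -> : (\int[lam]_x (EFin \o f)^\- x =
   `|a|%:E * \int[lam]_x ((fun x => (f (s + a * x))%:E)^\- x))%E.
  rewrite (ge0_integral_affine s a0)//; last exact: measurable_funeneg.
  by congr (_ * _)%E; apply: eq_integral => x _; rewrite !funenegE.
by rewrite -(fineK Pp) -(fineK Pm) -!EFinM -!EFinB/= mulrBr.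
Qed.

Lemma measurable_invR : measurable_fun setT (@GRing.inv R).
Proof.
rewrite -(setvU [set (0 : R)]); apply/measurable_funU => //.
  exact: measurableC.
split; last exact: measurable_fun_set1.
apply: open_continuous_measurable_fun.
  by apply: closed_openC; exact: closed_eq.
by move=> x; rewrite inE/= => /eqP x0; exact: inv_continuous.
Qed.

Lemma measurable_sqrtR : measurable_fun setT (@Num.sqrt R).
Proof. by apply: continuous_measurable_fun; exact: sqrt_continuous. Qed.

(** The singularity is approached through the intervals ending at
    [th - th / (n + 2)], where the primitive [- 2 sqrt (th - x)] is regular. *)
Lemma integral_inv_sqrt (th : R) : 0 < th ->
  (\int[lam]_x (if 0 < x < th then (Num.sqrt (th - x))^-1 else 0)%:E
    <= (2 * Num.sqrt th)%:E)%E.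
Proof.
move=> th0.
pose g (x : R) : R := if 0 < x < th then (Num.sqrt (th - x))^-1 else 0.
have g0 x : 0 <= g x by rewrite /g; case: ifP => // _; rewrite invr_ge0.
have mg : measurable_fun setT g.
  apply: measurable_fun_ifT => //.
    by apply: measurable_and; apply: measurable_fun_ltr.
  apply: measurableT_comp => //.
    exact: measurable_invR.
  apply: measurableT_comp; first exact: measurable_sqrtR.
  exact: measurable_funB.
pose b n := th - th / n.+2%:R.
have bth n : b n < th by rewrite /b gtrBl divr_gt0.
have b0 n : 0 < b n.
  by rewrite subr_gt0 ltr_pdivrMr// ltr_pMr// ltr1n.
have bmono n m : (n <= m)%N -> b n <= b m.
  by move=> nm; rewrite lerD2l lerN2 ler_pM2l// lef_pV2 ?posrE// ler_nat !ltnS.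
pose f n (x : R) : \bar R := if x <= b n then (g x)%:E else 0%E.
have mf n : measurable_fun setT (f n).
  apply: measurable_fun_ifT => //; last exact/measurable_EFinP.
  exact: measurable_fun_ler.
have f0 n x : (0 <= f n x)%E by rewrite /f; case: ifP => // _; rewrite lee_fin.
have fmono x : {homo f^~ x : n m / (n <= m)%N >-> (n <= m)%E}.
  move=> n m nm; rewrite /f; case: ifP => [xb|_]; last exact: f0.
  by rewrite (le_trans xb (bmono _ _ nm)).
have flim x : limn (f^~ x) = (g x)%:E.
  apply: cvg_lim => //.
  have [xth|thx] := ltP x th; last first.
    have -> : f^~ x = fun=> (g x)%:E.
      apply/funext => n; rewrite /f /g [x < th]ltNge thx andbF.
      by case: ifP.
    exact: cvg_cst.
  have cb : b @ \oo --> th.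
    rewrite /b -[X in _ --> X]subr0; apply: cvgB; first exact: cvg_cst.
    rewrite -(mulr0 th); apply: cvgM; first exact: cvg_cst.
    apply/gtr0_cvgV0; first by near=> n.
    apply/cvgryPge => A; near=> n.
    have : A <= n%:R by near: n; exact: nbhs_infty_ger.
    by move/le_trans; apply; rewrite ler_nat -addn2 leq_addr.
  apply: cvg_near_cst; near=> n; rewrite /f.
  suff -> : x <= b n by [].
  by near: n; apply: (cvgr_ge _ cb).
rewrite (_ : (\int[lam]_x _ = \int[lam]_x (limn (f^~ x)))%E); last first.
  by apply: eq_integral => x _; rewrite flim.
have cint := @cvg_monotone_convergence _ _ R lam setT measurableT f mf
  (fun n x _ => f0 n x) (fun x _ => fmono x).
rewrite -(cvg_lim _ cint)//; apply: lime_le; first by apply/cvg_ex; eexists; exact: cint.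
apply: nearW => n.
pose F (x : R) : R := - (2 * Num.sqrt (th - x)).
have dF x : x < th -> is_derive x 1 F ((Num.sqrt (th - x))^-1).
  move=> xth; rewrite /F.
  have xp : 0 < th - x by rewrite subr_gt0.
  have d1 : is_derive x (1:R) (fun y => th - y) (-1).
    by rewrite -(sub0r (1 : R)); exact: is_deriveB.
  have d2 := is_derive1_sqrt xp.
  have d3 : is_derive x (1:R) (fun y => Num.sqrt (th - y))
      ((2 * Num.sqrt (th - x))^-1 * -1).
    exact: (@is_derive1_comp _ Num.sqrt (fun y : R => th - y) x _ _ d2 d1).
  have d4 : is_derive x (1:R) (fun y => - (2 * Num.sqrt (th - y)))
      (- (2 * ((2 * Num.sqrt (th - x))^-1 * -1))).
    by apply: is_deriveN; apply: is_deriveZ.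
  apply: (is_derive_eq d4); field; by rewrite gt_eqF// sqrtr_gt0.
have cs x : x < th -> {for x, continuous (fun y => (Num.sqrt (th - y))^-1)}.
  move=> xth; have xp : 0 < th - x by rewrite subr_gt0.
  apply: cvgV; first by rewrite gt_eqF// sqrtr_gt0.
  apply: continuous_comp; last exact: sqrt_continuous.
  by apply: cvgB; [exact: cvg_cst|exact: cvg_id].
have cF x : x < th -> {for x, continuous F}.
  by move=> xth; apply/differentiable_continuous/derivable1_diffP; case: (dF x xth).
have E : (\int[lam]_(x in `[0%R, b n]) ((Num.sqrt (th - x))^-1)%R%:E =
   (F (b n))%:E - (F 0%R)%:E)%E.
  apply: continuous_FTC2 => //.
  - apply: continuous_in_subspaceT => x; rewrite inE/= in_itv/= => /andP[_ xb].
    exact/cs/(le_lt_trans xb).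
  - split.
    + move=> x; rewrite in_itv/= => /andP[_ xb].
      by case: (dF x (lt_trans xb (bth n))).
    + by apply: cvg_at_right_filter; exact: cF.
    + by apply: cvg_at_left_filter; exact: cF.
  - move=> x; rewrite in_itv/= => /andP[_ xb].
    by rewrite derive1E; case: (dF x (lt_trans xb (bth n))).
apply: (@le_trans _ _ (\int[lam]_(x in `[0%R, b n]) ((Num.sqrt (th - x))^-1)%R%:E)%E).
  rewrite [leRHS]integral_mkcond; apply: ge0_le_integral => //.
  - exact: mf.
  - apply/(measurable_restrictT _ _).1 => //; apply: measurable_funTS.
    apply/measurable_EFinP; apply: measurableT_comp => //.
      exact: measurable_invR.
    apply: measurableT_comp; first exact: measurable_sqrtR.
    exact: measurable_funB.
  move=> x _; rewrite /f /g patchE; case: ifPn => xb; last first.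
    by case: ifPn => _//; rewrite lee_fin invr_ge0.
  case: ifPn => [/andP[x0 xt]|_]; last by case: ifPn => _//; rewrite lee_fin invr_ge0.
  by rewrite mem_set//= in_itv/= (ltW x0) xb.
rewrite E -EFinB lee_fin /F subr0 opprK; have := sqrtr_ge0 (th - b n); lra.
Unshelve. all: by end_near. Qed.

End line.

(** * The Duhamel term as a bilinear operator on jets *)

Section duhamel.
Context d (X : measurableType d) (R : realType)
  (mX : {sigma_finite_measure set X -> \bar R}) (I : finType).
Local Notation lam := (@lebesgue_measure R).
Local Notation mZ := (prodm mX lam).
Local Notation field := (I -> R -> X -> nat -> R).
Implicit Types (W : field) (K : I -> I -> I -> R -> X -> X -> nat -> R).

Definition jmeas W :=
  forall i n, measurable_fun setT (fun z : X * measurableTypeR R => W i z.2 z.1 n).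

Definition kmeas K := forall i j k n, measurable_fun setT
  (fun q : (X * measurableTypeR R) * X => K i j k q.1.2 q.1.1 q.2 n).

(** The integrand of the Duhamel term at time [th], on space-time, extended by zero
    outside the time interval; it is bilinear in the two fields. *)
Definition duhi K W1 W2 i th x (z : X * measurableTypeR R) : nat -> R := fun n =>
  if 0 < (z.2 : R) < th then
    \sum_j \sum_k jmul (K i j k (th - z.2) x z.1)
                       (jmul (W1 j z.2 z.1) (W2 k z.2 z.1)) n
  else 0.

Definition duh K W1 W2 i th x : nat -> R := fun n => \int[mZ]_z duhi K W1 W2 i th x z n.

Lemma measurable_jmul d' (T : measurableType d') (a b : T -> nat -> R) n :
  (forall n, measurable_fun setT (a ^~ n)) ->
  (forall n, measurable_fun setT (b ^~ n)) ->
  measurable_fun setT (fun t => jmul (a t) (b t) n).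
Proof.
move=> ma mb; case: n => [|n] /=; first exact: measurable_funM.
by apply: measurable_sum => i; exact: measurable_funM.
Qed.

Lemma measurable_duhi2 K W1 W2 i n : kmeas K -> jmeas W1 -> jmeas W2 ->
  measurable_fun setT (fun q : (X * measurableTypeR R) * (X * measurableTypeR R) =>
    duhi K W1 W2 i q.1.2 q.1.1 q.2 n).
Proof.
move=> mK mW1 mW2; apply: measurable_fun_ifT => //.
- apply: measurable_and; apply: measurable_fun_ltr => //.
  + exact: measurableT_comp.
  + exact: measurableT_comp.
  + exact: measurableT_comp.
- apply: measurable_sum => j; apply: measurable_sum => k.
  apply: measurable_jmul => [{}n|{}n].
    pose g (q : (X * measurableTypeR R) * (X * measurableTypeR R)) :
        (X * measurableTypeR R) * X := ((q.1.1, (q.1.2 : R) - q.2.2), q.2.1).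
    have mg : measurable_fun setT g.
      apply: measurable_fun_pair; last exact: measurableT_comp.
      apply: measurable_fun_pair; first exact: measurableT_comp.
      apply: measurable_funB; exact: measurableT_comp.
    exact: (measurableT_comp (mK i j k n) mg).
  apply: measurable_jmul => [{}n|{}n].
    exact: (measurableT_comp (mW1 j n) measurable_snd).
  exact: (measurableT_comp (mW2 k n) measurable_snd).
Qed.

Lemma measurable_duhi K W1 W2 i th x n : kmeas K -> jmeas W1 -> jmeas W2 ->
  measurable_fun setT (fun z => duhi K W1 W2 i th x z n).
Proof.
move=> mK mW1 mW2; exact: (measurableT_comp (measurable_duhi2 i n mK mW1 mW2)
  (measurable_pair1 (x, th : measurableTypeR R))).
Qed.

Lemma measurable_duh K W1 W2 : kmeas K -> jmeas W1 -> jmeas W2 ->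
  jmeas (duh K W1 W2).
Proof.
move=> mK mW1 mW2 i n.
exact: (measurable_Rintegral1 mZ (measurable_duhi2 i n mK mW1 mW2)).
Qed.

Section estimates.
Variables (r m : R) (N : nat) (K : I -> I -> I -> R -> X -> X -> nat -> R).
Variables (G : R -> X -> X -> R) (c : R).
Hypotheses (m0 : 0 < m) (mr : m <= r) (mK : kmeas K).
Hypothesis mG : measurable_fun setT
  (fun q : (X * measurableTypeR R) * X => G q.1.2 q.1.1 q.2).
Hypothesis KG : forall i j k t x y, 0 < t -> jnorm r m N (K i j k t x y) <= G t x y.
Hypothesis c0 : 0 <= c.
Hypothesis Gc : forall t x, 0 < t ->
  (\int[mX]_y (G t x y)%:E <= (c / Num.sqrt t)%:E)%E.

Lemma KG_ge0 t x y : 0 < t -> forall i : I, 0 <= G t x y.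
Proof.
by move=> t0 i; rewrite (le_trans _ (KG i i i x y t0))// jnorm_ge0.
Qed.

(** Young's inequality in space and the integrable singularity in time. *)
Lemma duh_est W1 W2 i th x b1 b2 : 0 < th -> jmeas W1 -> jmeas W2 ->
  0 <= b1 -> 0 <= b2 ->
  (forall s, 0 < s < th -> {ae mX, forall y, forall j,
     jnorm r m N (W1 j s y) <= b1 /\ jnorm r m N (W2 j s y) <= b2}) ->
  [/\ forall n, (n <= N)%N -> mZ.-integrable setT (EFin \o (fun z => duhi K W1 W2 i th x z n)),
      forall n s, (n <= N)%N -> mX.-integrable setT (EFin \o (fun y => duhi K W1 W2 i th x (y, s) n))
   & jnorm r m N (duh K W1 W2 i th x) <=
       #|I|%:R ^+ 2 * (b1 * b2) * (c * (2 * Num.sqrt th))].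
Proof.
move=> th0 mW1 mW2 b10 b20 Wb.
set C0 := #|I|%:R ^+ 2 * (b1 * b2).
have C00 : 0 <= C0 by rewrite mulr_ge0 ?exprn_ge0 ?mulr_ge0.
have mf n : measurable_fun setT (fun z => duhi K W1 W2 i th x z n).
  exact: measurable_duhi.
have mj d' (T : measurableType d') (f : T -> nat -> R) :
   (forall n, measurable_fun setT (f ^~ n)) ->
   measurable_fun setT (fun z => jnorm r m N (f z)).
  move=> {}mf; rewrite /jnorm /jpoly; apply: measurable_funD.
    apply: measurable_sum => k; apply: measurable_funM; first exact: measurable_cst.
    exact: measurableT_comp.
  apply: measurable_funM; first exact: measurable_cst.
  apply: measurableT_comp => //; apply: measurable_funB => //.
  by apply: measurable_sum => k; apply: measurable_funM => //; exact: measurable_cst.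
pose g (s : R) : R := C0 * (c * (if 0 < s < th then (Num.sqrt (th - s))^-1 else 0)).
have mg0 : measurable_fun setT (fun s : R => if 0 < s < th then (Num.sqrt (th - s))^-1 else 0).
  apply: measurable_fun_ifT => //.
    by apply: measurable_and; apply: measurable_fun_ltr.
  apply: measurableT_comp; first exact: measurable_invR.
  apply: measurableT_comp; first exact: measurable_sqrtR.
  exact: measurable_funB.
have slice s : (\int[mX]_y (jnorm r m N (duhi K W1 W2 i th x (y, s)))%:E <= (g s)%:E)%E.
  have [hs|hs] := boolP (0 < s < th); last first.
    under eq_integral => y _.
      rewrite (@eq_jnorm _ r m N _ (fun=> 0)) ?jnorm0; last first.
        by move=> n _; rewrite /duhi/= (negbTE hs).
      over.
    by rewrite integral0 lee_fin /g (negbTE hs) !mulr0.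
  have ts : 0 < th - s by case/andP: hs => _; rewrite subr_gt0.
  have mGy : measurable_fun setT (fun y => G (th - s) x y).
    by apply: (measurableT_comp mG (measurable_pair1 (x, th - s : measurableTypeR R))).
  apply: (@le_trans _ _ (\int[mX]_y (C0 * G (th - s) x y)%:E)%E).
    apply: ae_ge0_le_integral => //.
    - by move=> y _; rewrite lee_fin jnorm_ge0.
    - apply/measurable_EFinP; apply: mj => n.
      by apply: (measurableT_comp (mf n)); exact: measurable_pair2.
    - by move=> y _; rewrite lee_fin mulr_ge0// (KG_ge0 _ _ ts i).
    - by apply/measurable_EFinP; apply: measurable_funM => //; exact: measurable_cst.
    apply: filterS (Wb s hs) => y Wy _; rewrite lee_fin.
    rewrite (@eq_jnorm _ r m N _ (fun n => \sum_j \sum_k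
        jmul (K i j k (th - s) x y) (jmul (W1 j s y) (W2 k s y)) n)); last first.
      by move=> n _; rewrite /duhi/= hs.
    rewrite (le_trans (jnorm_sum_seq m0 mr _ _ _))//.
    apply: (@le_trans _ _ (\sum_(j : I) \sum_(k : I) G (th - s) x y * (b1 * b2))).
      apply: ler_sum => j _; rewrite (le_trans (jnorm_sum_seq m0 mr _ _ _))//.
      apply: ler_sum => k _; rewrite (le_trans (jnormM m0 mr _ _ _))//.
      apply: ler_pM; rewrite ?jnorm_ge0//; first exact: KG.
      rewrite (le_trans (jnormM m0 mr _ _ _))//.
      by apply: ler_pM; rewrite ?jnorm_ge0//; [case: (Wy j)|case: (Wy k)].
    rewrite !sumr_const -!mulrnA -[leLHS]mulr_natr /C0 natrM expr2.
    by rewrite le_eqVlt; apply/orP; left; apply/eqP; ring.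
  have -> : (\int[mX]_y (C0 * G (th - s) x y)%:E = C0%:E * \int[mX]_y (G (th - s) x y)%:E)%E.
    rewrite -ge0_integralZl//.
    - exact/measurable_EFinP.
    - by move=> y _; rewrite lee_fin (KG_ge0 _ _ ts i).
  have -> : g s = C0 * (c / Num.sqrt (th - s)) by rewrite /g hs.
  rewrite [leRHS]EFinM; apply: lee_pmul; rewrite ?lee_fin ?Gc//.
  by apply: integral_ge0 => y _; rewrite lee_fin (KG_ge0 _ _ ts i).
have tot : (\int[mZ]_z (jnorm r m N (duhi K W1 W2 i th x z))%:E <=
   (C0 * (c * (2 * Num.sqrt th)))%:E)%E.
  apply: (@prodm_integral_le _ _ _ _ _ mX lam _ _ g) => //.
  - exact: mj.
  - by move=> z; exact: jnorm_ge0.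
  - by apply: measurable_funM => //; apply: measurable_funM.
  rewrite /g; under eq_integral do rewrite mulrA EFinM.
  rewrite ge0_integralZl//.
  - rewrite mulrA [leRHS]EFinM; apply: lee_pmul => //.
    + by rewrite lee_fin mulr_ge0.
    + by apply: integral_ge0 => s _; rewrite lee_fin; case: ifP => ?; rewrite ?invr_ge0.
    + exact: integral_inv_sqrt.
  - exact/measurable_EFinP.
  - by move=> s _; rewrite lee_fin; case: ifP => ?; rewrite ?invr_ge0.
  - by rewrite lee_fin mulr_ge0.
have [Ij bound] := jnorm_integral m0 mr mf tot.
split => // n s nN.
have [Is _] := @jnorm_integral _ X R mX r m N (fun y => duhi K W1 W2 i th x (y, s)) _ m0 mr
  (fun n => measurableT_comp (mf n) (measurable_pair2 s)) (slice s).
exact: Is.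
Qed.

End estimates.
End duhamel.

(** * Time analyticity of mild solutions *)

Section jmul_bilinear.
Context (R : realType).
Implicit Types a b c : nat -> R.

Lemma jmulDr a b c n : jmul a (fun n => b n + c n) n = jmul a b n + jmul a c n.
Proof.
case: n => [|n] /=; first by rewrite mulrDr.
by rewrite -big_split; apply: eq_bigr => i _; rewrite mulrDr.
Qed.

Lemma jmul_telescope a b a' b' n : jmul a b n =
  jmul (fun n => a n - a' n) b n + jmul a' (fun n => b n - b' n) n + jmul a' b' n.
Proof.
case: n => [|n] /=; first by ring.
by rewrite -!big_split; apply: eq_bigr => i _ /=; ring.
Qed.

End jmul_bilinear.

Section backward.
Context d (X : measurableType d) (R : realType)
  (mX : {sigma_finite_measure set X -> \bar R}) (I : finType).
Local Notation lam := (@lebesgue_measure R).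
Local Notation mZ := (prodm mX lam).

(* [H] and [Kv] are the heat and Oseen kernels, [hj] and [kj] the jets of their
   rescalings, and [G] dominates the jets of the Oseen kernel. *)
Variables (H : R -> X -> X -> R) (Kv : I -> I -> I -> R -> X -> X -> R).
Variables (hj : R -> R -> X -> X -> nat -> R)
  (kj : R -> I -> I -> I -> R -> X -> X -> nat -> R).
Variables (G : R -> X -> X -> R) (c : R).
Let r : R := 1 / 2.
Let sq (m : R) : R := Num.sqrt (1 + m).
Local Notation good m := (0 < m <= 1 / 2).

Hypothesis c1 : 1 <= c.
Hypothesis mhj : forall m n, measurable_fun setT
  (fun q : (X * measurableTypeR R) * X => hj m q.1.2 q.1.1 q.2 n).
Hypothesis mkj : forall m, kmeas (kj m).
Hypothesis mG : measurable_fun setT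
  (fun q : (X * measurableTypeR R) * X => G q.1.2 q.1.1 q.2).
Hypothesis hjc : forall m N t x, good m -> 0 < t ->
  (\int[mX]_y (jnorm r m N (hj m t x y))%:E <= c%:E)%E.
Hypothesis kjG : forall m N i j k t x y, good m -> 0 < t ->
  jnorm r m N (kj m i j k t x y) <= G t x y.
Hypothesis Gc : forall t x, 0 < t ->
  (\int[mX]_y (G t x y)%:E <= (c / Num.sqrt t)%:E)%E.
Hypothesis hj0 : forall m t x y, 0 < m -> 0 < t ->
  hj m t x y 0%N = (sq m)^-1 * H (t / (1 + m)) x y.
Hypothesis kj0 : forall m i j k t x y, 0 < m -> 0 < t ->
  kj m i j k t x y 0%N = (sq m)^-1 * Kv i j k (t / (1 + m)) x y.
Hypothesis hjS : forall m m' t x y n, hj m t x y n.+1 = hj m' t x y n.+1.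
Hypothesis kjS : forall m m' i j k t x y n, kj m i j k t x y n.+1 = kj m' i j k t x y n.+1.

Let c0 : 0 <= c. Proof. exact: le_trans c1. Qed.

Definition mild (T : R) (u : I -> R -> X -> R) := forall s t, 0 <= s -> s < t -> t <= T ->
  {ae mX, forall x, forall i, u i t x = \int[mX]_y (H (t - s) x y * u i s y) -
     \int[lam]_(tau in `[s, t]) \int[mX]_y
       (\sum_j \sum_k Kv i j k (t - tau) x y * (u j tau y * u k tau y))}.

Definition umeas (u : I -> R -> X -> R) :=
  forall i, measurable_fun setT (fun z : X * measurableTypeR R => u i z.2 z.1).

Definition bounded_by (M : R) (u : I -> R -> X -> R) := forall i t x, `|u i t x| <= M.

(** The solution started at time [s], in the rescaled time [th], where
    [t = s + th / (1 + m)].  The factor makes the quadratic term of the rescaled equation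
    free of any other power of [1 + m] than those in the kernel.  Only the entry
    of index 0 is meaningful, and it is used with truncation order 0. *)
Definition resc m s (u : I -> R -> X -> R) : I -> R -> X -> nat -> R :=
  fun i th x n => if n is 0%N then (sq m)^-1 * u i (s + th / (1 + m)) x else 0.

(** The jets of the linear term of the rescaled mild formula. *)
Definition lin m s (u : I -> R -> X -> R) : I -> R -> X -> nat -> R :=
  fun i th x n => \int[mX]_y (hj m th x y n * u i s y).

Lemma good_gt0 (m : R) : good m -> 0 < m. Proof. by case/andP. Qed.

Lemma good_ler (m : R) : good m -> m <= r. Proof. by case/andP. Qed.

Let sq_gt0 m : 0 < m -> 0 < sq m.
Proof. by move=> m0; rewrite sqrtr_gt0; lra. Qed.

Let sq_ge1 m : 0 < m -> 1 <= sq m.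
Proof. by move=> m0; rewrite -[leLHS]sqrtr1 ler_wsqrtr//; lra. Qed.

Lemma umeas_slice u s i : umeas u -> measurable_fun setT (u i s).
Proof. by move=> mu; exact: (measurableT_comp (mu i) (measurable_pair2 (s : measurableTypeR R))). Qed.

Lemma jmeas_resc m s u : umeas u -> jmeas (resc m s u).
Proof.
move=> mu i [|n] /=; last exact: measurable_cst.
apply: measurable_funM; first exact: measurable_cst.
pose g (z : X * measurableTypeR R) : X * measurableTypeR R :=
  (z.1, s + (z.2 : R) / (1 + m)).
have mg : measurable_fun setT g.
  apply: measurable_fun_pair => //; apply: measurable_funD => //.
  by apply: measurable_funM.
exact: (measurableT_comp (mu i) mg).
Qed.

Lemma resc_bound m s u M i th x : 0 < m -> bounded_by M u -> `|resc m s u i th x 0%N| <= M.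
Proof.
move=> m0 uM; rewrite /resc normrM ger0_norm ?invr_ge0 ?sqrtr_ge0//.
rewrite (le_trans _ (uM i (s + th / (1 + m)) x))// ler_piMl//.
by rewrite invf_le1 ?sq_gt0 ?sq_ge1.
Qed.

Lemma jmeas_lin m s u : umeas u -> jmeas (lin m s u).
Proof.
move=> mu i n.
pose f (q : (X * measurableTypeR R) * X) := hj m q.1.2 q.1.1 q.2 n * u i s q.2.
have mf : measurable_fun setT f.
  apply: measurable_funM => //.
  exact: (measurableT_comp (umeas_slice s i mu) measurable_snd).
exact: (measurable_Rintegral1 mX mf).
Qed.

Lemma lin_est m N s u i th x b : good m -> 0 < th -> 0 <= b -> umeas u ->
  {ae mX, forall y, `|u i s y| <= b} ->
  (forall n, (n <= N)%N -> mX.-integrable setT (EFin \o (fun y => hj m th x y n * u i s y))) /\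
  jnorm r m N (lin m s u i th x) <= c * b.
Proof.
move=> gm th0 b0 mu ub; have m0 := good_gt0 gm; have mr := good_ler gm.
have mh n : measurable_fun setT (fun y => hj m th x y n).
  exact: (measurableT_comp (mhj m n) (measurable_pair1 (x, th : measurableTypeR R))).
have mf n : measurable_fun setT (fun y => hj m th x y n * u i s y).
  by apply: measurable_funM => //; exact: umeas_slice.
apply: jnorm_integral => //.
have E y : jnorm r m N (fun n => hj m th x y n * u i s y) =
    `|u i s y| * jnorm r m N (hj m th x y).
  by rewrite -jnormZ; apply: eq_jnorm => n _; rewrite mulrC.
under eq_integral do rewrite E.
have mj : measurable_fun setT (fun y => jnorm r m N (hj m th x y)).
  rewrite /jnorm /jpoly; apply: measurable_funD.
    apply: measurable_sum => k; apply: measurable_funM; first exact: measurable_cst.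
    exact: measurableT_comp.
  apply: measurable_funM; first exact: measurable_cst.
  apply: measurableT_comp => //; apply: measurable_funB => //.
  by apply: measurable_sum => k; apply: measurable_funM => //; exact: measurable_cst.
apply: (@le_trans _ _ (\int[mX]_y (b * jnorm r m N (hj m th x y))%:E)%E).
  apply: ae_ge0_le_integral => //.
  - by move=> y _; rewrite lee_fin mulr_ge0// jnorm_ge0.
  - apply/measurable_EFinP; apply: measurable_funM => //.
    by apply: measurableT_comp => //; exact: umeas_slice.
  - by move=> y _; rewrite lee_fin mulr_ge0// jnorm_ge0.
  - by apply/measurable_EFinP; apply: measurable_funM => //; exact: measurable_cst.
  by apply: filterS ub => y uy _; rewrite lee_fin ler_wpM2r// jnorm_ge0.
under eq_integral do rewrite EFinM.
rewrite ge0_integralZl//; last 2 first.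
- exact/measurable_EFinP.
- by move=> y _; rewrite lee_fin jnorm_ge0.
rewrite mulrC [leRHS]EFinM; apply: lee_pmul; rewrite ?lee_fin ?hjc//.
by apply: integral_ge0 => y _; rewrite lee_fin jnorm_ge0.
Qed.

Let q : R := #|I|%:R ^+ 2.

Lemma ae_fin (P : I -> X -> Prop) : (forall i, {ae mX, forall x, P i x}) ->
  {ae mX, forall x, forall i, P i x}.
Proof.
move=> HP; pose Q n x := if unpickle n is Some i then P i x else True.
have : {ae mX, forall x, forall n, Q n x}.
  apply/ae_foralln => n; rewrite /Q; case: unpickle => [i|]; first exact: HP.
  exact: aeW.
by apply: filterS => x Qx i; have := Qx (pickle i); rewrite /Q pickleK.
Qed.

(** The bilinear Duhamel operator is Lipschitz on bounded sets: the difference of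
    two quadratic terms is split by inserting a mixed product. *)
Lemma duh_difference m N W W' i th x B de : good m -> 0 < th -> jmeas W -> jmeas W' ->
  0 <= B -> 0 <= de ->
  (forall s, 0 < s < th -> {ae mX, forall y, forall j,
     [/\ jnorm r m N (W j s y) <= B, jnorm r m N (W' j s y) <= B &
       jnorm r m N (fun n => W j s y n - W' j s y n) <= de]}) ->
  jnorm r m N (fun n => duh mX (kj m) W W i th x n - duh mX (kj m) W' W' i th x n) <=
    4 * q * B * c * Num.sqrt th * de.
Proof.
move=> gm th0 mW mW' B0 de0 Wb; have m0 := good_gt0 gm; have mr := good_ler gm.
pose D : I -> R -> X -> nat -> R := fun j s y n => W j s y n - W' j s y n.
have mD : jmeas D by move=> j n; exact: measurable_funB.
have kjGm : forall i j k t x y, 0 < t -> jnorm r m N (kj m i j k t x y) <= G t x y.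
  by move=> *; exact: kjG.
have [I1 _ E1] := @duh_est _ _ _ mX I _ _ N _ _ _ m0 mr (mkj m) mG kjGm c0 Gc D W i th x de B
  th0 mD mW de0 B0 (fun s hs => filterS (fun y Wy j => let: And3 a b c := Wy j in conj c a) (Wb s hs)).
have [I2 _ E2] := @duh_est _ _ _ mX I _ _ N _ _ _ m0 mr (mkj m) mG kjGm c0 Gc W' D i th x B de
  th0 mW' mD B0 de0 (fun s hs => filterS (fun y Wy j => let: And3 a b c := Wy j in conj b c) (Wb s hs)).
have [I3 _ _] := @duh_est _ _ _ mX I _ _ N _ _ _ m0 mr (mkj m) mG kjGm c0 Gc W' W' i th x B B
  th0 mW' mW' B0 B0 (fun s hs => filterS (fun y Wy j => let: And3 a b c := Wy j in conj b b) (Wb s hs)).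
rewrite (@eq_jnorm _ r m N _ (fun n => duh mX (kj m) D W i th x n + duh mX (kj m) W' D i th x n)).
  rewrite (le_trans (jnormD m0 mr _ _ _))// (le_trans (lerD E1 E2))//.
  by rewrite le_eqVlt; apply/orP; left; apply/eqP; rewrite /q; ring.
move=> n nN; apply/eqP; rewrite subr_eq; apply/eqP.
rewrite /duh -RintegralD//; [|exact: I1|exact: I2].
rewrite -RintegralD//; [|apply: integrableRD; [exact: I1|exact: I2]|exact: I3].
apply: eq_Rintegral => z _; rewrite /duhi; case: ifP => _; last by rewrite !addr0.
rewrite -!big_split; apply: eq_bigr => j _; rewrite -!big_split; apply: eq_bigr => k _ /=.
rewrite -!jmulDr; congr (jmul _ _ _); apply/funext => l.
exact: jmul_telescope.
Qed.

(** In rescaled time the Duhamel term is an integral over space-time. *)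
Lemma duhamel_rescaled u M m s th i x : umeas u -> bounded_by M u -> 0 <= M ->
  good m -> 0 < th ->
  let U := resc m s u in let t := s + th / (1 + m) in
  [/\ mZ.-integrable setT (EFin \o (fun z => duhi (kj m) U U i th x z 0%N)),
      \int[lam]_(tau in `[s, t]) (\int[mX]_y
        (\sum_j \sum_k Kv i j k (t - tau) x y * (u j tau y * u k tau y))) =
      sq m * duh mX (kj m) U U i th x 0%N &
      `|duh mX (kj m) U U i th x 0%N| <= #|I|%:R ^+ 2 * (M * M) * (c * (2 * Num.sqrt th))].
Proof.
move=> mu uM M0 gm th0 U t; have m0 := good_gt0 gm; have mr := good_ler gm.
have m1 : 0 < 1 + m by lra.
have st : s < t by rewrite ltrDl divr_gt0.
have sm0 := sq_gt0 m0; have sm1 : sq m != 0 by rewrite gt_eqF.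
have sq2 : sq m * sq m = 1 + m by rewrite -expr2 sqr_sqrtr// ltW.
have kjGm : forall i j k t x y, 0 < t -> jnorm r m 0 (kj m i j k t x y) <= G t x y.
  by move=> *; exact: kjG.
have mU : jmeas U := jmeas_resc m s mu.
have [|Iz Iy dE] := @duh_est _ _ _ mX I _ _ 0 _ _ _ m0 mr (mkj m) mG kjGm c0 Gc U U i th x M M
  th0 mU mU M0 M0.
  by move=> sg _; apply: aeW => y j; rewrite !jnorm0n !resc_bound.
have Iz0 := Iz _ (leqnn 0); have Iy0 sg := Iy 0%N sg (leqnn 0).
pose D sg := \int[mX]_y duhi (kj m) U U i th x (y, sg) 0%N.
have DE : \int[lam]_sg D sg = duh mX (kj m) U U i th x 0%N.
  by rewrite /duh -(prodm_Rintegral Iz0).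
have ID : lam.-integrable setT (EFin \o D).
  exact: (integrable_prodm2 Iz0 Iy0).
pose f tau := \int[mX]_y (\sum_j \sum_k Kv i j k (t - tau) x y * (u j tau y * u k tau y)).
have DF sg : 0 < sg < th -> D sg = (sq m)^-1 * (1 + m)^-1 * f (s + sg / (1 + m)).
  move=> /[dup] hs /andP[sg0 sgt]; have ts : 0 < th - sg by rewrite subr_gt0.
  have Eint y : \sum_j \sum_k Kv i j k (t - (s + sg / (1 + m))) x y *
      (u j (s + sg / (1 + m)) y * u k (s + sg / (1 + m)) y) =
      sq m * (1 + m) * duhi (kj m) U U i th x (y, sg) 0%N.
    rewrite /duhi/= hs mulr_sumr; apply: eq_bigr => j _.
    rewrite mulr_sumr; apply: eq_bigr => k _; rewrite kj0// /t.
    have -> : s + th / (1 + m) - (s + sg / (1 + m)) = (th - sg) / (1 + m).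
      by field; rewrite gt_eqF.
    rewrite -sq2; field; exact: sm1.
  rewrite /f; under eq_Rintegral do rewrite Eint.
  rewrite (RintegralZl _ measurableT (Iy0 sg)).
  by rewrite /D -sq2; field; exact: sm1.
have affK (sg : R) : (s + (1 + m)^-1 * sg - s) * (1 + m) = sg.
  by field; rewrite gt_eqF.
pose F := f \_ (`]s, t[%classic : set R).
have FE tau : F tau = sq m * (1 + m) * D ((tau - s) * (1 + m)).
  rewrite /F patchE; case: ifPn => [|tau_out].
    rewrite inE/= in_itv/= => /andP[st1 st2].
    rewrite DF; last first.
      rewrite mulr_gt0 ?subr_gt0//= -ltr_pdivlMr// ltrBlDl//.
    rewrite mulfK ?gt_eqF// [s + _]addrC subrK; field; rewrite sm1 gt_eqF//.
  suff -> : D ((tau - s) * (1 + m)) = 0 by rewrite mulr0.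
  have out : (0 < (tau - s) * (1 + m) < th) = false.
    apply/negbTE; apply: contra tau_out => /andP[a b].
    rewrite inE/= in_itv/= -subr_gt0 -(pmulr_lgt0 _ m1) a/=.
    by rewrite /t -ltrBlDl ltr_pdivlMr.
  rewrite /D; under eq_Rintegral => y _ do rewrite /duhi/= out.
  by rewrite Rintegral_cst// mul0r.
have mF : measurable_fun setT F.
  rewrite (_ : F = fun tau => sq m * (1 + m) * D ((tau - s) * (1 + m))); last exact/funext.
  apply: measurable_funM; first exact: measurable_cst.
  have mD : measurable_fun setT D by apply/measurable_EFinP; exact: measurable_int ID.
  apply: (measurableT_comp mD (f := D)).
  by apply: measurable_funM => //; apply: measurable_funB.
have [||IF EF] := @Rintegral_affine R s (1 + m)^-1 F _ mF.
- by rewrite gt_eqF// invr_gt0.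
- have := integrableZl measurableT (sq m * (1 + m)) ID.
  apply: eq_integrable => // sg _ /=.
  rewrite FE -EFinM; congr (_ * D _)%:E.
  by rewrite affK.
have Rf : \int[lam]_(tau in `[s, t]) f tau = sq m * duh mX (kj m) U U i th x 0%N.
  have If : lam.-integrable (`]s, t[%classic : set R) (EFin \o f).
    apply/integrable_mkcond => //.
    by apply: eq_integrable IF => // tau _; rewrite /F/= restrict_EFin.
  rewrite /Rintegral integral_itv_bndoo; last exact: measurable_int If.
  rewrite -/(Rintegral lam _ _) Rintegral_mkcond -/F EF.
  rewrite gtr0_norm ?invr_gt0//.
  have -> : \int[lam]_sg F (s + (1 + m)^-1 * sg) = \int[lam]_sg (sq m * (1 + m) * D sg).
    apply: eq_Rintegral => sg _; rewrite FE; congr (_ * D _).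
    by rewrite affK.
  by rewrite RintegralZl// DE; field; rewrite gt_eqF.
by split => //; rewrite jnorm0n in dE.
Qed.

Lemma mild_rescaled T u M m s th : mild T u -> umeas u -> bounded_by M u -> 0 <= M ->
  good m -> 0 < th -> 0 <= s -> s + th / (1 + m) <= T ->
  {ae mX, forall x, forall i, resc m s u i th x 0%N =
     lin m s u i th x 0%N - duh mX (kj m) (resc m s u) (resc m s u) i th x 0%N}.
Proof.
move=> mi mu uM M0 gm th0 s0 tT; have m0 := good_gt0 gm; have mr := good_ler gm.
have m1 : 0 < 1 + m by lra.
set t := s + th / (1 + m).
have st : s < t by rewrite ltrDl divr_gt0.
have sm0 := sq_gt0 m0; have sm1 : sq m != 0 by rewrite gt_eqF.
apply: filterS (mi s t s0 st tT) => x Ex i.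
have [_ Rf _] := duhamel_rescaled s i x mu uM M0 gm th0.
rewrite /resc Ex Rf mulrBr; congr (_ - _); last by rewrite mulKf.
rewrite /lin; under [RHS]eq_Rintegral => y _ do rewrite hj0// -mulrA.
have [Ilin _] := @lin_est m 0 s u i th x M gm th0 M0 mu (aeW _ (fun y => uM i s y)).
rewrite RintegralZl//.
  by congr (_ * _); apply: eq_Rintegral => y _; rewrite /t addrAC subrr add0r.
have := integrableRZ (sq m) (Ilin 0%N (leqnn _)).
apply: eq_integrable => // y _ /=; rewrite hj0// mulrA mulrA divff// mul1r//.
Qed.


(** The iterates are jets: their coefficients are computed along with their
    values, and by [picard_indep] they do not depend on [m]. *)
Fixpoint picard (u : I -> R -> X -> R) s m k : I -> R -> X -> nat -> R :=
  if k is k'.+1 then fun i th x n => lin m s u i th x n -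
    duh mX (kj m) (picard u s m k') (picard u s m k') i th x n
  else fun _ _ _ _ => 0.

Lemma jmeas_picard u s m k : umeas u -> jmeas (picard u s m k).
Proof.
move=> mu; elim: k => [|k IH] i n /=; first exact: measurable_cst.
by apply: measurable_funB; [exact: jmeas_lin|exact: measurable_duh].
Qed.

Lemma picard_indep u s m m' k i th x n :
  picard u s m k i th x n.+1 = picard u s m' k i th x n.+1.
Proof.
elim: k i th x n => [//|k IH] i th x n /=; congr (_ - _).
  by apply: eq_Rintegral => y _; rewrite (hjS m m').
apply: eq_Rintegral => z _; rewrite /duhi; case: ifP => // _.
apply: eq_bigr => j _; apply: eq_bigr => l _ /=.
apply: eq_bigr => e _; rewrite (kjS m m'); congr (_ * _).
by apply: eq_bigr => e' _; rewrite IH [picard u s m k l _ _ _]IH.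
Qed.

Section picard_iteration.
Variables (T M h s : R) (u : I -> R -> X -> R).
Hypotheses (mi : mild T u) (mu : umeas u) (uM : bounded_by M u) (M0 : 0 <= M).
Hypotheses (s0 : 0 <= s) (h0 : 0 < h) (shT : s + h <= T).
Let B : R := 2 * c * M.
Hypothesis small : 8 * q * B * c * Num.sqrt h <= 1.

Let B0 : 0 <= B. Proof. by rewrite mulr_ge0// mulr_ge0. Qed.

Let q0 : 0 <= q. Proof. by rewrite exprn_ge0. Qed.

Let MB : M <= B.
Proof. by rewrite /B -[leLHS]mul1r ler_wpM2r//; move: c1; lra. Qed.

Let small_th th : th <= h -> 8 * q * B * c * Num.sqrt th <= 1.
Proof.
move=> thh; rewrite (le_trans _ small)// ler_wpM2l ?ler_wsqrtr//.
by rewrite !mulr_ge0.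
Qed.

(** The ball of radius [B], twice the size of the linear term, is preserved when
    [h] is small. *)
Lemma picard_bound m N k i th x : good m -> 0 < th <= h ->
  jnorm r m N (picard u s m k i th x) <= B.
Proof.
move=> gm; have m0 := good_gt0 gm; have mr := good_ler gm.
elim: k i th x => [|k IH] i th x /andP[th0 thh] /=; first by rewrite jnorm0.
have [_ L] := @lin_est m N s u i th x M gm th0 M0 mu (aeW _ (fun y => uM i s y)).
have kjGm : forall i j k t x y, 0 < t -> jnorm r m N (kj m i j k t x y) <= G t x y.
  by move=> *; exact: kjG.
have mP := jmeas_picard s m k mu.
have [|_ _ D] := @duh_est _ _ _ mX I _ _ N _ _ _ m0 mr (mkj m) mG kjGm c0 Gc
  (picard u s m k) (picard u s m k) i th x B B th0 mP mP B0 B0.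
  move=> t /andP[t0 tth]; apply: aeW => y j.
  by split; apply: IH; rewrite t0 (le_trans (ltW tth)).
rewrite (le_trans (jnormB m0 mr _ _ _))//.
apply: (le_trans (lerD L D)).
have := ler_wpM2r B0 (small_th thh); rewrite mul1r -/q => E.
have -> : q * (B * B) * (c * (2 * Num.sqrt th)) = 8 * q * B * c * Num.sqrt th * B / 4.
  by field.
have -> : c * M = B / 2 by rewrite /B; field.
have := B0; lra.
Qed.

(** Contraction with ratio one half on this ball. *)
Lemma picard_diff m N k i th x : good m -> 0 < th <= h ->
  jnorm r m N (fun n => picard u s m k.+1 i th x n - picard u s m k i th x n)
    <= B / 2 ^+ k.
Proof.
move=> gm; have m0 := good_gt0 gm; have mr := good_ler gm.
elim: k i th x => [|k IH] i th x thh.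
  rewrite (@eq_jnorm _ r m N _ (picard u s m 1 i th x)).
    by rewrite expr0 divr1 picard_bound.
  by move=> n _; rewrite [picard u s m 0 i th x n]/= subr0.
case/andP: (thh) => th0 thl.
set P1 := picard u s m k.+1; set P0 := picard u s m k.
rewrite (@eq_jnorm _ r m N _ (fun n =>
  - (duh mX (kj m) P1 P1 i th x n - duh mX (kj m) P0 P0 i th x n))); last first.
  move=> n _; have -> : picard u s m k.+2 i th x n =
    lin m s u i th x n - duh mX (kj m) P1 P1 i th x n by [].
  have -> : P1 i th x n = lin m s u i th x n - duh mX (kj m) P0 P0 i th x n by [].
  by ring.
rewrite jnormN//.
have de0 : 0 <= B / 2 ^+ k by rewrite divr_ge0// exprn_ge0.
apply: (@le_trans _ _ (4 * q * B * c * Num.sqrt th * (B / 2 ^+ k))).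
  apply: duh_difference => //; [exact: jmeas_picard|exact: jmeas_picard|].
  move=> t /andP[t0 tth]; apply: aeW => y j.
  have tt : 0 < t <= h by rewrite t0 (le_trans (ltW tth)).
  by split; [exact: picard_bound|exact: picard_bound|exact: IH].
have -> : B / 2 ^+ k.+1 = 2^-1 * (B / 2 ^+ k) by rewrite exprS invfM mulrCA.
have := ler_wpM2r de0 (small_th thl).
move: (B / 2 ^+ k) => e; lra.
Qed.

(** The solution itself lies in the ball and is a fixed point, so the values of the iterates
    converge to it. *)
Lemma picard_value m k th : good m -> 0 < th <= h ->
  {ae mX, forall x, forall i,
    `|resc m s u i th x 0%N - picard u s m k i th x 0%N| <= B / 2 ^+ k}.
Proof.
move=> gm; have m0 := good_gt0 gm; have mr := good_ler gm.
elim: k th => [|k IH] th thh.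
  apply: aeW => x i; rewrite expr0 divr1 subr0.
  by rewrite (le_trans (resc_bound _ _ _ _ _ uM)).
case/andP: (thh) => th0 thl.
have sT : s + th / (1 + m) <= T.
  rewrite (le_trans _ shT)// lerD2l (le_trans _ thl)//.
  by rewrite ler_pdivrMr ?ler_peMr ?(ltW th0)//; lra.
apply: filterS (mild_rescaled mi mu uM M0 gm th0 s0 sT) => x Ex i.
rewrite Ex /=.
set P0 := picard u s m k; set U := resc m s u.
rewrite (_ : _ - _ = - (duh mX (kj m) U U i th x 0%N - duh mX (kj m) P0 P0 i th x 0%N)); last by ring.
rewrite normrN.
have de0 : 0 <= B / 2 ^+ k by rewrite divr_ge0// exprn_ge0.
have D := @duh_difference m 0 U P0 i th x B (B / 2 ^+ k) gm th0
  (jmeas_resc _ _ mu) (jmeas_picard _ _ _ mu) B0 de0.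
rewrite -(jnorm0n r m (fun n => duh mX (kj m) U U i th x n - duh mX (kj m) P0 P0 i th x n)).
apply: (le_trans (D _)).
  move=> t /andP[t0 tth].
  have tt : 0 < t <= h by rewrite t0 (le_trans (ltW tth)).
  apply: filterS (IH t tt) => y Ey j; split.
  - by rewrite jnorm0n (le_trans (resc_bound _ _ _ _ _ uM)).
  - exact: picard_bound.
  - by rewrite jnorm0n; exact: Ey.
have -> : B / 2 ^+ k.+1 = 2^-1 * (B / 2 ^+ k) by rewrite exprS invfM mulrCA.
have := ler_wpM2r de0 (small_th thl).
move: (B / 2 ^+ k) => e; lra.
Qed.

Let P k i x n := picard u s (1 / 2) k i h x n.+1.

Let goodh : good (1 / 2 : R). Proof. by rewrite lexx andbT; lra. Qed.

Let P_bound k i x n : `|P k i x n| <= B * 2 ^+ n.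
Proof.
have := picard_bound n.+1 k i x goodh (th := h); rewrite h0 lexx => /(_ isT).
move=> /(le_trans (jnorm_coef (good_gt0 goodh) (good_ler goodh) _ (ltnSn n))).
rewrite /r expr_div_n expr1n mul1r mulrC ler_pdivrMr ?exprn_gt0//.
Qed.

Let P_cvg i x n : cvgn (fun k => P k i x n).
Proof.
pose e k := P k.+1 i x n - P k i x n.
have -> : (fun k => P k i x n) = series e.
  apply/funext; elim => [|k IH].
    by rewrite /series/= big_geq// /P.
  by rewrite /series/= big_nat_recr//= -[X in X + _]/(series e k) -IH /e addrC subrK.
apply: normed_cvg; apply: (@series_le_cvg _ _ (geometric (B * 2 ^+ n) (1 / 2))).
- by move=> k /=.
- by move=> k; rewrite /geometric/= mulr_ge0 ?mulr_ge0 ?exprn_ge0//; lra.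
- move=> k; rewrite /geometric/=.
  have := picard_diff n.+1 k i x goodh (th := h); rewrite h0 lexx => /(_ isT).
  move=> /(le_trans (jnorm_coef (good_gt0 goodh) (good_ler goodh) _ (ltnSn n))).
  rewrite /r !expr_div_n !expr1n mul1r mulrC ler_pdivrMr ?exprn_gt0//.
  by move=> E; apply: (le_trans E); rewrite mul1r mulrAC.
- by apply: is_cvg_geometric_series; rewrite ger0_norm; lra.
Qed.

(** A mild solution has, at the end of a short time interval, an expansion
    with bounded coefficients, valid on one side and uniformly in space. *)
Lemma analytic : exists co : I -> X -> nat -> R,
  [/\ forall i n, measurable_fun setT (fun x => co i x n),
      forall i x n, `|co i x n| <= B * 2 ^+ n &
      forall m N, good m -> {ae mX, forall x, forall i,
        `|(sq m)^-1 * u i (s + h / (1 + m)) x - \sum_(n < N) co i x n * m ^+ n|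
           <= B * (2 * m) ^+ N}].
Proof.
exists (fun i x n => limn (fun k => P k i x n)); split.
- move=> i n; apply: (@measurable_fun_cvg _ X R setT (fun k x => P k i x n)
    (fun x => limn (fun k => P k i x n))).
  + move=> k; exact: (measurableT_comp (jmeas_picard s (1 / 2) k mu i n.+1)
      (measurable_pair2 (h : measurableTypeR R))).
  + by move=> x _; exact: P_cvg.
- move=> i x n; have cn : `|P k i x n| @[k --> \oo] --> `|limn (fun k => P k i x n)|.
    by apply: cvg_norm; exact: P_cvg.
  rewrite -(cvg_lim _ cn)//; apply: limr_le.
    by apply/cvg_ex; eexists; exact: cn.
  by apply: nearW => k; exact: P_bound.
move=> m N gm; have m0 := good_gt0 gm; have mr := good_ler gm.
have hh : 0 < h <= h by rewrite h0 lexx.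
have H1 : {ae mX, forall x, forall k i,
    `|resc m s u i h x 0%N - picard u s m k i h x 0%N| <= B / 2 ^+ k}.
  by apply/ae_foralln => k; exact: picard_value.
apply: filterS H1 => x Ex i.
pose S k := \sum_(n < N) P k i x n * m ^+ n.
have cS : S @ \oo --> \sum_(n < N) limn (fun k => P k i x n) * m ^+ n.
  rewrite /S; elim: N {S} => [|N' IH].
    rewrite big_ord0 (_ : (fun k => _) = fun=> 0); first exact: cvg_cst.
    by apply/funext => k; rewrite big_ord0.
  rewrite big_ord_recr/= (_ : (fun k => _) = fun k =>
    \sum_(n < N') P k i x n * m ^+ n + P k i x N' * m ^+ N'); last first.
    by apply/funext => k; rewrite big_ord_recr.
  apply: cvgD; first exact: IH.
  by apply: cvgM; [exact: P_cvg|exact: cvg_cst].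
have cD : `|resc m s u i h x 0%N - S k| @[k --> \oo] -->
   `|resc m s u i h x 0%N - \sum_(n < N) limn (fun k => P k i x n) * m ^+ n|.
  by apply: cvg_norm; apply: cvgB => //; exact: cvg_cst.
have cE : B / 2 ^+ k + B * (2 * m) ^+ N @[k --> \oo] --> 0 + B * (2 * m) ^+ N.
  apply: cvgD; last exact: cvg_cst.
  rewrite (_ : (fun k => _) = geometric B (1 / 2)).
    by apply: cvg_geometric; rewrite ger0_norm; lra.
  by apply/funext => k; rewrite /geometric/= expr_div_n expr1n mul1r.
rewrite add0r in cE.
rewrite -(cvg_lim _ cD)// -(cvg_lim _ cE)//; apply: ler_lim.
- by apply/cvg_ex; eexists; exact: cD.
- by apply/cvg_ex; eexists; exact: cE.
apply: nearW => k.
have -> : S k = jpoly N (picard u s m k i h x) m.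
  by apply: eq_bigr => n _; rewrite /P (picard_indep u s m (1 / 2)).
rewrite -[resc m s u i h x 0%N](subrK (picard u s m k i h x 0%N)) -addrA.
rewrite (le_trans (ler_normD _ _))// lerD ?Ex//.
rewrite (le_trans (jnorm_rem m0 mr N _))//.
have -> : m / r = 2 * m by rewrite /r; field.
by rewrite ler_wpM2r ?picard_bound// exprn_ge0// mulr_ge0// ltW.
Qed.

End picard_iteration.


(** * Backward uniqueness *)

(** The only property of the heat kernel needed besides the bounds: it cannot
    send a nonzero bounded function to arbitrarily small ones at small times. *)
Hypothesis H_approx : forall (f : X -> R) (C : R), measurable_fun setT f ->
  (forall x, `|f x| <= C) ->
  (forall de e0, 0 < de -> 0 < e0 -> exists e, 0 < e < e0 /\
     {ae mX, forall x, `|\int[mX]_y (H e x y * f y)| <= de}) ->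
  {ae mX, forall x, f x = 0}.

Section two_solutions.
Variables (T M : R) (u v : I -> R -> X -> R).
Hypotheses (miu : mild T u) (muu : umeas u) (uM : bounded_by M u).
Hypotheses (miv : mild T v) (muv : umeas v) (vM : bounded_by M v).
Hypothesis M0 : 0 <= M.
Let B : R := 2 * c * M.
Let q0 : 0 <= q. Proof. by rewrite exprn_ge0. Qed.
Let B0 : 0 <= B. Proof. by rewrite mulr_ge0// mulr_ge0. Qed.

Let w i t x := u i t x - v i t x.

Let mw : umeas w. Proof. by move=> i; exact: measurable_funB. Qed.

(** Quantitative form of [duh_difference] when the difference of the solutions is
    known to be small, of size [de], between the two times. *)
Lemma duhamel_gap m t th x i : good m -> 0 < th -> 0 <= t -> t + th / (1 + m) <= T ->
  forall de, 0 <= de ->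
  (forall sg, 0 < sg < th -> {ae mX, forall y, forall j, `|w j (t + sg / (1 + m)) y| <= de}) ->
  `|duh mX (kj m) (resc m t u) (resc m t u) i th x 0%N -
    duh mX (kj m) (resc m t v) (resc m t v) i th x 0%N| <= 4 * q * M * c * Num.sqrt th * de.
Proof.
move=> gm th0 t0 tT de de0 wde; have m0 := good_gt0 gm.
rewrite -(jnorm0n r m (fun n => duh mX (kj m) (resc m t u) (resc m t u) i th x n -
    duh mX (kj m) (resc m t v) (resc m t v) i th x n)).
apply: duh_difference => //; [exact: jmeas_resc|exact: jmeas_resc|].
move=> sg hsg; apply: filterS (wde sg hsg) => y Ey j; split.
- by rewrite jnorm0n resc_bound.
- by rewrite jnorm0n resc_bound.
- rewrite jnorm0n /resc -mulrBr normrM (le_trans _ (Ey j))// ler_piMl//.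
  by rewrite ger0_norm ?invr_ge0 ?sqrtr_ge0// invf_le1 ?sq_gt0 ?sq_ge1.
Qed.

(** If the difference vanishes at the later time, its heat flow between the two
    times equals the difference of the Duhamel terms, which gains the square root
    of the elapsed time. *)
Lemma heat_bound m t th i : good m -> 0 < th -> 0 <= t -> t + th / (1 + m) <= T ->
  {ae mX, forall x, forall i, w i (t + th / (1 + m)) x = 0} ->
  forall de, 0 <= de ->
  (forall sg, 0 < sg < th -> {ae mX, forall y, forall j, `|w j (t + sg / (1 + m)) y| <= de}) ->
  {ae mX, forall x, `|\int[mX]_y (hj m th x y 0%N * w i t y)| <=
      4 * q * M * c * Num.sqrt th * de}.
Proof.
move=> gm th0 t0 tT wT de de0 wde; have m0 := good_gt0 gm; have mr := good_ler gm.
apply: filterS3 wT (mild_rescaled miu muu uM M0 gm th0 t0 tT)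
  (mild_rescaled miv muv vM M0 gm th0 t0 tT) => x wx ux vx.
have E2 : resc m t u i th x 0%N = resc m t v i th x 0%N.
  by rewrite /resc; congr (_ * _); apply/eqP; rewrite -subr_eq0; apply/eqP/wx.
have -> : \int[mX]_y (hj m th x y 0%N * w i t y) =
    lin m t u i th x 0%N - lin m t v i th x 0%N.
  have [I1 _] := @lin_est m 0 t u i th x M gm th0 M0 muu (aeW _ (fun y => uM i t y)).
  have [I2 _] := @lin_est m 0 t v i th x M gm th0 M0 muv (aeW _ (fun y => vM i t y)).
  rewrite /lin -RintegralB//; [|exact: I1|exact: I2].
  by apply: eq_Rintegral => y _; rewrite /w mulrBr.
have -> : lin m t u i th x 0%N - lin m t v i th x 0%N =
  duh mX (kj m) (resc m t u) (resc m t u) i th x 0%N -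
  duh mX (kj m) (resc m t v) (resc m t v) i th x 0%N.
  by move: E2; rewrite ux vx; lra.
exact: duhamel_gap.
Qed.

Lemma int_hj m th x (f : X -> R) C : good m -> 0 < th -> measurable_fun setT f ->
  {ae mX, forall y, `|f y| <= C} -> 0 <= C ->
  mX.-integrable setT (EFin \o (fun y => hj m th x y 0%N * f y)) /\
  `|\int[mX]_y (hj m th x y 0%N * f y)| <= c * C.
Proof.
move=> gm th0 mf fC C0; have m0 := good_gt0 gm; have mr := good_ler gm.
have mh : measurable_fun setT (fun y => hj m th x y 0%N).
  exact: (measurableT_comp (mhj m 0) (measurable_pair1 (x, th : measurableTypeR R))).
have mhf : measurable_fun setT (fun y => hj m th x y 0%N * f y) by exact: measurable_funM.
have bnd : (\int[mX]_y (`|hj m th x y 0%N * f y|)%:E <= (c * C)%:E)%E.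
  apply: (@le_trans _ _ (\int[mX]_y (C * `|hj m th x y 0%N|)%:E)%E).
    apply: ae_ge0_le_integral => //.
    - by apply/measurable_EFinP; apply: measurableT_comp.
    - by move=> y _; rewrite lee_fin mulr_ge0.
    - apply/measurable_EFinP; apply: measurable_funM; first exact: measurable_cst.
      exact: measurableT_comp.
    by apply: filterS fC => y fy _; rewrite lee_fin normrM mulrC ler_wpM2r.
  under eq_integral do rewrite EFinM.
  rewrite ge0_integralZl//; last exact/measurable_EFinP/measurableT_comp.
  rewrite mulrC [leRHS]EFinM; apply: lee_pmul; rewrite ?lee_fin//.
    by apply: integral_ge0 => y _; rewrite lee_fin.
  have Ej : (\int[mX]_y (`|hj m th x y 0%N|)%:E =
      \int[mX]_y (jnorm r m 0 (hj m th x y))%:E)%E.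
    by apply: eq_integral => y _; rewrite jnorm0n.
  by rewrite Ej hjc.
split; last exact: Rintegral_le.
by apply: (integrable_le mhf _ _ bnd) => //; exact: measurableT_comp.
Qed.

Section one_step.
Variables (T' h : R).
Hypotheses (h0 : 0 < h) (hT' : h <= T') (T'T : T' <= T).
Hypothesis small : 8 * q * B * c * Num.sqrt h <= 1.
Hypothesis wT' : {ae mX, forall x, forall i, w i T' x = 0}.

Let s := T' - h.
Let s0 : 0 <= s. Proof. by rewrite subr_ge0. Qed.

(** All Taylor coefficients [C k] of the difference at the final time vanish, by induction
    on [k]; then the expansion with remainder [O((2 m)^N)] for every [N] gives zero. *)
Lemma difference_vanishes m : 0 < m <= 1 / 4 -> {ae mX, forall x, forall i, w i (s + h / (1 + m)) x = 0}.
Proof.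
have shT : s + h <= T by rewrite /s subrK.
have [cu [mcu cuB Eu]] := analytic miu muu uM M0 s0 h0 shT small.
have [cv [mcv cvB Ev]] := analytic miv muv vM M0 s0 h0 shT small.
pose C i x n := cu i x n - cv i x n.
have mC i n : measurable_fun setT (fun x => C i x n) by exact: measurable_funB.
have CB i x n : `|C i x n| <= 2 * B * 2 ^+ n.
  rewrite (le_trans (ler_normB _ _))// (le_trans (lerD (cuB _ _ _) (cvB _ _ _)))// /B; lra.
pose D m i x := (sq m)^-1 * w i (s + h / (1 + m)) x.
have E m' N : good m' -> {ae mX, forall x, forall i,
    `|D m' i x - \sum_(n < N) C i x n * m' ^+ n| <= 2 * B * (2 * m') ^+ N}.
  move=> gm; apply: filterS2 (Eu m' N gm) (Ev m' N gm) => x Eux Evx i.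
  have -> : D m' i x - \sum_(n < N) C i x n * m' ^+ n =
    ((sq m')^-1 * u i (s + h / (1 + m')) x - \sum_(n < N) cu i x n * m' ^+ n) -
    ((sq m')^-1 * v i (s + h / (1 + m')) x - \sum_(n < N) cv i x n * m' ^+ n).
    have -> : \sum_(n < N) C i x n * m' ^+ n = \sum_(n < N) cu i x n * m' ^+ n -
       \sum_(n < N) cv i x n * m' ^+ n.
      by rewrite -sumrB; apply: eq_bigr => n _; rewrite mulrBl.
    by rewrite /D /w; ring.
  rewrite (le_trans (ler_normB _ _))// (le_trans (lerD (Eux _) (Evx _)))// /B; lra.
have sq2 m' : good m' -> sq m' <= 2.
  move=> /andP[a b]; rewrite -[leRHS]ger0_norm// -sqrtr_sqr ler_wsqrtr//; lra.
have C0 k : {ae mX, forall x, forall i, C i x k = 0}.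
  clear m; elim/ltn_ind : k => k IH.
  have IH' : {ae mX, forall x, forall n, (n < k)%N -> forall i, C i x n = 0}.
    apply/ae_foralln => n; case: (ltnP n k) => nk; last by apply: aeW.
    by apply: filterS (IH n nk) => x Cx _.
  (* The lower coefficients vanish, so the difference is of order [m' ^+ k], and [C k]
     is its leading coefficient. *)
  have D1 m' : good m' -> {ae mX, forall x, forall i, `|D m' i x| <= 2 * B * (2 * m') ^+ k}.
    move=> gm; apply: filterS2 IH' (E m' k gm) => x Cx Ex i.
    by have := Ex i; rewrite big1 ?subr0// => n _; rewrite Cx ?mul0r.
  have D2 m' : good m' -> {ae mX, forall x, forall i,
      `|D m' i x - C i x k * m' ^+ k| <= 2 * B * (2 * m') ^+ k.+1}.
    move=> gm; apply: filterS2 IH' (E m' k.+1 gm) => x Cx Ex i.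
    by have := Ex i; rewrite big_ord_recr/= big1 ?add0r// => n _; rewrite Cx ?mul0r.
  apply: ae_fin => i.
  apply: (H_approx (mC i k) (CB i ^~ k)) => de e0 de0 e00.
  (* [A] collects the constants of the two error terms below: the Duhamel gap
     and the next term of the expansion, both relative to [m ^+ k]. *)
  pose A := 2 ^+ k * (16 * q * M * c * B * Num.sqrt h + 8 * c * B).
  have A0 : 0 <= A.
    by rewrite mulr_ge0 ?exprn_ge0// addr_ge0 ?mulr_ge0 ?sqrtr_ge0.
  pose m := Num.min (1 / 2) (Num.min ((de / (A + 1)) ^+ 2) (e0 / (2 * h))).
  have m0 : 0 < m.
    rewrite !lt_min; apply/and3P; split; first lra.
      by rewrite exprn_gt0// divr_gt0// ltr_wpDl.
    by rewrite divr_gt0// mulr_gt0.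
  have gm : good m by rewrite m0 ge_min lexx.
  have mA : Num.sqrt m * A <= de.
    have : Num.sqrt m <= de / (A + 1).
      have dA : 0 <= de / (A + 1) by rewrite divr_ge0 ?(ltW de0)// addr_ge0.
      rewrite -[leRHS]ger0_norm// -sqrtr_sqr ler_wsqrtr//.
      by rewrite /m !ge_min lexx orbT.
    rewrite ler_pdivlMr; last by rewrite ltr_wpDl.
    apply: le_trans; rewrite ler_wpM2l ?sqrtr_ge0//; lra.
  have mE : m * h < e0.
    have : m <= e0 / (2 * h) by rewrite /m !ge_min lexx !orbT.
    rewrite ler_pdivlMr ?mulr_gt0// => le.
    by have := mulr_gt0 m0 h0; lra.
  have m1 : 0 < 1 + m by lra.
  (* The mild formula is used between [t], which has parameter [m], and the final time, where
     the elapsed time is [th / (1 + m)]. *)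
  pose t := s + h / (1 + m); pose th := h * m.
  have th0 : 0 < th by rewrite mulr_gt0.
  have te : t + th / (1 + m) = T'.
    by rewrite /t /th /s; field; rewrite gt_eqF.
  have t0 : 0 <= t by rewrite addr_ge0// divr_ge0 ?(ltW h0) ?(ltW m1).
  exists (th / (1 + m)); split.
    rewrite divr_gt0//= ltr_pdivrMr// /th.
    by rewrite mulrDr mulr1 mulrC (lt_le_trans mE)// lerDl mulr_ge0 ?(ltW e00) ?(ltW m0).
  have tT : t + th / (1 + m) <= T by rewrite te.
  have wt sg : 0 < sg < th -> {ae mX, forall y, forall j, `|w j (t + sg / (1 + m)) y| <= 4 * B * (2 * m) ^+ k}.
    move=> /andP[sg0 sgt].
    (* The parameter of the intermediate time. *)
    pose m' := h / (h / (1 + m) + sg / (1 + m)) - 1.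
    have den : 0 < h + sg by rewrite addr_gt0.
    have m'E : m' = (h * m - sg) / (h + sg).
      rewrite /m' -mulrDl; field; by rewrite !gt_eqF.
    have m'0 : 0 < m' by rewrite m'E divr_gt0// subr_gt0.
    have m'm : m' <= m.
      rewrite m'E ler_pdivrMr// mulrDr [m * h]mulrC lerD2l.
      by rewrite (@le_trans _ _ 0) ?oppr_le0 ?mulr_ge0 ?(ltW m0) ?(ltW sg0).
    have gm' : good m' by rewrite m'0 (le_trans m'm)//; case/andP: gm.
    apply: filterS (D1 m' gm') => y Dy j.
    have -> : w j (t + sg / (1 + m)) y = sq m' * D m' j y.
      rewrite /D mulrA divff ?mul1r; last by rewrite gt_eqF ?sq_gt0.
      congr (w j _ y); rewrite /t -addrA; congr (_ + _).
      rewrite -mulrDl; have -> : 1 + m' = h / ((h + sg) / (1 + m)).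
        by rewrite /m' -mulrDl addrC subrK.
      by field; rewrite !gt_eqF.
    rewrite normrM ger0_norm ?sqrtr_ge0//.
    apply: (@le_trans _ _ (2 * (2 * B * (2 * m') ^+ k))).
      by rewrite ler_pM ?sqrtr_ge0 ?sq2.
    rewrite !mulrA -(natrM _ 2 2) ler_wpM2l ?mulr_ge0//.
    by apply: lerXn2r; rewrite ?nnegrE ?mulr_ge0 ?(ltW m0) ?(ltW m'0)// ler_pM2l.
  have de1 : 0 <= 4 * B * (2 * m) ^+ k by rewrite mulr_ge0 ?exprn_ge0 ?mulr_ge0 ?(ltW m0).
  have wte : {ae mX, forall x, forall i, w i (t + th / (1 + m)) x = 0} by rewrite te.
  have Hw := heat_bound i gm th0 t0 tT wte de1 wt.
  have wB y : `|w i t y| <= M + M.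
    by rewrite (le_trans (ler_normB _ _))// lerD.
  apply: filterS Hw => x Hx.
  have mwt : measurable_fun setT (w i t) by exact: umeas_slice.
  pose g y := w i t y - sq m * m ^+ k * C i y k.
  have mg : measurable_fun setT g.
    by apply: measurable_funB => //; apply: measurable_funM => //; exact: measurable_cst.
  have gb : {ae mX, forall y, `|g y| <= 4 * B * (2 * m) ^+ k.+1}.
    apply: filterS (D2 m gm) => y Dy.
    have -> : g y = sq m * (D m i y - C i y k * m ^+ k).
      rewrite /g /D -/t; field; by rewrite gt_eqF ?sq_gt0.
    rewrite normrM ger0_norm ?sqrtr_ge0//.
    apply: (@le_trans _ _ (2 * (2 * B * (2 * m) ^+ k.+1))); last lra.
    by rewrite ler_pM ?sqrtr_ge0 ?sq2.
  have g0 : 0 <= 4 * B * (2 * m) ^+ k.+1 by rewrite mulr_ge0 ?exprn_ge0 ?mulr_ge0 ?(ltW m0).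
  have [Ig gI] := int_hj x gm th0 mg gb g0.
  have [Iw _] := int_hj x gm th0 mwt (aeW _ wB) (addr_ge0 M0 M0).
  have C2k : 0 <= 2 * B * 2 ^+ k by rewrite mulr_ge0 ?exprn_ge0 ?mulr_ge0.
  have CBk : {ae mX, forall y, `|C i y k| <= 2 * B * 2 ^+ k} by exact: aeW.
  have [IC _] := int_hj x gm th0 (mC i k) CBk C2k.
  have HC : m ^+ k * \int[mX]_y (H (th / (1 + m)) x y * C i y k) =
     \int[mX]_y (hj m th x y 0%N * w i t y) - \int[mX]_y (hj m th x y 0%N * g y).
    rewrite -RintegralB//.
    rewrite [RHS](_ : _ = \int[mX]_y ((sq m * m ^+ k) * (hj m th x y 0%N * C i y k))); last first.
      by apply: eq_Rintegral => y _; rewrite /g; ring.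
    rewrite RintegralZl// [in RHS](mulrC (sq m)) -[RHS]mulrA; congr (_ * _).
    rewrite -RintegralZl//; apply: eq_Rintegral => y _.
    by rewrite hj0// !mulrA divff ?mul1r// gt_eqF ?sq_gt0.
  have mk0 : 0 < m ^+ k by rewrite exprn_gt0.
  rewrite -(ler_pM2l mk0) -[X in X * _ <= _](gtr0_norm mk0) -normrM HC.
  rewrite (le_trans (ler_normB _ _))// (le_trans (lerD Hx gI))//.
  have msm : m <= Num.sqrt m.
    rewrite -[leLHS]ger0_norm ?(ltW m0)// -sqrtr_sqr ler_wsqrtr// expr2.
    by rewrite ler_piMl ?(ltW m0)//; case/andP: gm => _; lra.
  rewrite /th sqrtrM ?(ltW h0)// [4 * B * _ ^+ k.+1](_ : _ = 8 * B * (2 * m) ^+ k * m); last first.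
    by rewrite exprS; ring.
  apply: (@le_trans _ _ (m ^+ k * (Num.sqrt m * A))); last by rewrite ler_pM2l.
  rewrite /A exprMn -subr_ge0.
  set S := Num.sqrt m in msm *; set a := 2 ^+ k.
  rewrite (_ : _ - _ = m ^+ k * a * (8 * c * B) * (S - m)); last by ring.
  by rewrite mulr_ge0 ?subr_ge0 ?mulr_ge0 ?exprn_ge0 ?(ltW m0).
move=> /andP[m0 m4].
have gm : good m by rewrite m0/= (le_trans m4)//; lra.
have C0' : {ae mX, forall x, forall k i, C i x k = 0} by apply/ae_foralln.
have E' : {ae mX, forall x, forall N i,
    `|D m i x - \sum_(n < N) C i x n * m ^+ n| <= 2 * B * (2 * m) ^+ N}.
  by apply/ae_foralln => N; exact: E.
apply: filterS2 C0' E' => x Cx Ex i.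
suff : D m i x = 0.
  by move/eqP; rewrite mulf_eq0 invr_eq0 gt_eqF ?sq_gt0//= => /eqP.
apply/eqP; rewrite -normr_le0.
have cE : 2 * B * (2 * m) ^+ N @[N --> \oo] --> 0.
  apply: (@cvg_geometric _ (2 * B) (2 * m)).
  by rewrite ger0_norm ?mulr_ge0 ?(ltW m0)//; lra.
rewrite -(cvg_lim _ cE)//; apply: limr_ge; first by apply/cvg_ex; eexists; exact: cE.
apply: nearW => N; have := Ex N i; rewrite big1 ?subr0// => n _.
by rewrite Cx mul0r.
Qed.

End one_step.

(** A step from [tau] reaches back by a fixed fraction of the length of the
    interval used, which is bounded below away from [0]; so the infimum of the
    times from which on the solutions agree is [0].  The initial time follows from the mild
    formula on small intervals [0, e], again through [H_approx]. *)
Lemma backward_uniqueness : 0 < T -> {ae mX, forall x, forall i, u i T x = v i T x} ->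
  forall t, 0 <= t <= T -> {ae mX, forall x, forall i, u i t x = v i t x}.
Proof.
move=> T0 uvT.
pose Z t := {ae mX, forall x, forall i, w i t x = 0}.
have ZE t : Z t -> {ae mX, forall x, forall i, u i t x = v i t x}.
  by apply: filterS => x wx i; apply/eqP; rewrite -subr_eq0; apply/eqP/wx.
have ZT : Z T by apply: filterS uvT => x Ex i; rewrite /w Ex subrr.
pose hh := (8 * q * B * c + 1) ^- 2.
have D0 : 0 <= 8 * q * B * c by rewrite !mulr_ge0.
have D1 : 0 < 8 * q * B * c + 1 by rewrite ltr_wpDl.
have hh0 : 0 < hh by rewrite invr_gt0 exprn_gt0.
have small h : h <= hh -> 8 * q * B * c * Num.sqrt h <= 1.
  move=> hhh; apply: (@le_trans _ _ (8 * q * B * c * Num.sqrt hh)).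
    by rewrite ler_wpM2l// ler_wsqrtr.
  rewrite /hh -exprVn sqrtr_sqr ger0_norm ?invr_ge0 ?(ltW D1)//.
  by rewrite ler_pdivrMr// mul1r lerDl.
pose S := [set tau : R | 0 < tau <= T /\ forall t, tau <= t <= T -> Z t].
have ST : S T.
  by split; [rewrite T0 lexx|move=> t tT; have -> : t = T by apply/eqP; rewrite eq_le andbC].
have lbS : lbound S 0 by move=> tau [/andP[/ltW]].
have infS : has_inf S by split; [exists T|exists 0].
have next tau : S tau -> S (tau - Num.min hh tau / 5).
  move=> [/andP[tau0 tauT] Ztau]; set h := Num.min hh tau.
  have h0 : 0 < h by rewrite lt_min hh0.
  have htau : h <= tau by rewrite ge_min lexx orbT.
  split; first by lra.
  move=> t /andP[t1 t2]; have [taut|ttau] := leP tau t.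
    by apply: Ztau; rewrite taut.
  have ts : 0 < t - (tau - h) by lra.
  pose m := h / (t - (tau - h)) - 1.
  have m0 : 0 < m by rewrite subr_gt0 ltr_pdivlMr// mul1r; lra.
  have m4 : m <= 1 / 4 by rewrite lerBlDr ler_pdivrMr//; lra.
  have hhh : h <= hh by rewrite ge_min lexx.
  have mm : 0 < m <= 1 / 4 by rewrite m0.
  have := difference_vanishes h0 htau tauT (small _ hhh) (Ztau tau _) mm; rewrite lexx tauT => /(_ isT).
  have -> // : tau - h + h / (1 + m) = t.
  have -> : 1 + m = h / (t - (tau - h)) by rewrite /m addrC subrK.
  by rewrite invf_div mulrCA divff ?gt_eqF// mulr1 addrC subrK.
have inf0 : inf S <= 0.
  rewrite leNgt; apply/negP => i0.
  have e0 : 0 < Num.min hh (inf S) / 5 by rewrite divr_gt0// lt_min hh0.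
  have [tau Stau taui] := inf_adherent e0 infS.
  have itau : inf S <= tau by apply: ge_inf => //; exists 0.
  have : inf S <= tau - Num.min hh tau / 5 by apply: ge_inf (next _ Stau); exists 0.
  have : Num.min hh (inf S) <= Num.min hh tau by rewrite le_min !ge_min lexx itau orbT.
  lra.
have Zpos t : 0 < t -> t <= T -> Z t.
  move=> t0 tT; have [tau [_ Ztau] taut] := inf_adherent t0 infS.
  by apply: Ztau; rewrite tT andbT; lra.
move=> t /andP[t0 tT]; apply: ZE; move: t0; rewrite le_eqVlt => /predU1P[t0|]; last first.
  by move=> t0; exact: Zpos.
rewrite -t0; apply: ae_fin => i.
apply: (@H_approx (w i 0) (M + M)); first exact: umeas_slice.
  by move=> x; rewrite (le_trans (ler_normB _ _))// lerD.
move=> de e0 de0 e00; pose e := Num.min (e0 / 2) T.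
have ep : 0 < e by rewrite lt_min T0 divr_gt0.
have ee0 : e < e0 by rewrite gt_min; apply/orP; left; lra.
have eT : e <= T by rewrite ge_min lexx orbT.
exists e; rewrite ep ee0; split => //.
have gm : good (1 / 2 : R) by rewrite lexx andbT; lra.
pose m : R := 1 / 2; pose th := (1 + m) * e.
have m1 : 0 < 1 + m by rewrite /m; lra.
have th0 : 0 < th by rewrite mulr_gt0.
have the : 0 + th / (1 + m) = e by rewrite add0r /th mulrAC divff ?mul1r ?gt_eqF.
have thT : 0 + th / (1 + m) <= T by rewrite the.
have We : {ae mX, forall x, forall i, w i (0 + th / (1 + m)) x = 0}.
  by rewrite the; exact: Zpos.
have Wsg sg : 0 < sg < th -> {ae mX, forall y, forall j, `|w j (0 + sg / (1 + m)) y| <= 0}.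
  move=> /andP[sg0 sgth].
  have : Z (0 + sg / (1 + m)).
    apply: Zpos; first by rewrite add0r divr_gt0.
    by rewrite (le_trans _ thT)// lerD2l ler_pM2r ?invr_gt0// ltW.
  by apply: filterS => y wy j; rewrite wy normr0.
apply: filterS (heat_bound i gm th0 (lexx 0) thT We (lexx 0) Wsg) => x.
rewrite mulr0 normr_le0 => /eqP Ex.
have -> : \int[mX]_y (H e x y * w i 0 y) = 0; last by rewrite normr0 ltW.
have wB : {ae mX, forall y, `|w i 0 y| <= M + M}.
  by apply: aeW => y; rewrite (le_trans (ler_normB _ _))// lerD.
have [Iw _] := int_hj x gm th0 (umeas_slice 0 i mw) wB (addr_ge0 M0 M0).
have sm0 : sq m != 0 by rewrite gt_eqF// sq_gt0// /m; lra.
transitivity (\int[mX]_y (sq m * (hj m th x y 0%N * w i 0 y))).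
  apply: eq_Rintegral => y _; rewrite hj0//; last by rewrite /m; lra.
  by rewrite -the add0r; field.
by rewrite RintegralZl// Ex mulr0.
Qed.

End two_solutions.
End backward.

(** * Gaussian integrals *)

Section product_integral.
Context d1 d2 (T1 : measurableType d1) (T2 : measurableType d2) (R : realType)
  (m1 : {sigma_finite_measure set T1 -> \bar R})
  (m2 : {sigma_finite_measure set T2 -> \bar R}).

Lemma ge0_integral_prodM (f : T1 -> R) (g : T2 -> R) :
  measurable_fun setT f -> measurable_fun setT g ->
  (forall x, 0 <= f x) -> (forall x, 0 <= g x) ->
  (\int[prodm m1 m2]_z (f z.1 * g z.2)%:E =
   \int[m1]_x (f x)%:E * \int[m2]_y (g y)%:E)%E.
Proof.
move=> mf mg f0 g0.
have mfg : measurable_fun setT (fun z : T1 * T2 => (f z.1 * g z.2)%:E).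
  apply/measurable_EFinP; apply: measurable_funM; exact: measurableT_comp.
have -> : (\int[prodm m1 m2]_z (f z.1 * g z.2)%:E =
    \int[m1]_x \int[m2]_y (f x * g y)%:E)%E.
  by apply: (fubini_tonelli1 (fun z : T1 * T2 => (f z.1 * g z.2)%:E)) => // z;
    rewrite lee_fin mulr_ge0.
under eq_integral => x _.
  under eq_integral do rewrite EFinM.
  rewrite ge0_integralZl//; last 3 first.
  - exact/measurable_EFinP.
  - by move=> y _; rewrite lee_fin.
  - by rewrite lee_fin.
  over.
rewrite ge0_integralZr//.
- exact/measurable_EFinP.
- by move=> x _; rewrite lee_fin.
- by apply: integral_ge0 => y _; rewrite lee_fin.
Qed.

Lemma Rintegral_prodM (f : T1 -> R) (g : T2 -> R) :
  m1.-integrable setT (EFin \o f) -> m2.-integrable setT (EFin \o g) ->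
  (prodm m1 m2).-integrable setT (EFin \o (fun z => f z.1 * g z.2)) /\
  \int[prodm m1 m2]_z (f z.1 * g z.2) = (\int[m1]_x f x) * (\int[m2]_y g y).
Proof.
move=> If Ig.
have mf : measurable_fun setT f by apply/measurable_EFinP; exact: measurable_int If.
have mg : measurable_fun setT g by apply/measurable_EFinP; exact: measurable_int Ig.
have mfg : measurable_fun setT (fun z : T1 * T2 => f z.1 * g z.2).
  apply: measurable_funM; exact: measurableT_comp.
have Ifg : (prodm m1 m2).-integrable setT (EFin \o (fun z => f z.1 * g z.2)).
  apply/integrableP; split; first exact/measurable_EFinP.
  rewrite (_ : (\int[_]_x _)%E = (\int[prodm m1 m2]_z (`|f z.1| * `|g z.2|)%:E)%E); last first.
    by apply: eq_integral => z _ /=; rewrite normrM.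
  rewrite (@ge0_integral_prodM (fun x => `|f x|) (fun x => `|g x|))//; last 2 first.
  - exact: measurableT_comp.
  - exact: measurableT_comp.
  have /integrableP[_ Lf] := If; have /integrableP[_ Lg] := Ig.
  by rewrite lte_mul_pinfty// ?integral_ge0// ge0_fin_numE// integral_ge0.
split => //.
have E := @integral12_prod_meas1 _ _ _ _ _ m1 m2 _ Ifg.
rewrite {1}/Rintegral -[X in fine X = _]E.
rewrite (_ : (\int[m1]_x _)%E = (\int[m1]_x ((f x)%:E * (\int[m2]_y g y)%:E))%E); last first.
  apply: eq_integral => x _; rewrite /fubini_F /=.
  under eq_integral do rewrite EFinM.
  rewrite integralZl//; congr (_ * _)%E.
  by rewrite /Rintegral fineK//; exact: integrable_fin_num.
rewrite integralZr// fineM//=.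
exact: integrable_fin_num.
Qed.

End product_integral.

Section gaussian1.
Context (R : realType).
Local Notation lam := (@lebesgue_measure R).

Definition gau (b x : R) : R := expR (- (b * x ^+ 2)).

Lemma measurable_gau b : measurable_fun setT (gau b).
Proof.
apply: measurableT_comp => //; apply: measurableT_comp => //.
by apply: measurable_funM => //; exact: measurable_funX.
Qed.

Lemma gau_ge0 b x : 0 <= gau b x. Proof. exact: expR_ge0. Qed.

Lemma integral_gau b : 0 < b ->
  (\int[lam]_x (gau b x)%:E = (Num.sqrt pi / Num.sqrt b)%:E)%E.
Proof.
move=> b0; have sb : 0 < Num.sqrt b by rewrite sqrtr_gt0.
have E := @integralT_gauss R.
rewrite (@ge0_integral_affine _ 0 (Num.sqrt b)) in E; last 3 first.
- by rewrite gt_eqF.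
- by apply/measurable_EFinP; exact: measurable_gauss_fun.
- by move=> x; rewrite lee_fin gauss_fun_ge0.
rewrite gtr0_norm// in E.
rewrite (_ : (\int[lam]_x (gauss_fun (0 + Num.sqrt b * x)%R)%:E)%E =
  (\int[lam]_x (gau b x)%:E)%E) in E; last first.
  by apply: eq_integral => x _; rewrite /gauss_fun /gau add0r exprMn sqr_sqrtr// ltW.
have : (((Num.sqrt b)^-1)%:E * ((Num.sqrt b)%:E * \int[lam]_x (gau b x)%:E) =
  ((Num.sqrt b)^-1)%:E * (Num.sqrt pi)%:E)%E by rewrite E.
by rewrite muleA -!EFinM mulVf ?gt_eqF// mul1e mulrC => ->.
Qed.

Lemma integrable_gau b : 0 < b -> lam.-integrable setT (EFin \o gau b).
Proof.
move=> b0; apply: (@integrable_le _ _ _ lam (gau b) (gau b) (Num.sqrt pi / Num.sqrt b)) => //.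
- exact: measurable_gau.
- exact: measurable_gau.
- by move=> x; rewrite ger0_norm// gau_ge0.
- by rewrite integral_gau.
Qed.

Lemma Rintegral_gau b : 0 < b -> \int[lam]_x gau b x = Num.sqrt pi / Num.sqrt b.
Proof. by move=> b0; rewrite /Rintegral integral_gau. Qed.

(** These two bounds absorb the polynomial factors of the Oseen kernel into half
    of the exponent that remains. *)
Lemma le_expR_sqr4 (b : R) : b <= expR (b ^+ 2 / 4).
Proof.
apply: le_trans (expR_ge1Dx _).
by rewrite -subr_ge0 (_ : _ - _ = (1 - b / 2) ^+ 2) ?sqr_ge0//; field.
Qed.

Lemma le_expR_sqr12 (b : R) : b <= 2 * expR (b ^+ 2 / 12).
Proof.
apply: (@le_trans _ _ (2 * (1 + b ^+ 2 / 12))); last by rewrite ler_pM2l// expR_ge1Dx.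
have := sqr_ge0 (b - 3); rewrite sqrrB; nra.
Qed.

Lemma le_expR_sqr (b x : R) : 0 < b -> x ^+ 2 <= (2 / b) * expR (b * x ^+ 2 / 2).
Proof.
move=> b0; have := expR_ge1Dx (b * x ^+ 2 / 2) => h.
rewrite -ler_pdivrMl; last by rewrite divr_gt0.
by rewrite invf_div (le_trans _ h)// mulrAC; lra.
Qed.

Lemma integrable_gau_poly b (f : R -> R) C : 0 < b -> measurable_fun setT f -> 0 <= C ->
  (forall x, `|f x| <= C * expR (b * x ^+ 2 / 2)) ->
  lam.-integrable setT (EFin \o (fun x => f x * gau b x)).
Proof.
move=> b0 mf C0 fC.
have b2 : 0 < b / 2 by rewrite divr_gt0.
apply: (@integrable_le _ _ _ lam (fun x => f x * gau b x)
  (fun x => C * gau (b / 2) x) (C * (Num.sqrt pi / Num.sqrt (b / 2)))).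
- by apply: measurable_funM => //; exact: measurable_gau.
- by apply: measurable_funM => //; exact: measurable_gau.
- move=> x; rewrite normrM (ger0_norm (gau_ge0 _ _)).
  apply: (@le_trans _ _ (C * expR (b * x ^+ 2 / 2) * gau b x)).
    by rewrite ler_wpM2r// gau_ge0.
  rewrite -mulrA /gau -expRD; rewrite le_eqVlt; apply/orP; left; apply/eqP.
  by congr (_ * expR _); field.
- under eq_integral do rewrite EFinM.
  rewrite ge0_integralZl//; last 2 first.
  + by apply/measurable_EFinP; exact: measurable_gau.
  + by move=> x _; rewrite lee_fin gau_ge0.
  by rewrite integral_gau// -EFinM.
Qed.

Lemma moment1 b : 0 < b -> lam.-integrable setT (EFin \o (fun x => x * gau b x)) /\
  \int[lam]_x (x * gau b x) = 0.
Proof.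
move=> b0.
have I1 : lam.-integrable setT (EFin \o (fun x => x * gau b x)).
  apply: (@integrable_gau_poly _ _ (1 + 2 / b)) => //.
    by rewrite addr_ge0// divr_ge0// ltW.
  move=> x; have h1 := le_expR_sqr x b0.
  have h2 : 1 <= expR (b * x ^+ 2 / 2).
    by rewrite -[leLHS]expR0 ler_expR divr_ge0// mulr_ge0 ?sqr_ge0// ltW.
  have h3 : `|x| <= 1 + x ^+ 2.
    by rewrite -[x ^+ 2]real_normK ?num_real//; have := sqr_ge0 (`|x| - 1 / 2); rewrite sqrrB; nra.
  by rewrite mulrDl mul1r (le_trans h3)// lerD.
split => //.
have mf : measurable_fun setT (fun x : R => x * gau b x).
  by apply: measurable_funM => //; exact: measurable_gau.
have If' : lam.-integrable setT (fun x : R => ((0 + -1 * x) * gau b (0 + -1 * x))%:E).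
  have := integrableRZ (-1) I1; apply: eq_integrable => // x _ /=.
  by rewrite /gau add0r !mulN1r sqrrN mulNr.
have [|_ E] := @Rintegral_affine R 0 (-1) _ _ mf If'; first by rewrite oppr_eq0 oner_eq0.
rewrite normrN1 mul1r in E.
have E2 : \int[lam]_x ((0 + -1 * x) * gau b (0 + -1 * x)) = -1 * \int[lam]_x (x * gau b x).
  rewrite -RintegralZl//; apply: eq_Rintegral => x _.
  by rewrite /gau add0r !mulN1r sqrrN mulNr.
move: E; rewrite E2; set X := \int[lam]_x _; move: X => X; lra.
Qed.

(** The integral of the Gaussian, differentiated with respect to its parameter. *)
Lemma moment2 b : 0 < b -> lam.-integrable setT (EFin \o (fun x => x ^+ 2 * gau b x)) /\
  \int[lam]_x (x ^+ 2 * gau b x) = Num.sqrt pi / Num.sqrt b / (2 * b).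
Proof.
move=> b0.
have I2 (a : R) : 0 < a -> lam.-integrable setT (EFin \o (fun x => x ^+ 2 * gau a x)).
  move=> a0; apply: (@integrable_gau_poly _ _ (2 / a)) => //.
  - by rewrite divr_ge0// ltW.
  - by move=> x; rewrite ger0_norm ?sqr_ge0// le_expR_sqr.
split; first exact: I2.
have b2 : 0 < b / 2 by rewrite divr_gt0.
pose f (a x : R) := gau a x.
have df (a x : R) : is_derive a (1 : R) (f ^~ x) (- (x ^+ 2 * gau a x)).
  rewrite /f /gau.
  have d1 : is_derive a (1:R) (fun a : R => - (a * x ^+ 2)) (- (x ^+ 2)).
    apply: is_deriveN.
    rewrite (_ : (fun a : R => a * x ^+ 2) = (x ^+ 2) \*: id); last first.
      by apply/funext => y; rewrite /= mulrC.
    by apply: (is_derive_eq (is_deriveZ _ _)); rewrite /GRing.scale/= mulr1.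
  have d2 := is_derive_expR (- (a * x ^+ 2)).
  have d3 := @is_derive1_comp _ expR (fun a : R => - (a * x ^+ 2)) a _ _ d2 d1.
  by apply: (is_derive_eq d3); rewrite mulrN mulrC.
have inI : b \in `]b / 2, b + 1[ by rewrite in_itv/=; lra.
have intf a : `]b / 2, b + 1[%classic a -> lam.-integrable setT (EFin \o f a).
  by rewrite /= in_itv/= => /andP[a1 _]; apply: integrable_gau; lra.
have derf a x : `]b / 2, b + 1[%classic a -> setT x -> derivable (f ^~ x) a 1.
  by move=> _ _; case: (df a x).
have Gub a x : `]b / 2, b + 1[%classic a -> setT x ->
    `|(partial1of2 f) a x| <= x ^+ 2 * gau (b / 2) x.
  rewrite /= in_itv/= => /andP[a1 _] _.
  rewrite /partial1of2 derive1E (derive_val (is_derive := df a x)).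
  rewrite normrN ger0_norm; last by apply: mulr_ge0; [exact: sqr_ge0|exact: gau_ge0].
  apply: ler_wpM2l; first exact: sqr_ge0.
  rewrite /gau ler_expR lerN2.
  by apply: ler_wpM2r; [exact: sqr_ge0|exact: ltW].
have D := @differentiation_under_integral _ _ _ lam f setT measurableT b (b / 2) (b + 1)
  inI intf derf (fun x => x ^+ 2 * gau (b / 2) x)
  (fun x => mulr_ge0 (sqr_ge0 x) (gau_ge0 _ _)) (I2 _ b2) Gub.
have E1 : \int[lam]_x (partial1of2 f) b x = - \int[lam]_x (x ^+ 2 * gau b x).
  rewrite -mulN1r -RintegralZl//; last exact: I2.
  apply: eq_Rintegral => x _.
  by rewrite /partial1of2 derive1E (derive_val (is_derive := df b x)) mulN1r.
have dF : is_derive b (1:R) (fun a : R => Num.sqrt pi * (Num.sqrt a)^-1)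
    (- (Num.sqrt pi / Num.sqrt b / (2 * b))).
  have sb0 : Num.sqrt b != 0 by rewrite gt_eqF// sqrtr_gt0.
  have d1 := is_derive1_sqrt b0.
  have d2 := is_deriveV sb0 d1.
  have d3 := is_deriveZ (Num.sqrt pi) d2.
  apply: (is_derive_eq d3); rewrite /GRing.scale/=.
  have bE : b = Num.sqrt b ^+ 2 by rewrite sqr_sqrtr// ltW.
  by rewrite [X in _ = - (_ / (2 * X))]bE; field.
have E2 : (fun x' : R => \int[lam]_y f x' y)^`()%classic b = - (Num.sqrt pi / Num.sqrt b / (2 * b)).
  rewrite derive1E.
  rewrite (@near_eq_derive _ _ _ _ (fun a : R => Num.sqrt pi * (Num.sqrt a)^-1))//.
    exact: (derive_val (is_derive := dF)).
  near=> a; rewrite Rintegral_gau//; near: a; exact: lt_nbhsr.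
by apply/eqP; rewrite -eqr_opp; apply/eqP; rewrite -E1 -E2 D.
Unshelve. all: by end_near. Qed.

End gaussian1.

(** * Lebesgue measure on space *)

Section invariance.
Context d1 d2 (T1 : measurableType d1) (T2 : measurableType d2) (R : realType)
  (m1 : {sigma_finite_measure set T1 -> \bar R})
  (m2 : {sigma_finite_measure set T2 -> \bar R}).

(** Invariance is stated on integrals of nonnegative functions, the form stable
    under products and compositions. *)
Definition preserves d (T : measurableType d) (m : {sigma_finite_measure set T -> \bar R})
  (phi : T -> T) := measurable_fun setT phi /\
  forall f : T -> \bar R, measurable_fun setT f -> (forall x, 0 <= f x)%E ->
  (\int[m]_x f (phi x) = \int[m]_x f x)%E.

Lemma preserves_id : preserves m1 id. Proof. by []. Qed.

(** Skew products: the second factor may be moved by a map depending on the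
    first coordinate. *)
Lemma preserves_skew (phi : T1 -> T1) (psi : T1 -> T2 -> T2) :
  preserves m1 phi ->
  measurable_fun setT (fun z : T1 * T2 => psi z.1 z.2) ->
  (forall x, preserves m2 (psi x)) ->
  preserves (prodm m1 m2) (fun z => (phi z.1, psi z.1 z.2)).
Proof.
move=> [mphi Hphi] mpsi Hpsi.
have mz : measurable_fun setT (fun z : T1 * T2 => (phi z.1, psi z.1 z.2)).
  by apply: measurable_fun_pair => //; exact: measurableT_comp.
split => // f mf f0.
have -> : (\int[prodm m1 m2]_z f (phi z.1, psi z.1 z.2) =
   \int[m1]_x \int[m2]_y f (phi x, psi x y))%E.
  apply: (fubini_tonelli1 (fun z : T1 * T2 => f (phi z.1, psi z.1 z.2))) => //.
  exact: (measurableT_comp mf mz).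
under eq_integral => x _.
  rewrite ((Hpsi x).2 (fun y => f (phi x, y)))//; last first.
    exact: (measurableT_comp mf (measurable_pair1 (phi x))).
  over.
rewrite (Hphi (fun x => \int[m2]_y f (x, y))%E).
- by rewrite [RHS](fubini_tonelli1 f).
- exact: (measurable_fun_fubini_tonelli_F f).
- by move=> x; apply: integral_ge0.
Qed.

Lemma preserves_pair (phi : T1 -> T1) (psi : T2 -> T2) :
  preserves m1 phi -> preserves m2 psi ->
  preserves (prodm m1 m2) (fun z => (phi z.1, psi z.2)).
Proof.
move=> Hphi Hpsi; apply: (preserves_skew (psi := fun=> psi)) => //.
by apply: measurableT_comp => //; case: Hpsi.
Qed.

Lemma preserves_swap (phi : T1 -> T2 -> T1) (psi : T2 -> T2) :
  preserves m2 psi ->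
  measurable_fun setT (fun z : T1 * T2 => phi z.1 z.2) ->
  (forall y, preserves m1 (phi ^~ y)) ->
  preserves (prodm m1 m2) (fun z => (phi z.1 z.2, psi z.2)).
Proof.
move=> [mpsi Hpsi] mphi Hphi.
have mz : measurable_fun setT (fun z : T1 * T2 => (phi z.1 z.2, psi z.2)).
  by apply: measurable_fun_pair => //; exact: measurableT_comp.
split => // f mf f0.
have -> : (\int[prodm m1 m2]_z f (phi z.1 z.2, psi z.2) =
   \int[m2]_y \int[m1]_x f (phi x y, psi y))%E.
  apply: (fubini_tonelli2 (fun z : T1 * T2 => f (phi z.1 z.2, psi z.2))) => //.
  exact: (measurableT_comp mf mz).
under eq_integral => y _.
  rewrite ((Hphi y).2 (fun x => f (x, psi y)))//; last first.
    exact: (measurableT_comp mf (measurable_pair2 (psi y))).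
  over.
rewrite (Hpsi (fun y => \int[m1]_x f (x, y))%E).
- by rewrite [RHS](fubini_tonelli2 f).
- exact: (measurable_fun_fubini_tonelli_G f).
- by move=> y; apply: integral_ge0.
Qed.

End invariance.

Section preserves_theory.
Context d (T : measurableType d) (R : realType)
  (m : {sigma_finite_measure set T -> \bar R}).

Lemma preserves_comp (phi psi : T -> T) : preserves m phi -> preserves m psi ->
  preserves m (phi \o psi).
Proof.
move=> [mphi Hphi] [mpsi Hpsi]; split; first exact: measurableT_comp.
move=> f mf f0; rewrite (Hpsi (f \o phi)); first exact: Hphi.
  exact: measurableT_comp.
by move=> x; exact: f0.
Qed.

Lemma preserves_integral (phi : T -> T) (f : T -> R) : preserves m phi ->
  measurable_fun setT f ->
  \int[m]_x f (phi x) = \int[m]_x f x.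
Proof.
move=> [mphi Hphi] mf; rewrite /Rintegral [in LHS]integralE [in RHS]integralE.
have mE : measurable_fun setT (EFin \o f) by exact/measurable_EFinP.
congr (fine (_ - _))%E.
  rewrite -[RHS](Hphi (EFin \o f)^\+%E); last 2 first.
  - exact: measurable_funepos.
  - by [].
  by apply: eq_integral => x _; rewrite !funeposE.
rewrite -[RHS](Hphi (EFin \o f)^\-%E); last 2 first.
- exact: measurable_funeneg.
- by [].
by apply: eq_integral => x _; rewrite !funenegE.
Qed.

Lemma preserves_integrable (phi : T -> T) (f : T -> R) : preserves m phi ->
  measurable_fun setT f -> m.-integrable setT (EFin \o (fun x => f (phi x))) ->
  m.-integrable setT (EFin \o f).
Proof.
move=> [mphi Hphi] mf /integrableP[_ If]; apply/integrableP; split.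
  exact/measurable_EFinP.
rewrite -[X in (X < _)%E](Hphi (abse \o (EFin \o f)))//.
- by apply: measurableT_comp => //; exact/measurable_EFinP.
- by move=> x; exact: abse_ge0.
Qed.

Lemma preserves_ae (phi : T -> T) (P : T -> Prop) : preserves m phi ->
  {ae m, forall x, P x} -> {ae m, forall x, P (phi x)}.
Proof.
move=> [mphi Hphi] [A [mA A0 PA]].
exists (phi @^-1` A); split.
- by rewrite -[X in measurable X]setTI; exact: mphi.
- have := Hphi (EFin \o \1_A) _ _.
  rewrite /= => H.
  have mphiA : measurable (phi @^-1` A).
    by rewrite -[X in measurable X]setTI; exact: mphi.
  rewrite -(setIT (phi @^-1` A)) -integral_indic//.
  rewrite (_ : (\int[m]_x _)%E = (\int[m]_x ((\1_A (phi x))%:E))%E); last by [].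
  rewrite H.
  + by rewrite integral_indic// setIT.
  + by apply/measurable_EFinP; exact: measurable_indic.
  + by move=> x; rewrite lee_fin.
- by move=> x; apply: (PA (phi x)).
Qed.

End preserves_theory.

Section space.
Context (R : realType).
Local Notation lam := (@lebesgue_measure R).
Local Notation space := (measurableTypeR R * measurableTypeR R * measurableTypeR R)%type.

Definition lam3 : {sigma_finite_measure set _ -> \bar R} := prodm (prodm lam lam) lam.

Lemma leb3E : leb3 R = lam3. Proof. by []. Qed.

Definition pcoord (p : space) (i : 'I_3) : R := [:: p.1.1 : R; p.1.2 : R; p.2 : R]`_i.

Lemma vec3E p i : vec3 p 0 i = pcoord p i. Proof. by rewrite mxE. Qed.

Lemma measurable_coord i : measurable_fun setT (fun p : space => pcoord p i).
Proof.
case: i => -[|[|[|//]]] ?; rewrite /pcoord /=.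
- exact: (measurableT_comp measurable_fst measurable_fst).
- exact: (measurableT_comp measurable_snd measurable_fst).
- exact: measurable_snd.
Qed.

Definition dist2 (x y : space) : R := \sum_i (pcoord x i - pcoord y i) ^+ 2.

Lemma dist2E (x y : space) : dist2 x y =
  ((x.1.1 : R) - y.1.1) ^+ 2 + ((x.1.2 : R) - y.1.2) ^+ 2 + ((x.2 : R) - y.2) ^+ 2.
Proof. by rewrite /dist2 !big_ord_recl big_ord0 addr0 addrA. Qed.

Lemma dist2_ge0 x y : 0 <= dist2 x y.
Proof. by apply: sumr_ge0 => i _; exact: sqr_ge0. Qed.

Lemma coord_dist2 x y i : (pcoord x i - pcoord y i) ^+ 2 <= dist2 x y.
Proof.
rewrite /dist2 (bigD1 i)//= lerDl; apply: sumr_ge0 => j _; exact: sqr_ge0.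
Qed.

Lemma measurable_dist2 : measurable_fun setT (fun q : space * space => dist2 q.1 q.2).
Proof.
apply: measurable_sum => i; apply: measurable_funX; apply: measurable_funB.
- exact: (measurableT_comp (measurable_coord i) measurable_fst).
- exact: (measurableT_comp (measurable_coord i) measurable_snd).
Qed.

Lemma preserves_affine (s a : R) : `|a| = 1 ->
  preserves lam (fun x : measurableTypeR R => s + a * (x : R) : measurableTypeR R).
Proof.
move=> a1; split.
  by apply: measurable_funD => //; apply: measurable_funM.
move=> f mf f0; rewrite [RHS](@ge0_integral_affine _ s a)//.
  by rewrite a1 mul1e.
by rewrite -normr_gt0 a1.
Qed.

Definition reflect_pt (x y : space) : space :=
  ((x.1.1 : R) - y.1.1, (x.1.2 : R) - y.1.2, (x.2 : R) - y.2).

Lemma preserves_reflect_pt x : preserves lam3 (reflect_pt x).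
Proof.
have P (c : R) : preserves lam (fun y : measurableTypeR R => (c : R) - y : measurableTypeR R).
  have := @preserves_affine c (-1); rewrite normrN1 => /(_ erefl).
  by congr preserves; apply/funext => y; rewrite mulN1r.
exact: (preserves_pair (preserves_pair (P x.1.1) (P x.1.2)) (P x.2)).
Qed.

Lemma integral_gau_shift (b c : R) : 0 < b ->
  (\int[lam]_y (gau b (c - y))%:E = (Num.sqrt pi / Num.sqrt b)%:E)%E.
Proof.
move=> b0; rewrite -integral_gau//.
have := @preserves_affine c (-1); rewrite normrN1 => /(_ erefl) [_ H].
rewrite -[RHS](H (EFin \o gau b)).
- by apply: eq_integral => y _; rewrite /= mulN1r.
- by apply/measurable_EFinP; exact: measurable_gau.
- by move=> y; rewrite lee_fin gau_ge0.
Qed.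

Definition gau3 (b : R) (x y : space) : R := expR (- (b * dist2 x y)).

Lemma gau3E b x y : gau3 b x y = gau b ((x.1.1 : R) - y.1.1) *
   gau b ((x.1.2 : R) - y.1.2) * gau b ((x.2 : R) - y.2).
Proof. by rewrite /gau3 /gau dist2E -!expRD; congr expR; ring. Qed.

Lemma gau3_ge0 b x y : 0 <= gau3 b x y. Proof. exact: expR_ge0. Qed.

Lemma measurable_gau3 b : measurable_fun setT (fun q : space * space => gau3 b q.1 q.2).
Proof.
apply: measurableT_comp => //; apply: measurableT_comp => //.
by apply: measurable_funM => //; exact: measurable_dist2.
Qed.

Lemma integral_gau3 b x : 0 < b ->
  (\int[lam3]_y (gau3 b x y)%:E = ((Num.sqrt pi / Num.sqrt b) ^+ 3)%:E)%E.
Proof.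
move=> b0; under eq_integral do rewrite gau3E.
have mg (c : R) : measurable_fun setT (fun y : measurableTypeR R => gau b (c - y)).
  by apply: (measurableT_comp (measurable_gau b)); apply: measurable_funB.
have g0 (c y : R) : 0 <= gau b (c - y) by exact: gau_ge0.
rewrite (@ge0_integral_prodM _ _ _ _ _ (prodm lam lam) lam
  (fun z : measurableTypeR R * measurableTypeR R =>
     gau b ((x.1.1 : R) - z.1) * gau b ((x.1.2 : R) - z.2))
  (fun y : measurableTypeR R => gau b ((x.2 : R) - y)))//; last 2 first.
- by apply: measurable_funM; [exact: (measurableT_comp (mg _) measurable_fst)
    |exact: (measurableT_comp (mg _) measurable_snd)].
- by move=> z; rewrite mulr_ge0.
rewrite (@ge0_integral_prodM _ _ _ _ _ lam lam
  (fun z : measurableTypeR R => gau b ((x.1.1 : R) - z))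
  (fun y : measurableTypeR R => gau b ((x.1.2 : R) - y)))//.
by rewrite !integral_gau_shift// -!EFinM exprS expr2 mulrA.
Qed.

(** The normalizing factor of the heat kernel. *)
Definition ct (t : R) : R := (4 * pi * t) `^ (- (3 / 2)).

Lemma ctE t : 0 < t -> ct t = (Num.sqrt (4 * pi * t)) ^- 3.
Proof.
move=> t0; have p0 : 0 < 4 * pi * t by rewrite !mulr_gt0// pi_gt0.
rewrite /ct powRN -powR12_sqrt ?(ltW p0)// -powR_mulrn ?powR_ge0// -powRrM.
by congr (_ `^ _)^-1; field.
Qed.

Lemma ct_gt0 t : 0 < t -> 0 < ct t.
Proof.
by move=> t0; rewrite ctE// invr_gt0 exprn_gt0// sqrtr_gt0 !mulr_gt0// pi_gt0.
Qed.

Lemma ct_gauss t k : 0 < t -> 0 < k ->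
  ct t * (Num.sqrt pi / Num.sqrt (k / (4 * t))) ^+ 3 = (Num.sqrt k) ^- 3.
Proof.
move=> t0 k0; have p0 := pi_gt0 R.
have s4 : 0 < Num.sqrt (4 * t) by rewrite sqrtr_gt0 mulr_gt0.
have sp : 0 < Num.sqrt pi :> R by rewrite sqrtr_gt0.
have sk : 0 < Num.sqrt k by rewrite sqrtr_gt0.
rewrite ctE// (_ : 4 * pi * t = pi * (4 * t)); last by ring.
rewrite [Num.sqrt (pi * _)]sqrtrM ?(ltW p0)// [Num.sqrt (k / _)]sqrtrM ?(ltW k0)// sqrtrV; last by rewrite mulr_ge0// ltW.
by field; rewrite !gt_eqF.
Qed.

(** The powers of [1 + m] produced by rescaling time in the heat kernel. *)
Lemma ct_scale t m : 0 < t -> 0 < m ->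
  ct (t / (1 + m)) = ct t * (1 + m) * Num.sqrt (1 + m).
Proof.
move=> t0 m0; have m1 : 0 < 1 + m by lra.
have p0 := pi_gt0 R.
rewrite !ctE ?divr_gt0// mulrA sqrtrM; last by rewrite !mulr_ge0// ltW.
rewrite sqrtrV ?(ltW m1)//.
have s4 : 0 < Num.sqrt (4 * pi * t) by rewrite sqrtr_gt0 !mulr_gt0.
have sm : 0 < Num.sqrt (1 + m) by rewrite sqrtr_gt0.
rewrite -[X in _ = _ * X * _](@sqr_sqrtr _ (1 + m)) ?(ltW m1)//.
by field; rewrite !gt_eqF.
Qed.

End space.

(** * The Oseen kernel *)

Section fubini.
Context d1 d2 (T1 : measurableType d1) (T2 : measurableType d2) (R : realType)
  (m1 : {sigma_finite_measure set T1 -> \bar R})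
  (m2 : {sigma_finite_measure set T2 -> \bar R}).

Lemma Rintegral_fine d (T : measurableType d) (mu : {measure set T -> \bar R})
  (f : T -> \bar R) : mu.-integrable setT f ->
  \int[mu]_x fine (f x) = fine (\int[mu]_x f x).
Proof.
move=> If; rewrite /Rintegral; congr fine.
apply: ae_eq_integral => //.
- apply/measurable_EFinP; apply: measurableT_comp => //.
  exact: measurable_int If.
- exact: measurable_int If.
- by have := integrable_ae measurableT If; apply: filterS => x /= h _; rewrite fineK// h.
Qed.

Lemma integrable_fine d (T : measurableType d) (mu : {measure set T -> \bar R})
  (f : T -> \bar R) : mu.-integrable setT f ->
  mu.-integrable setT (EFin \o (fun x => fine (f x))).
Proof.
move=> If; apply: (le_integrable measurableT _ _ If).
  apply/measurable_EFinP; apply: measurableT_comp => //; exact: measurable_int If.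
by move=> x _ /=; case: (f x) => [r| |]; rewrite ?abse0 ?leey//= normr0 leey.
Qed.

Lemma integrable_fubini_G (f : T1 * T2 -> \bar R) :
  (prodm m1 m2).-integrable setT f -> m2.-integrable setT (fubini_G m1 f).
Proof.
move=> If; have mf := measurable_int _ If.
have mG := measurable_fubini_G If.
apply/integrableP; split => //.
have fin := (@integrable21ltyP _ _ _ _ _ m1 m2 _ mf).1 If.
apply: le_lt_trans fin; apply: ge0_le_integral => //.
- exact: measurableT_comp.
- apply: (measurable_fun_fubini_tonelli_G (abse \o f)).
  + exact: measurableT_comp.
  + by move=> z; exact: abse_ge0.
- move=> y _; apply: le_abse_integral => //.
  exact: measurableT_comp mf (measurable_pair2 y).
Qed.

(** Sections that fail to be integrable form a null set and contribute the default
    value, hence integrability of the whole function suffices. *)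
Lemma Rintegral_fubini (f : T1 * T2 -> R) :
  (prodm m1 m2).-integrable setT (EFin \o f) ->
  \int[m1]_x (\int[m2]_y f (x, y)) = \int[m2]_y (\int[m1]_x f (x, y)).
Proof.
move=> If.
have E1 := Rintegral_fine (integrable_fubini_F If).
have E2 := Rintegral_fine (integrable_fubini_G If).
transitivity (fine (\int[prodm m1 m2]_z (f z)%:E)).
  by rewrite -[X in _ = fine X](integral12_prod_meas1 If) -E1.
by rewrite -[X in fine X](integral21_prod_meas1 If) -E2.
Qed.

End fubini.

Section partial_derivatives.
Context (R : realType).
Implicit Types (x y : 'rV[R]_3) (i j k : 'I_3).

Definition kron i j : R := (i == j)%:R.

(** Partial derivatives are computed along lines, as derivatives of functions of one
    real variable. *)
Lemma partial_line i (f : 'rV[R]_3 -> R) x (g : R -> R) (d : R) :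
  (forall h, f (h *: delta_mx 0 i + x) = g h) ->
  is_derive (0 : R) (1 : R) g d -> partial i f x = d.
Proof.
move=> fg dg; rewrite /partial -(derive_val (is_derive := dg)) /derive.
rewrite (_ : (fun h => _) = (fun h : R => h^-1 *: ((g \o shift 0) (h *: (1 : R)) - g 0)))//.
apply/funext => h /=.
by rewrite fg -(fg 0) scale0r add0r addr0 scaler1.
Qed.

Definition sumsq x : R := \sum_l x 0 l ^+ 2.

Lemma sumsq_ge0 x : 0 <= sumsq x.
Proof. by apply: sumr_ge0 => l _; exact: sqr_ge0. Qed.

Lemma enorm_sqr x : enorm x ^+ 2 = sumsq x.
Proof. by rewrite sqr_sqrtr// sumsq_ge0. Qed.

Lemma line_coord (h : R) i x j : (h *: delta_mx 0 i + x) 0 j = x 0 j + h * kron i j.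
Proof. by rewrite !mxE /kron eqxx /= addrC eq_sym. Qed.

Lemma sumsq_line (h : R) i x :
  sumsq (h *: delta_mx 0 i + x) = sumsq x + 2 * h * x 0 i + h ^+ 2.
Proof.
rewrite /sumsq (eq_bigr (fun l => x 0 l ^+ 2 + (2 * h * x 0 l + h ^+ 2) * kron i l)).
  rewrite big_split /= -addrA; congr (_ + _).
  rewrite (bigD1 i)//= big1 ?addr0; first by rewrite /kron eqxx mulr1.
  by move=> l /negPf li; rewrite /kron eq_sym li mulr0.
move=> l _; rewrite line_coord /kron; case: (i == l) => /=; ring.
Qed.

Lemma coord_sumsq x j : x 0 j ^+ 2 <= sumsq x.
Proof. by rewrite /sumsq (bigD1 j)//= lerDl; apply: sumr_ge0 => l _; exact: sqr_ge0. Qed.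

Lemma coordM_sumsq x j k : `|x 0 j * x 0 k| <= sumsq x.
Proof.
have hj := coord_sumsq x j; have hk := coord_sumsq x k.
have s1 := sqr_ge0 (x 0 j - x 0 k); have s2 := sqr_ge0 (x 0 j + x 0 k).
rewrite sqrrB in s1; rewrite sqrrD in s2.
by rewrite ler_norml; apply/andP; split; lra.
Qed.

Lemma heat_kernelE t y : heat_kernel t y = ct t * expR (- (sumsq y / (4 * t))).
Proof. by rewrite /heat_kernel enorm_sqr. Qed.

Section line_rules.
Variables (a : R) (f g : R -> R) (df dg : R).
Hypotheses (Hf : is_derive a (1 : R) f df) (Hg : is_derive a (1 : R) g dg).

Lemma drvD : is_derive a (1 : R) (fun h => f h + g h) (df + dg).
Proof. exact: is_deriveD. Qed.

Lemma drvN : is_derive a (1 : R) (fun h => - f h) (- df).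
Proof. exact: is_deriveN. Qed.

Lemma drvM : is_derive a (1 : R) (fun h => f h * g h) (df * g a + f a * dg).
Proof. by apply: (is_derive_eq (is_deriveM Hf Hg)); rewrite /GRing.scale/= addrC mulrC. Qed.

Lemma drvE : is_derive a (1 : R) (fun h => expR (f h)) (df * expR (f a)).
Proof.
by have := is_derive1_comp (is_derive_expR (f a)) Hf; rewrite mulrC.
Qed.

End line_rules.

Lemma drvC (a c : R) : is_derive a (1 : R) (fun=> c) 0.
Proof. exact: is_derive_cst. Qed.

Lemma drvI (a : R) : is_derive a (1 : R) (fun h => h) 1.
Proof. exact: is_derive_id. Qed.

(** The restriction of the square length to a line is a polynomial
    [S + 2 h b + h^2]. *)
Lemma drv_gauss (h S b c : R) :
  is_derive h (1 : R) (fun h => expR (- (c * (S + 2 * h * b + h ^+ 2))))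
    (- (c * 2 * (b + h)) * expR (- (c * (S + 2 * h * b + h ^+ 2)))).
Proof.
have d := drvE (drvN (drvM (drvC h c) (drvD (drvD (drvC h S)
  (drvM (drvM (drvC h 2) (drvI h)) (drvC h b))) (drvM (drvI h) (drvI h))))).
have d' := is_derive_eq d; rewrite -[X in is_derive _ _ X]/(fun h => expR (- (c * (S + 2 * h * b + h * h)))) in d'.
apply: d'; rewrite -expr2; congr (_ * _); ring.
Qed.

Lemma partial_heat_kernel t i y : partial i (heat_kernel t) y =
  - (y 0 i / (2 * t)) * heat_kernel t y.
Proof.
apply: (@partial_line _ _ _
  (fun h => ct t * expR (- ((4 * t)^-1 * (sumsq y + 2 * h * y 0 i + h ^+ 2))))).
  by move=> h; rewrite heat_kernelE sumsq_line [(4 * t)^-1 * _]mulrC.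
apply: (is_derive_eq (drvM (drvC 0 (ct t)) (drv_gauss 0 _ _ _))).
rewrite heat_kernelE mulr0 mul0r !addr0 expr0n /= addr0 [_ * sumsq y]mulrC.
rewrite !invfM mul0r add0r; set e := expR _.
rewrite (_ : 4^-1 = 2^-1 * 2^-1 :> R); last by rewrite -invfM -natrM.
have : (2 : R) != 0 by []. set t' := t^-1 => h2.
by field.
Qed.

Lemma partial2_heat_kernel t j k y : t != 0 -> partial j (partial k (heat_kernel t)) y =
  (y 0 j * y 0 k / (4 * t ^+ 2) - kron j k / (2 * t)) * heat_kernel t y.
Proof.
move=> t0.
apply: (@partial_line _ _ _
  (fun h => (- ((y 0 k + h * kron j k) / (2 * t))) *
    (ct t * expR (- ((4 * t)^-1 * (sumsq y + 2 * h * y 0 j + h ^+ 2)))))).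
  move=> h; rewrite partial_heat_kernel line_coord heat_kernelE sumsq_line.
  by rewrite [(4 * t)^-1 * _]mulrC.
apply: (is_derive_eq (drvM (drvN (drvM (drvD (drvC 0 (y 0 k)) (drvM (drvI 0) (drvC 0 (kron j k))))
  (drvC 0 (2 * t)^-1))) (drvM (drvC 0 (ct t)) (drv_gauss 0 _ _ _)))).
rewrite heat_kernelE.
rewrite (_ : - ((4 * t)^-1 * _) = - (sumsq y / (4 * t))); last by ring.
by field.
Qed.

End partial_derivatives.

(** * Gaussian moments in space *)

Section gaussian_moments.
Context (R : realType).
Local Notation lam := (@lebesgue_measure R).
Local Notation space := (measurableTypeR R * measurableTypeR R * measurableTypeR R)%type.
Local Notation lam3 := (lam3 R).

Lemma Rintegral_prod3 (f1 f2 f3 : R -> R) :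
  lam.-integrable setT (EFin \o f1) -> lam.-integrable setT (EFin \o f2) ->
  lam.-integrable setT (EFin \o f3) ->
  lam3.-integrable setT (EFin \o (fun w : space => f1 w.1.1 * f2 w.1.2 * f3 w.2)) /\
  \int[lam3]_w (f1 w.1.1 * f2 w.1.2 * f3 w.2) =
  (\int[lam]_x f1 x) * (\int[lam]_x f2 x) * (\int[lam]_x f3 x).
Proof.
move=> I1 I2 I3.
have [I12 E12] := @Rintegral_prodM _ _ _ _ _ lam lam _ _ I1 I2.
have [I123 E123] := @Rintegral_prodM _ _ _ _ _ (prodm lam lam) lam _ _ I12 I3.
by split => //; rewrite E123 E12.
Qed.

Definition origin : space := (0 : R, 0 : R, 0 : R).

Lemma gau30E b (w : space) : gau3 b origin w = gau b w.1.1 * gau b w.1.2 * gau b w.2.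
Proof. by rewrite gau3E /gau /= !sub0r !sqrrN. Qed.

Lemma gau3_moment0 b : 0 < b ->
  lam3.-integrable setT (EFin \o (fun w => gau3 b origin w)) /\
  \int[lam3]_w gau3 b origin w = (Num.sqrt pi / Num.sqrt b) ^+ 3.
Proof.
move=> b0; have Ig := integrable_gau b0.
have [] := Rintegral_prod3 Ig Ig Ig.
rewrite Rintegral_gau// => H1 H2; split.
  by apply: eq_integrable H1 => // w _; rewrite /= gau30E.
by under eq_Rintegral do rewrite gau30E; rewrite H2; ring.
Qed.

Lemma gau3_moment1 (b : R) (j : 'I_3) : 0 < b ->
  lam3.-integrable setT (EFin \o (fun w : space => pcoord w j * gau3 b origin w)) /\
  \int[lam3]_(w in [set: space]) (pcoord w j * gau3 b origin w) = 0.
Proof.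
move=> b0; have Ig := integrable_gau b0; have [I1 E1] := moment1 b0.
case: j => -[|[|[|//]]] ?; rewrite /pcoord /=.
- have [H1 H2] := Rintegral_prod3 I1 Ig Ig; split.
    by apply: eq_integrable H1 => // w _; rewrite /= gau30E !mulrA.
  by under eq_Rintegral do rewrite gau30E !mulrA; rewrite H2 E1 !mul0r.
- have [H1 H2] := Rintegral_prod3 Ig I1 Ig; split.
    by apply: eq_integrable H1 => // w _; rewrite /= gau30E; congr EFin; ring.
  transitivity (\int[lam3]_w (gau b w.1.1 * (w.1.2 * gau b w.1.2) * gau b w.2)); last by rewrite H2 E1 mulr0 mul0r.
  by apply: eq_Rintegral => w _; rewrite gau30E; ring.
- have [H1 H2] := Rintegral_prod3 Ig Ig I1; split.
    by apply: eq_integrable H1 => // w _; rewrite /= gau30E; congr EFin; ring.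
  transitivity (\int[lam3]_w (gau b w.1.1 * gau b w.1.2 * (w.2 * gau b w.2))); last by rewrite H2 E1 mulr0.
  by apply: eq_Rintegral => w _; rewrite gau30E; ring.
Qed.

Lemma gau3_moment2 (b : R) (j k : 'I_3) : 0 < b ->
  lam3.-integrable setT (EFin \o (fun w : space => pcoord w j * pcoord w k * gau3 b origin w)) /\
  \int[lam3]_(w in [set: space]) (pcoord w j * pcoord w k * gau3 b origin w) =
    kron R j k * (Num.sqrt pi / Num.sqrt b) ^+ 3 / (2 * b).
Proof.
move=> b0; have Ig := integrable_gau b0; have [I1 E1] := moment1 b0.
have [I2 E2] := moment2 b0; have E0 := Rintegral_gau b0.
have K (f1 f2 f3 : R -> R) (v : R) :
  lam.-integrable setT (EFin \o f1) -> lam.-integrable setT (EFin \o f2) ->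
  lam.-integrable setT (EFin \o f3) ->
  (forall w : space, pcoord w j * pcoord w k * gau3 b origin w = f1 w.1.1 * f2 w.1.2 * f3 w.2) ->
  (\int[lam]_x f1 x) * (\int[lam]_x f2 x) * (\int[lam]_x f3 x) = v ->
  lam3.-integrable setT (EFin \o (fun w : space => pcoord w j * pcoord w k * gau3 b origin w)) /\
  \int[lam3]_(w in [set: space]) (pcoord w j * pcoord w k * gau3 b origin w) = v.
  move=> J1 J2 J3 E V; have [H1 H2] := Rintegral_prod3 J1 J2 J3; split.
    by apply: eq_integrable H1 => // w _; rewrite /= E.
  by rewrite -V -H2; apply: eq_Rintegral => w _; rewrite E.
case: j k K => -[|[|[|//]]] ? [] [|[|[|//]]] ? K.
- by apply: (K _ _ _ _ I2 Ig Ig); [move=> w; rewrite gau30E /pcoord/=; ring|rewrite E2 E0 /kron/=; ring].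
- by apply: (K _ _ _ _ I1 I1 Ig); [move=> w; rewrite gau30E /pcoord/=; ring|rewrite E1 /kron/=; ring].
- by apply: (K _ _ _ _ I1 Ig I1); [move=> w; rewrite gau30E /pcoord/=; ring|rewrite E1 /kron/=; ring].
- by apply: (K _ _ _ _ I1 I1 Ig); [move=> w; rewrite gau30E /pcoord/=; ring|rewrite E1 /kron/=; ring].
- by apply: (K _ _ _ _ Ig I2 Ig); [move=> w; rewrite gau30E /pcoord/=; ring|rewrite E2 E0 /kron/=; ring].
- by apply: (K _ _ _ _ Ig I1 I1); [move=> w; rewrite gau30E /pcoord/=; ring|rewrite E1 /kron/=; ring].
- by apply: (K _ _ _ _ I1 Ig I1); [move=> w; rewrite gau30E /pcoord/=; ring|rewrite E1 /kron/=; ring].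
- by apply: (K _ _ _ _ Ig I1 I1); [move=> w; rewrite gau30E /pcoord/=; ring|rewrite E1 /kron/=; ring].
- by apply: (K _ _ _ _ Ig Ig I2); [move=> w; rewrite gau30E /pcoord/=; ring|rewrite E2 E0 /kron/=; ring].
Qed.

Lemma pcoord_reflect (c w : space) (j : 'I_3) : @pcoord R (@reflect_pt R c w) j = pcoord c j - pcoord w j.
Proof. by case: j => -[|[|[|//]]]. Qed.

Lemma gau3_reflect (b : R) (c w : space) : gau3 b c (@reflect_pt R c w) = gau3 b origin w.
Proof. by rewrite /gau3 !dist2E /=; congr expR; ring. Qed.

Lemma measurable_gau3r (b : R) (c : space) : measurable_fun setT (gau3 b c).
Proof. exact: (measurableT_comp (measurable_gau3 b) (measurable_pair1 c)). Qed.

(** Quadratic polynomials are integrated against a Gaussian by recentring. *)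
Lemma gau3_quad (b : R) (c : space) (al be : R) (j k : 'I_3) : 0 < b ->
  lam3.-integrable setT
    (EFin \o (fun y : space => (al * (pcoord y j * pcoord y k) - be * kron R j k) * gau3 b c y)) /\
  \int[lam3]_y ((al * (pcoord y j * pcoord y k) - be * kron R j k) * gau3 b c y) =
  (Num.sqrt pi / Num.sqrt b) ^+ 3 *
    (al * (pcoord c j * pcoord c k + kron R j k / (2 * b)) - be * kron R j k).
Proof.
move=> b0.
have mf : measurable_fun setT
    (fun y : space => (al * (pcoord y j * pcoord y k) - be * kron R j k) * gau3 b c y).
  apply: measurable_funM; last exact: measurable_gau3r.
  apply: measurable_funB => //; apply: measurable_funM => //.
  by apply: measurable_funM; exact: measurable_coord.
have [I0 E0] := gau3_moment0 b0.
have [Ij Ej] := gau3_moment1 j b0; have [Ik Ek] := gau3_moment1 k b0.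
have [I2 E2] := gau3_moment2 j k b0.
have J0 := integrableRZ (al * (pcoord c j * pcoord c k) - be * kron R j k) I0.
have J2 := integrableRZ al I2.
have Jj := integrableRZ (al * pcoord c k) Ij.
have Jk := integrableRZ (al * pcoord c j) Ik.
have E (w : space) : (al * (pcoord (@reflect_pt R c w) j * pcoord (@reflect_pt R c w) k) - be * kron R j k)
     * gau3 b c (reflect_pt c w) =
  ((al * (pcoord c j * pcoord c k) - be * kron R j k) * gau3 b origin w +
   al * (pcoord w j * pcoord w k * gau3 b origin w)) -
   ((al * pcoord c j) * (pcoord w k * gau3 b origin w) +
    (al * pcoord c k) * (pcoord w j * gau3 b origin w)).
  by rewrite gau3_reflect !pcoord_reflect; ring.
split.
  apply: (preserves_integrable (preserves_reflect_pt (R := R) c) mf).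
  have := integrableRB (integrableRD J0 J2) (integrableRD Jk Jj).
  by apply: eq_integrable => // w _; rewrite /= -E.
rewrite -(preserves_integral (preserves_reflect_pt (R := R) c) mf).
transitivity (\int[lam3]_w (((al * (pcoord c j * pcoord c k) - be * kron R j k) * gau3 b origin w +
   al * (pcoord w j * pcoord w k * gau3 b origin w)) -
   ((al * pcoord c j) * (pcoord w k * gau3 b origin w) +
    (al * pcoord c k) * (pcoord w j * gau3 b origin w)))).
  by apply: eq_Rintegral => w _; exact: E.
rewrite RintegralB//; [|exact: integrableRD|exact: integrableRD].
rewrite !RintegralD// !RintegralZl// E0 Ej Ek E2.
set X := _ ^+ 3; move: X => X; field; by rewrite gt_eqF.
Qed.

Definition scale_pt (a : R) (x : space) : space :=
  (a * (x.1.1 : R), a * (x.1.2 : R), a * (x.2 : R)).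

Lemma coord_scale (a : R) (x : space) (j : 'I_3) : @pcoord R (@scale_pt a x) j = a * pcoord x j.
Proof. by case: j => -[|[|[|//]]]. Qed.

(** Completing the square. *)
Lemma gau3M (a g : R) (x y : space) : 0 < a -> 0 <= g ->
  gau3 a origin y * gau3 g x y =
  expR (- (a * (g / (a + g)) * dist2 x origin)) * gau3 (a + g) (scale_pt (g / (a + g)) x) y.
Proof.
move=> a0 g0; rewrite /gau3 -!expRD !dist2E /=; congr expR.
by field; rewrite gt_eqF// ltr_wpDr.
Qed.

End gaussian_moments.

Section weight.
Context (R : realType).
Local Notation lam := (@lebesgue_measure R).

Definition oneD (s : R) : R := 1 + s ^+ 2.
(** The variable [s] parametrizes the Gaussians [exp (- s^2 |x|^2 / 4t)] whose
    superposition is the Newtonian kernel.  Convolution with the heat kernel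
    multiplies the exponent [|x|^2 / 4t] by [pp s] and the mass by [om s]. *)
Definition om (s : R) : R := (Num.sqrt (oneD s)) ^- 3.
Definition pp (s : R) : R := s ^+ 2 / oneD s.

Lemma oneD_ge1 s : 1 <= oneD s. Proof. by rewrite lerDl sqr_ge0. Qed.
Lemma oneD_gt0 s : 0 < oneD s. Proof. exact: lt_le_trans (oneD_ge1 s). Qed.

Lemma om_ge0 s : 0 <= om s.
Proof. by rewrite invr_ge0 exprn_ge0// sqrtr_ge0. Qed.

Lemma om_le s : om s <= (oneD s)^-1.
Proof.
rewrite /om lef_pV2 ?posrE ?exprn_gt0 ?sqrtr_gt0 ?oneD_gt0//.
rewrite exprS sqr_sqrtr ?(ltW (oneD_gt0 _))// ler_pMl ?oneD_gt0//.
by rewrite -sqrtr1 ler_wsqrtr// oneD_ge1.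
Qed.

Lemma pp_ge0 s : 0 <= pp s.
Proof. by rewrite divr_ge0 ?sqr_ge0// ltW// oneD_gt0. Qed.

Lemma pp_le1 s : pp s <= 1.
Proof. by rewrite ler_pdivrMr ?oneD_gt0// mul1r /oneD lerDr. Qed.

Lemma measurable_oneD : measurable_fun setT oneD.
Proof. by apply: measurable_funD => //; exact: measurable_funX. Qed.

Lemma measurable_om : measurable_fun setT om.
Proof.
apply: (measurableT_comp (@measurable_invR R)); apply: measurable_funX.
by apply: (measurableT_comp (@measurable_sqrtR R)); exact: measurable_oneD.
Qed.

Lemma measurable_pp : measurable_fun setT pp.
Proof.
apply: measurable_funM; first exact: measurable_funX.
by apply: (measurableT_comp (@measurable_invR R)); exact: measurable_oneD.
Qed.

Lemma integral_oneDV : (\int[lam]_s ((oneD s)^-1)%:E = pi%:E)%E.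
Proof.
rewrite (@ge0_symfun_integralT _ (fun s : R => (oneD s)^-1)).
- have -> : [set x | 0 <= x] = `[0, +oo[%classic :> set R.
    by apply/seteqP; split => x /=; rewrite in_itv/= andbT.
  rewrite [X in (_ * X)%E](@integral0y_oneDsqr R) -EFinM; congr EFin; by field.
- by move=> s; rewrite invr_ge0 ltW// oneD_gt0.
- move=> s; apply: (@continuous_oneDsqrV R s).
- by move=> s; rewrite /= /oneD sqrrN.
Qed.

Lemma integrable_om : lam.-integrable setT (EFin \o om).
Proof.
apply: (@integrable_le _ _ _ lam om (fun s => (oneD s)^-1) pi).
- exact: measurable_om.
- by apply: (measurableT_comp (@measurable_invR R)); exact: measurable_oneD.
- by move=> s; rewrite ger0_norm ?om_ge0 ?om_le.
- by rewrite integral_oneDV.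
Qed.

Lemma integrable_omM (f : R -> R) C : measurable_fun setT f -> (forall s, `|f s| <= C) ->
  lam.-integrable setT (EFin \o (fun s => om s * f s)).
Proof.
move=> mf fC; have C0 : 0 <= C by apply: le_trans (fC 0).
apply: (@integrable_le _ _ _ lam _ (fun s => C * (oneD s)^-1) (C * pi)).
- by apply: measurable_funM => //; exact: measurable_om.
- apply: measurable_funM => //; apply: (measurableT_comp (@measurable_invR R)).
  exact: measurable_oneD.
- move=> s; rewrite normrM mulrC (ger0_norm (om_ge0 _)).
  by apply: ler_pM => //; [exact: om_ge0|exact: om_le].
- under eq_integral do rewrite EFinM.
  rewrite ge0_integralZl//; last 2 first.
  + apply/measurable_EFinP; apply: (measurableT_comp (@measurable_invR R)).
    exact: measurable_oneD.
  + by move=> s _; rewrite lee_fin invr_ge0 ltW// oneD_gt0.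
  by rewrite integral_oneDV -EFinM.
Qed.

(** Every integral over [s] met below is of this form. *)
Lemma integrable_om_poly (c a1 a2 a3 : R) : 0 <= c ->
  lam.-integrable setT (EFin \o (fun s => om s * (expR (- (pp s * c)) *
    (a1 * pp s + a2 * pp s ^+ 2 + a3 * pp s ^+ 3)))).
Proof.
move=> c0; apply: (@integrable_omM _ (`|a1| + `|a2| + `|a3|)).
  apply: measurable_funM.
    apply: measurableT_comp => //; apply: measurableT_comp => //.
    by apply: measurable_funM => //; exact: measurable_pp.
  have mX n : measurable_fun setT (fun s => pp s ^+ n) by apply: measurable_funX; exact: measurable_pp.
  apply: measurable_funD; last exact: measurable_funM.
  apply: measurable_funD; last exact: measurable_funM.
  by apply: measurable_funM => //; exact: measurable_pp.
move=> s; have p0 := pp_ge0 s; have p1 := pp_le1 s.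
rewrite normrM -[leRHS]mul1r; apply: ler_pM => //.
  by rewrite ger0_norm ?expR_ge0// -[leRHS]expR0 ler_expR oppr_le0 mulr_ge0.
apply: (le_trans (ler_normD _ _)); apply: lerD.
  apply: (le_trans (ler_normD _ _)); apply: lerD.
    by rewrite normrM ler_piMr// ger0_norm.
  by rewrite normrM ler_piMr// ger0_norm ?exprn_ge0// exprn_ile1.
by rewrite normrM ler_piMr// ger0_norm ?exprn_ge0// exprn_ile1.
Qed.

End weight.

(** * The Newtonian potential of the Hessian of the heat kernel *)

Section potential.
Context (R : realType).
Local Notation lam := (@lebesgue_measure R).
Local Notation space := (measurableTypeR R * measurableTypeR R * measurableTypeR R)%type.
Local Notation lam3 := (lam3 R).
Local Notation origin := (origin R).

Definition pt (x : 'rV[R]_3) : space := (x 0 0, x 0 1, x 0 2).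

Lemma vec3_pt x : vec3 (pt x) = x.
Proof.
apply/rowP => i; rewrite vec3E; case: i => -[|[|[|//]]] ?; rewrite /pcoord /=;
  by congr (x 0 _); apply/val_inj.
Qed.

Lemma sumsq_vec3 (p : space) : sumsq (vec3 p) = dist2 p origin.
Proof.
apply: eq_bigr => i _; rewrite vec3E.
by case: i => -[|[|[|//]]] ?; rewrite /pcoord /= subr0.
Qed.

Lemma sumsq_vec3B (x y : space) : sumsq (vec3 x - vec3 y) = dist2 x y.
Proof. by apply: eq_bigr => i _; rewrite !mxE. Qed.

(** The Newtonian kernel as a superposition of Gaussians. *)
Lemma newton_gauss t z : 0 < t -> 0 <= z ->
  (4 * pi * Num.sqrt z)^-1 = ct t * t * \int[lam]_s gau (z / (4 * t)) s.
Proof.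
move=> t0; rewrite le_eqVlt => /predU1P[<-|z0].
  rewrite sqrtr0 mulr0 invr0 mul0r /Rintegral.
  under eq_integral do rewrite /gau mul0r oppr0 expR0.
  rewrite integral_cst// mul1e.
  have E : lam setT = +oo%E by rewrite -set_itvNyy lebesgue_measure_itv.
  by rewrite [X in fine X]E /= mulr0.
have p0 := pi_gt0 R; have sp : 0 < Num.sqrt pi :> R by rewrite sqrtr_gt0.
have s4 : 0 < Num.sqrt (4 * t) by rewrite sqrtr_gt0 mulr_gt0.
have sz : 0 < Num.sqrt z by rewrite sqrtr_gt0.
rewrite Rintegral_gau ?divr_gt0 ?mulr_gt0// ctE// (_ : 4 * pi * t = pi * (4 * t)); last by ring.
rewrite [Num.sqrt (pi * _)]sqrtrM ?(ltW p0)// [Num.sqrt (z / _)]sqrtrM ?(ltW z0)// sqrtrV; last first.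
  by rewrite mulr_ge0// ltW.
rewrite -{1}(sqr_sqrtr (ltW p0)) (_ : t = Num.sqrt (4 * t) ^+ 2 / 4); last first.
  by rewrite sqr_sqrtr ?mulr_ge0// ?ltW//; field.
rewrite [in RHS](_ : 4 * (_ / 4) = 4 * t); last first.
  by rewrite sqr_sqrtr ?mulr_ge0// ?ltW//; field.
by field; rewrite !gt_eqF.
Qed.

Variables (t : R) (t0 : 0 < t) (j k : 'I_3).

(** The polynomial factor of the Hessian of the heat kernel. *)
Definition hess (y : space) : R :=
  (4 * t ^+ 2)^-1 * (pcoord y j * pcoord y k) - (2 * t)^-1 * kron R j k.

Lemma measurable_hess : measurable_fun setT hess.
Proof.
apply: measurable_funB => //; apply: measurable_funM => //.
by apply: measurable_funM; exact: measurable_coord.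
Qed.

(** Half of the Gaussian decay is spent on the polynomial factor. *)
Lemma hess_le y : `|hess y| <= (5 / 2) / t * expR (dist2 y origin / (8 * t)).
Proof.
set S := dist2 y origin.
have S0 : 0 <= S by exact: dist2_ge0.
have h1 : `|pcoord y j * pcoord y k| <= S.
  by rewrite /S -sumsq_vec3 -!vec3E; exact: coordM_sumsq.
have h2 : `|kron R j k| <= 1 by rewrite /kron; case: (_ == _); rewrite ?normr1 ?normr0.
have h3 := expR_ge1Dx (S / (8 * t)).
have tV : 0 < t^-1 by rewrite invr_gt0.
apply: (@le_trans _ _ ((4 * t ^+ 2)^-1 * S + (2 * t)^-1)).
  apply: (le_trans (ler_normB _ _)); apply: lerD.
    rewrite normrM (ger0_norm (ltW _)) ?invr_gt0 ?mulr_gt0// ?exprn_gt0//.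
    by apply: ler_wpM2l => //; rewrite ltW// invr_gt0 mulr_gt0// exprn_gt0.
  rewrite normrM (ger0_norm (ltW _)) ?invr_gt0 ?mulr_gt0//.
  by rewrite ler_piMr// invr_ge0 mulr_ge0// ltW.
apply: (@le_trans _ _ ((5 / 2) / t * (1 + S / (8 * t)))); last first.
  by rewrite ler_pM2l// mulr_gt0.
rewrite -subr_ge0 (_ : _ - _ = 2 / t + (S / t ^+ 2) / 16).
  by rewrite addr_ge0// ?divr_ge0// ?sqr_ge0// ltW.
by field; rewrite gt_eqF.
Qed.

Definition pot (x : space) : R :=
  ct t * (2^-1 * \int[lam]_s (om s * (expR (- (pp s * (dist2 x origin / (4 * t)))) *
    (pp s ^+ 2 / (2 * t) * (pcoord x j * pcoord x k) - pp s * kron R j k)))).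

Lemma gau_gau3 x y (s : R) : gau (dist2 x y / (4 * t)) s = gau3 (s ^+ 2 / (4 * t)) x y.
Proof. by rewrite /gau /gau3; congr (expR (- _)); ring. Qed.

(** Completing the square and the moments of the recentred Gaussian; the variance
    term and the trace term of the Hessian combine into [- pp s]. *)
Lemma inner_gauss x s :
  \int[lam3]_y (hess y * gau3 (4 * t)^-1 origin y * gau (dist2 x y / (4 * t)) s) =
  (ct t)^-1 * (om s * (expR (- (pp s * (dist2 x origin / (4 * t)))) *
    ((4 * t ^+ 2)^-1 * (pp s ^+ 2 * (pcoord x j * pcoord x k)) - pp s / (2 * t) * kron R j k))).
Proof.
have t4 : 0 < (4 * t)^-1 by rewrite invr_gt0 mulr_gt0.
have st : 0 <= s ^+ 2 / (4 * t) by rewrite divr_ge0 ?sqr_ge0// mulr_ge0// ltW.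
have bE : (4 * t)^-1 + s ^+ 2 / (4 * t) = oneD s / (4 * t) by rewrite /oneD [RHS]mulrDl mul1r.
have b0 : 0 < oneD s / (4 * t) by rewrite divr_gt0 ?oneD_gt0// mulr_gt0.
have o0 := oneD_gt0 s.
have PE : s ^+ 2 / (4 * t) / (oneD s / (4 * t)) = pp s.
  by rewrite /pp; field; rewrite !gt_eqF.
pose e := expR (- (pp s * (dist2 x origin / (4 * t)))).
transitivity (\int[lam3]_y (e * (hess y * gau3 (oneD s / (4 * t)) (scale_pt (pp s) x) y))).
  apply: eq_Rintegral => y _; rewrite gau_gau3 -mulrA gau3M// bE PE mulrCA -mulrA.
  by congr (expR (- _) * _); ring.
have [Iq Eq] := gau3_quad (scale_pt (pp s) x) (4 * t ^+ 2)^-1 (2 * t)^-1 j k b0.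
rewrite RintegralZl// Eq !coord_scale.
have := ct_gauss t0 o0; rewrite -/(om s) => <-.
rewrite -/e (_ : 2 * (oneD s / (4 * t)) = oneD s / (2 * t)); last by field; rewrite gt_eqF.
have ->: kron R j k / (oneD s / (2 * t)) = 2 * t * (1 - pp s) * kron R j k.
  have -> : 1 - pp s = (oneD s)^-1.
    rewrite /pp -[X in X - _](divff (lt0r_neq0 o0)) -mulrBl {1}/oneD addrK mul1r //.
  by field; rewrite !gt_eqF.
have c0 := ct_gt0 t0.
set X := _ ^+ 3; move: X => X.
by field; rewrite !gt_eqF.
Qed.

Let F x (z : space * measurableTypeR R) : R :=
  hess z.1 * gau3 (4 * t)^-1 origin z.1 * gau (dist2 x z.1 / (4 * t)) z.2.

Let measurable_F x : measurable_fun setT (F x).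
Proof.
apply: measurable_funM.
  apply: measurable_funM.
    exact: (measurableT_comp measurable_hess measurable_fst).
  exact: (measurableT_comp (measurable_gau3r _ _) measurable_fst).
apply: measurableT_comp => //; apply: measurableT_comp => //.
apply: measurable_funM.
  apply: measurable_funM => //.
  exact: (measurableT_comp (measurableT_comp (@measurable_dist2 R) (measurable_pair1 x)) measurable_fst).
by apply: measurable_funX.
Qed.

Let integrable_F x : (prodm lam3 lam).-integrable setT (EFin \o F x).
Proof.
have t8 : 0 < (8 * t)^-1 by rewrite invr_gt0 mulr_gt0.
pose C := (5 / 2) / t; have C0 : 0 < C by rewrite !divr_gt0.
have c0 := ct_gt0 t0.
pose B := C * (4 / ct t).
have B0 : 0 <= B by apply/ltW; rewrite mulr_gt0// divr_gt0.
apply: (@integrable_le _ _ _ (prodm lam3 lam) _ (fun z => `|F x z|) (B * pi)) => //.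
  by apply: measurableT_comp.
apply: (@prodm_integral_le _ _ _ _ R lam3 lam (fun z => `|F x z|) (B * pi) (fun s => B * (oneD s)^-1)) => //.
- exact: measurableT_comp.
- apply: measurable_funM => //; apply: (measurableT_comp (@measurable_invR R)).
  exact: measurable_oneD.
- move=> s.
  have st : 0 <= s ^+ 2 / (4 * t) by rewrite divr_ge0 ?sqr_ge0// mulr_ge0// ltW.
  have k0 : 0 < 1 / 2 + s ^+ 2 by rewrite ltr_wpDr ?sqr_ge0.
  have bE : (8 * t)^-1 + s ^+ 2 / (4 * t) = (1 / 2 + s ^+ 2) / (4 * t).
    by field; rewrite gt_eqF.
  have b0 : 0 < (1 / 2 + s ^+ 2) / (4 * t) by rewrite divr_gt0// mulr_gt0.
  set b := (1 / 2 + s ^+ 2) / (4 * t) in bE b0.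
  set c := scale_pt ((s ^+ 2 / (4 * t)) / b) x.
  apply: (@le_trans _ _ (\int[lam3]_y (C * gau3 b c y)%:E)%E).
    apply: ge0_le_integral => //.
    + apply/measurable_EFinP; apply: measurableT_comp => //.
      exact: (measurableT_comp (measurable_F x) (measurable_pair2 s)).
    + by apply/measurable_EFinP; apply: measurable_funM => //; exact: measurable_gau3r.
    + move=> y _; rewrite lee_fin /F /= gau_gau3 -mulrA normrM.
      rewrite [`|gau3 _ _ _ * _|]ger0_norm ?mulr_ge0 ?gau3_ge0//.
      have hy := hess_le y; rewrite -/C in hy.
      apply: (@le_trans _ _ (C * (gau3 (8 * t)^-1 origin y * gau3 (s ^+ 2 / (4 * t)) x y))).
        have -> : gau3 (8 * t)^-1 origin y = expR (dist2 y origin / (8 * t)) * gau3 (4 * t)^-1 origin y.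
          rewrite /gau3 -expRD; congr expR; rewrite !dist2E /=; field; by rewrite gt_eqF.
        by rewrite !mulrA -[leRHS]mulrA -[leLHS]mulrA; apply: ler_wpM2r => //; rewrite mulr_ge0// gau3_ge0.
      rewrite gau3M// bE -/c; apply: ler_wpM2l; first exact: ltW.
      apply: ler_piMl; first exact: gau3_ge0.
      rewrite -[leRHS]expR0 ler_expR oppr_le0; apply: mulr_ge0; last exact: dist2_ge0.
      by apply: mulr_ge0; [rewrite invr_ge0 mulr_ge0// ltW|rewrite divr_ge0// ltW].
  rewrite (eq_integral (fun y => (C%:E * (gau3 b c y)%:E)%E)); last by move=> y _; rewrite EFinM.
  rewrite ge0_integralZl//; last 3 first.
  + by apply/measurable_EFinP; exact: measurable_gau3r.
  + by move=> y _; rewrite lee_fin gau3_ge0.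
  + by rewrite lee_fin ltW.
  rewrite integral_gau3// -EFinM lee_fin /B -mulrA; apply: ler_wpM2l; first exact: ltW.
  have := ct_gauss t0 k0; rewrite -/b => H.
  rewrite (_ : 4 / ct t / oneD s = 4 / oneD s / ct t); last by rewrite mulrAC.
  rewrite ler_pdivlMr// mulrC H.
  have s2 : 1 / 2 <= Num.sqrt (1 / 2 + s ^+ 2).
    rewrite -[leLHS]ger0_norm// -sqrtr_sqr ler_wsqrtr//.
    have := sqr_ge0 s; rewrite expr2; lra.
  rewrite -[leRHS]invrK lef_pV2 ?posrE ?invr_gt0 ?divr_gt0 ?oneD_gt0 ?exprn_gt0 ?sqrtr_gt0//.
  have -> : (4 / oneD s)^-1 = (1 / 2) * ((1 / 2) * oneD s) by field; rewrite gt_eqF// oneD_gt0.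
  rewrite exprS; apply: ler_pM => //.
    by rewrite mulr_ge0// ltW// oneD_gt0.
  rewrite sqr_sqrtr ?(ltW k0)// /oneD; have := sqr_ge0 s; rewrite expr2; lra.
- under eq_integral do rewrite EFinM.
  rewrite ge0_integralZl//; last 2 first.
  + apply/measurable_EFinP; apply: (measurableT_comp (@measurable_invR R)).
    exact: measurable_oneD.
  + by move=> s _; rewrite lee_fin invr_ge0 ltW// oneD_gt0.
  by rewrite integral_oneDV -EFinM.
Qed.

(** Valid without integrability, as an infinite integral of a nonnegative function has
    the value [0] on both sides. *)
Lemma Rintegral_ge0Z d (T : measurableType d) (mu : {measure set T -> \bar R}) (c : R) (f : T -> R) :
  measurable_fun setT f -> (forall x, 0 <= f x) ->
  \int[mu]_x (c * f x) = c * \int[mu]_x f x.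
Proof.
move=> mf f0; rewrite /Rintegral.
have K (a : R) : 0 <= a -> fine (\int[mu]_x (a * f x)%:E)%E = a * fine (\int[mu]_x (f x)%:E)%E.
  move=> a0; under eq_integral do rewrite EFinM.
  rewrite ge0_integralZl//; last 2 first.
  - exact/measurable_EFinP.
  - by move=> x _; rewrite lee_fin.
  have : (0 <= \int[mu]_x (f x)%:E)%E by apply: integral_ge0 => x _; rewrite lee_fin.
  case: (\int[mu]_x (f x)%:E)%E => [r|_|//]; first by [].
  have [->|an0] := eqVneq a 0; first by rewrite mul0e mul0r.
  by rewrite gt0_muley ?lte_fin ?lt_def ?an0//= mulr0.
have [c0|c0] := leP 0 c; first exact: K.
have := K (- c); rewrite oppr_ge0 => /(_ (ltW c0)).
rewrite mulNr => /(congr1 -%R); rewrite opprK => <-.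
rewrite -fineN -integral_ge0N//; last first.
  by move=> x _; rewrite lee_fin mulr_ge0// oppr_ge0 ltW.
by congr fine; apply: eq_integral => x _; rewrite -EFinN mulNr opprK.
Qed.

(** Fubini for the superposition of Gaussians against the Hessian. *)
Lemma inv_neg_laplacian_pot (x : space) :
  inv_neg_laplacian (partial j (partial k (heat_kernel t))) (vec3 x) = pot x.
Proof.
have t1 : t != 0 by rewrite gt_eqF.
have c0 := ct_gt0 t0.
rewrite /inv_neg_laplacian leb3E.
transitivity (\int[lam3]_y (ct t ^+ 2 * t * \int[lam]_s F x (y, s))).
  apply: eq_Rintegral => y _.
  rewrite partial2_heat_kernel// heat_kernelE sumsq_vec3.
  have -> : enorm (vec3 x - vec3 y) = Num.sqrt (dist2 x y) by rewrite -sumsq_vec3B.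
  rewrite (@newton_gauss t)//; last exact: dist2_ge0.
  rewrite /F /= Rintegral_ge0Z; last 2 first.
  - exact: measurable_gau.
  - by move=> s; exact: gau_ge0.
  rewrite /hess !vec3E (_ : expR _ = gau3 (4 * t)^-1 origin y); last first.
    by rewrite /gau3; congr (expR (- _)); rewrite !dist2E; ring.
  by ring.
rewrite RintegralZl//; last first.
  exact: (integrable_fine (integrable_fubini_F (integrable_F x))).
rewrite (Rintegral_fubini (integrable_F x)).
have r0 : 0 <= dist2 x origin / (4 * t) by rewrite divr_ge0 ?dist2_ge0// mulr_ge0// ltW.
have := integrable_om_poly (- kron R j k) ((2 * t)^-1 * (pcoord x j * pcoord x k)) 0 r0.
rewrite (_ : (EFin \o _) = EFin \o (fun s => om s * (expR (- (pp s * (dist2 x origin / (4 * t)))) *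
    (pp s ^+ 2 / (2 * t) * (pcoord x j * pcoord x k) - pp s * kron R j k)))); last first.
  by apply/funext => s /=; congr EFin; ring.
move=> I.
rewrite /pot; set B := (B in EFin \o B) in I *.
transitivity (ct t ^+ 2 * t * \int[lam]_s ((ct t)^-1 / (2 * t) * B s)).
  congr (_ * _); apply: eq_Rintegral => s _.
  by rewrite /F /= inner_gauss /B; field; rewrite !gt_eqF.
rewrite RintegralZl// /B; set X := (\int[lam]_s _); move: X => X.
by field; rewrite !gt_eqF.
Qed.

End potential.

Section kernel_formula.
Context (R : realType).
Local Notation lam := (@lebesgue_measure R).
Local Notation space := (measurableTypeR R * measurableTypeR R * measurableTypeR R)%type.
Local Notation lam3 := (lam3 R).
Local Notation origin := (origin R).

(** Differentiation under the integral sign, dominated by a multiple of [om]. *)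
Lemma is_derive_integral (f df : R -> R -> R) (C : R) :
  (forall h s, is_derive h (1 : R) (f ^~ s) (df h s)) ->
  (forall h, -1 < h < 1 -> lam.-integrable setT (EFin \o f h)) ->
  (forall h s, -1 < h < 1 -> `|df h s| <= C * om s) ->
  is_derive (0 : R) (1 : R) (fun h => \int[lam]_s f h s) (\int[lam]_s df 0 s).
Proof.
move=> Hd Hi Hb.
have C0 : 0 <= C * om 0.
  by apply: le_trans (Hb 0 0 _); [exact: normr_ge0|rewrite ltrN10 ltr01].
have om0 : om 0 = 1 :> R by rewrite /om /oneD expr0n /= addr0 sqrtr1 expr1n invr1.
rewrite om0 mulr1 in C0.
have inI : (0 : R) \in `](-1), (1:R)[ by rewrite in_itv/= ltrN10 ltr01.
have I1 h : `](-1), (1:R)[%classic h -> lam.-integrable setT (EFin \o f h).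
  by rewrite /= in_itv/=; exact: Hi.
have I2 h s : `](-1), (1:R)[%classic h -> setT s -> derivable (f ^~ s) h 1.
  by move=> _ _; case: (Hd h s).
have P h s : partial1of2 f h s = df h s.
  by rewrite /partial1of2 derive1E (derive_val (is_derive := Hd h s)).
have I3 h s : `](-1), (1:R)[%classic h -> setT s -> `|partial1of2 f h s| <= C * om s.
  by rewrite /= in_itv/= => hh _; rewrite P; exact: Hb.
have G0 s : 0 <= C * om s by rewrite mulr_ge0 ?om_ge0.
have IG : lam.-integrable setT (EFin \o (fun s => C * om s)).
  exact: (integrableRZ C (integrable_om R)).
have D1 := @derivable_under_integral _ _ _ lam f setT measurableT 0 (-1) 1 inI I1 I2 _ G0 IG I3.
have D2 := @differentiation_under_integral _ _ _ lam f setT measurableT 0 (-1) 1 inI I1 I2 _ G0 IG I3.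
split=> //; rewrite -derive1E D2; apply: eq_Rintegral => s _; exact: P.
Qed.

Definition oseen_inner (t : R) (i j k : 'I_3) (z : space) (s : R) : R :=
  expR (- (pp s * (dist2 z origin / (4 * t)))) *
    ((kron R i j * pcoord z k + kron R i k * pcoord z j + kron R j k * pcoord z i) * pp s ^+ 2 / (2 * t)
      - pcoord z i * pcoord z j * pcoord z k * pp s ^+ 3 / (4 * t ^+ 2)).

(** Explicit form of the kernel of the heat semigroup composed with the
    Leray projection and the divergence. *)
Definition oseen (t : R) (i j k : 'I_3) (z : space) : R :=
  ct t * (2^-1 * \int[lam]_s (om s * oseen_inner t i j k z s)
    - kron R i j * (pcoord z k / (2 * t)) * expR (- (dist2 z origin / (4 * t)))).

Variables (t : R) (t0 : 0 < t).

Lemma partial_pot i j k (z : space) :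
  partial i (fun x => pot t j k (pt x)) (vec3 z) =
  ct t * (2^-1 * \int[lam]_s (om s * oseen_inner t i j k z s)).
Proof.
have t1 : t != 0 by rewrite gt_eqF.
pose S := dist2 z origin; pose zi := pcoord z i; pose zj := pcoord z j; pose zk := pcoord z k.
pose E s h := expR (- (pp s / (4 * t) * (S + 2 * h * zi + h ^+ 2))).
pose q s h := pp s ^+ 2 / (2 * t) * ((zj + h * kron R i j) * (zk + h * kron R i k)) - pp s * kron R j k.
pose f h s := om s * (E s h * q s h).
pose dq s h := pp s ^+ 2 / (2 * t) * (kron R i j * (zk + h * kron R i k) + (zj + h * kron R i j) * kron R i k).
pose df h s := om s * (- (pp s / (4 * t) * 2 * (zi + h)) * E s h * q s h + E s h * dq s h).
have Sh h : dist2 (pt (h *: delta_mx 0 i + vec3 z)) origin = S + 2 * h * zi + h ^+ 2.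
  by rewrite -sumsq_vec3 vec3_pt sumsq_line sumsq_vec3 vec3E.
have ph h l : pcoord (pt (h *: delta_mx 0 i + vec3 z)) l = pcoord z l + h * kron R i l.
  by rewrite -vec3E vec3_pt line_coord vec3E.
have Hdf h s : is_derive h (1 : R) (f ^~ s) (df h s).
  have dlin (a b : R) : is_derive h (1 : R) (fun h => a + h * b) b.
    by apply: (is_derive_eq (drvD (drvC h a) (drvM (drvI h) (drvC h b)))); ring.
  have dE := drv_gauss h S zi (pp s / (4 * t)).
  have dq' : is_derive h (1 : R) (q s) (dq s h).
    apply: (is_derive_eq (drvD (drvM (drvC h (pp s ^+ 2 / (2 * t)))
      (drvM (dlin zj (kron R i j)) (dlin zk (kron R i k)))) (drvC h (- (pp s * kron R j k))))).
    by rewrite /dq; ring.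
  by apply: (is_derive_eq (drvM (drvC h (om s)) (drvM dE dq'))); rewrite /df /E; ring.
have Sh0 h : 0 <= S + 2 * h * zi + h ^+ 2 by rewrite -Sh dist2_ge0.
have If h : lam.-integrable setT (EFin \o f h).
  have r0 : 0 <= (S + 2 * h * zi + h ^+ 2) / (4 * t).
    by rewrite divr_ge0 ?Sh0// mulr_ge0// ltW.
  have := integrable_om_poly (- kron R j k) ((2 * t)^-1 * ((zj + h * kron R i j) * (zk + h * kron R i k))) 0 r0.
  apply: eq_integrable => // s _ /=; rewrite /f /E /q; congr (_%:E).
  rewrite (_ : pp s * (_ / _) = pp s / (4 * t) * (S + 2 * h * zi + h ^+ 2)); last by ring.
  by ring.
have d01 a b : `|kron R a b| <= 1 by rewrite /kron; case: (_ == _); rewrite ?normr1 ?normr0.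
pose tv := (2 * t)^-1; have tv0 : 0 < tv by rewrite invr_gt0 mulr_gt0.
pose C := tv * (`|zi| + 1) * (tv * ((`|zj| + 1) * (`|zk| + 1)) + 1) + tv * ((`|zk| + 1) + (`|zj| + 1)).
have Hb h s : -1 < h < 1 -> `|df h s| <= C * om s.
  move=> /andP[h1 h2]; have hn : `|h| <= 1 by rewrite ler_norml; apply/andP; split; lra.
  have p0 := pp_ge0 s; have p1 := pp_le1 s; have pn : `|pp s| <= 1 by rewrite ger0_norm.
  have lin (a : R) l : `|a + h * kron R i l| <= `|a| + 1.
    apply: (le_trans (ler_normD _ _)); rewrite lerD2l normrM -[leRHS]mulr1.
    exact: ler_pM.
  have E1 : `|E s h| <= 1.
    rewrite ger0_norm ?expR_ge0// -[leRHS]expR0 ler_expR oppr_le0 mulr_ge0 ?Sh0//.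
    by rewrite divr_ge0// mulr_ge0// ltW.
  have qb : `|q s h| <= tv * ((`|zj| + 1) * (`|zk| + 1)) + 1.
    apply: (le_trans (ler_normB _ _)); apply: lerD; last first.
      by rewrite normrM -[leRHS]mulr1; apply: ler_pM.
    rewrite normrM; apply: ler_pM => //; last by rewrite normrM; apply: ler_pM.
    rewrite normrM normrX -[leRHS]mul1r; apply: ler_pM; rewrite ?exprn_ge0 ?exprn_ile1//.
    by rewrite ger0_norm// ltW.
  have dqb : `|dq s h| <= tv * ((`|zk| + 1) + (`|zj| + 1)).
    rewrite normrM; apply: ler_pM => //.
      rewrite normrM normrX -[leRHS]mul1r; apply: ler_pM; rewrite ?exprn_ge0 ?exprn_ile1//.
      by rewrite ger0_norm// ltW.
    apply: (le_trans (ler_normD _ _)); rewrite !normrM; apply: lerD.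
      by rewrite -[leRHS]mul1r; apply: ler_pM.
    by rewrite -[leRHS]mulr1; apply: ler_pM.
  rewrite /df normrM (ger0_norm (om_ge0 s)) mulrC; apply: ler_wpM2r; first exact: om_ge0.
  apply: (le_trans (ler_normD _ _)); apply: lerD; last first.
    by rewrite normrM -[leRHS]mul1r; apply: ler_pM.
  rewrite !normrM normrN; apply: ler_pM => //.
  rewrite -[leRHS]mulr1; apply: ler_pM => //.
  rewrite normrM; apply: ler_pM => //; last first.
    by apply: (le_trans (ler_normD _ _)); rewrite lerD2l.
  rewrite (_ : pp s / (4 * t) * 2 = pp s * tv); last by rewrite /tv; field.
  rewrite normrM -[leRHS]mul1r; apply: ler_pM => //.
  by rewrite ger0_norm// ltW.
have D := @is_derive_integral f df C Hdf (fun h _ => If h) Hb.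
apply: (@partial_line _ _ _ _ (fun h => ct t * (2^-1 * \int[lam]_s f h s))).
  move=> h; rewrite /pot; congr (_ * (_ * _)); apply: eq_Rintegral => s _.
  rewrite Sh !ph /f /E /q; congr (_ * (expR (- _) * _)).
  by ring.
apply: (is_derive_eq (drvM (drvC 0 (ct t)) (drvM (drvC 0 2^-1) D))).
rewrite !mul0r !add0r; congr (_ * (_ * _)); apply: eq_Rintegral => s _.
rewrite /df /oseen_inner /E /q /dq -/S -/zi -/zj -/zk !mul0r !addr0 !mulr0 mul0r expr0n /= !addr0.
rewrite (_ : pp s * (S / (4 * t)) = pp s / (4 * t) * S); last by ring.
by field.
Qed.

Lemma partial_cst i (c : R) x : partial i (fun=> c) x = 0.
Proof. exact: (@partial_line _ _ _ _ (fun=> c) 0 _ (drvC 0 c)). Qed.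

Lemma oseen_kernelE j k i (z : space) : oseen_kernel t j k (vec3 z) 0 i = oseen t i j k z.
Proof.
rewrite /oseen_kernel /leray.
rewrite (_ : divergence _ = partial j (partial k (heat_kernel t))); last first.
  apply/funext => y; rewrite /divergence (bigD1 j)//= big1 ?addr0.
    congr (partial j _ y); apply/funext => x; by rewrite !mxE !eqxx mulr1.
  move=> l lj; rewrite (_ : (fun _ => _) = fun=> 0) ?partial_cst//.
  by apply/funext => x; rewrite !mxE (negPf lj) andbF mulr0.
rewrite (_ : inv_neg_laplacian _ = fun x => pot t j k (pt x)); last first.
  by apply/funext => x; rewrite -inv_neg_laplacian_pot// vec3_pt.
rewrite !mxE partial_pot /oseen eqxx /= partial_heat_kernel vec3E heat_kernelE sumsq_vec3.
by rewrite -/(kron R i j); ring.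
Qed.

End kernel_formula.

(** * Jets of the heat and Oseen kernels *)

Section jets.
Context (R : realType).
Local Notation lam := (@lebesgue_measure R).
Local Notation space := (measurableTypeR R * measurableTypeR R * measurableTypeR R)%type.
Local Notation lam3 := (lam3 R).
Local Notation origin := (origin R).
Implicit Types (x y : space) (i j k : 'I_3).

(** The jets of [(1 + m)^2 exp (- m rho)] and [(1 + m)^3 exp (- m rho)]: the powers
    come from [ct], from the factors [1 / t] and [1 / t^2] of the kernel, and from the
    factor of the rescaled solution. *)
Definition jm2 (m rho : R) := jmul (jone_plus m) (jmul (jone_plus m) (jexp m rho)).
Definition jm3 (m rho : R) := jmul (jone_plus m) (jm2 m rho).

(** Jets of [(1 + m)^(-1/2)] times the kernel at time [t / (1 + m)]; see [heat_jet0] and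
    [oseen_jet0]. *)
Definition heat_jet (m t : R) x y (n : nat) : R :=
  ct t * (expR (- (dist2 x y / (4 * t))) *
    jmul (jone_plus m) (jexp m (dist2 x y / (4 * t))) n).

Definition dz i j k x y : R :=
  kron R i j * (pcoord x k - pcoord y k) + kron R i k * (pcoord x j - pcoord y j)
  + kron R j k * (pcoord x i - pcoord y i).

Definition zzz i j k x y : R := (pcoord x i - pcoord y i) *
  (pcoord x j - pcoord y j) * (pcoord x k - pcoord y k).

Definition oseen_jet_inner (m : R) i j k (t : R) x y (s : R) (n : nat) : R :=
  expR (- (pp s * (dist2 x y / (4 * t)))) *
   (dz i j k x y * pp s ^+ 2 / (2 * t) * jm2 m (pp s * (dist2 x y / (4 * t))) n
    - zzz i j k x y * pp s ^+ 3 / (4 * t ^+ 2) * jm3 m (pp s * (dist2 x y / (4 * t))) n).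

Definition oseen_jet (m : R) i j k (t : R) x y (n : nat) : R :=
  ct t * (2^-1 * \int[lam]_s (om s * oseen_jet_inner m i j k t x y s n)
   - kron R i j * ((pcoord x k - pcoord y k) / (2 * t)) * expR (- (dist2 x y / (4 * t))) *
       jm2 m (dist2 x y / (4 * t)) n).

Lemma heat_jetS m m' t x y n : heat_jet m t x y n.+1 = heat_jet m' t x y n.+1.
Proof. by []. Qed.

Lemma oseen_jetS m m' i j k t x y n :
  oseen_jet m i j k t x y n.+1 = oseen_jet m' i j k t x y n.+1.
Proof. by []. Qed.

Lemma heat_jet0 m t x y : 0 < m -> 0 < t ->
  heat_jet m t x y 0 = (Num.sqrt (1 + m))^-1 * heat_kernel (t / (1 + m)) (vec3 x - vec3 y).
Proof.
move=> m0 t0; have m1 : 0 < 1 + m by lra.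
have sm : 0 < Num.sqrt (1 + m) by rewrite sqrtr_gt0.
rewrite heat_kernelE sumsq_vec3B ct_scale// /heat_jet /=.
rewrite (_ : - (dist2 x y / (4 * (t / (1 + m)))) = - (dist2 x y / (4 * t)) + - (m * (dist2 x y / (4 * t)))).
  by rewrite expRD; field; rewrite gt_eqF.
by field; rewrite !gt_eqF.
Qed.

Lemma integrable_oseen_inner t i j k (z : space) : 0 < t ->
  lam.-integrable setT (EFin \o (fun s => om s * oseen_inner t i j k z s)).
Proof.
move=> t0; have r0 : 0 <= dist2 z origin / (4 * t).
  by rewrite divr_ge0 ?dist2_ge0// mulr_ge0// ltW.
have := integrable_om_poly 0 ((kron R i j * pcoord z k + kron R i k * pcoord z j + kron R j k * pcoord z i) / (2 * t))
  (- (pcoord z i * pcoord z j * pcoord z k / (4 * t ^+ 2))) r0.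
apply: eq_integrable => // s _ /=; congr (_%:E); rewrite /oseen_inner; ring.
Qed.

Lemma oseen_jet0 m i j k t x y : 0 < m -> 0 < t ->
  oseen_jet m i j k t x y 0 =
  (Num.sqrt (1 + m))^-1 * oseen (t / (1 + m)) i j k (@reflect_pt R x y).
Proof.
move=> m0 t0; have m1 : 0 < 1 + m by lra.
have sm : 0 < Num.sqrt (1 + m) by rewrite sqrtr_gt0.
have dE : dist2 (@reflect_pt R x y) origin = dist2 x y by rewrite !dist2E /= !subr0.
have E c : expR (- (c * (dist2 x y / (4 * (t / (1 + m)))))) =
    expR (- (c * (dist2 x y / (4 * t)))) * expR (- (m * (c * (dist2 x y / (4 * t))))).
  by rewrite -expRD; congr expR; field; rewrite !gt_eqF.
rewrite /oseen ct_scale// /oseen_jet dE.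
have E1 := E 1; rewrite !mul1r in E1; rewrite E1.
transitivity (ct t * (1 + m) * (2^-1 * \int[lam]_s (om s * oseen_inner (t / (1 + m)) i j k (reflect_pt x y) s)
  - kron R i j * (pcoord (@reflect_pt R x y) k / (2 * (t / (1 + m)))) *
     (expR (- (dist2 x y / (4 * t))) * expR (- (m * (dist2 x y / (4 * t))))))); last first.
  set X := \int[lam]_s _; move: X => X; by field; rewrite !gt_eqF.
have -> : \int[lam]_s (om s * oseen_jet_inner m i j k t x y s 0) =
   (1 + m) * \int[lam]_s (om s * oseen_inner (t / (1 + m)) i j k (reflect_pt x y) s).
  rewrite -RintegralZl//; last first.
    by apply: integrable_oseen_inner; rewrite divr_gt0.
  apply: eq_Rintegral => s _; rewrite /oseen_inner /oseen_jet_inner dE E /= !pcoord_reflect /dz /zzz.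
  by field; rewrite !gt_eqF.
rewrite pcoord_reflect /=; set X := \int[lam]_s _; move: X => X.
by field; rewrite !gt_eqF.
Qed.

Section bounds.
Variables (m : R) (m0 : 0 < m) (mr : m <= 1 / 2) (N : nat).
Local Notation nrm := (jnorm (1 / 2) m N).

Lemma nrm_jm1 rho : 0 <= rho -> nrm (jmul (jone_plus m) (jexp m rho)) <= 3 / 2 * expR (1 / 2 * rho).
Proof.
move=> r0; apply: (le_trans (jnormM m0 mr N _ _)); apply: ler_pM.
- exact: jnorm_ge0.
- exact: jnorm_ge0.
- by apply: (le_trans (jnorm_one_plus m0 mr N)); lra.
- exact: (jnorm_exp m0 mr N).
Qed.

Lemma nrm_jm2 rho : 0 <= rho -> nrm (jm2 m rho) <= 9 / 4 * expR (1 / 2 * rho).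
Proof.
move=> r0; apply: (le_trans (jnormM m0 mr N _ _)).
rewrite (_ : 9 / 4 * _ = 3 / 2 * (3 / 2 * expR (1 / 2 * rho))); last by field.
apply: ler_pM; [exact: jnorm_ge0|exact: jnorm_ge0| |exact: nrm_jm1].
by apply: (le_trans (jnorm_one_plus m0 mr N)); lra.
Qed.

Lemma nrm_jm3 rho : 0 <= rho -> nrm (jm3 m rho) <= 27 / 8 * expR (1 / 2 * rho).
Proof.
move=> r0; apply: (le_trans (jnormM m0 mr N _ _)).
rewrite (_ : 27 / 8 * _ = 3 / 2 * (9 / 4 * expR (1 / 2 * rho))); last by field.
apply: ler_pM; [exact: jnorm_ge0|exact: jnorm_ge0| |exact: nrm_jm2].
by apply: (le_trans (jnorm_one_plus m0 mr N)); lra.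
Qed.

Lemma nrm_heat_jet t x y : 0 < t ->
  nrm (heat_jet m t x y) <= 3 / 2 * ct t * gau3 (1 / 2 / (4 * t)) x y.
Proof.
move=> t0; have c0 := ct_gt0 t0.
have r0 : 0 <= dist2 x y / (4 * t) by rewrite divr_ge0 ?dist2_ge0// mulr_ge0// ltW.
rewrite /heat_jet jnormZ jnormZ !ger0_norm ?expR_ge0 ?(ltW c0)//.
rewrite (_ : 3 / 2 * ct t * _ = ct t * (3 / 2 * gau3 (1 / 2 / (4 * t)) x y)); last by ring.
apply: ler_wpM2l; first exact: ltW.
apply: (le_trans (ler_wpM2l (expR_ge0 _) (nrm_jm1 r0))).
rewrite mulrCA -expRD /gau3; apply: ler_wpM2l => //.
by rewrite ler_expR le_eqVlt; apply/orP; left; apply/eqP; field; rewrite gt_eqF.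
Qed.


(** The scale-invariant quantity below bounds the integrand of the jets of
    the Oseen kernel. *)
Definition oseen_bound_inner (t : R) x y (s : R) : R :=
  Num.sqrt (pp s) ^+ 3 * expR (- (pp s / 4 * (dist2 x y / (4 * t)))).

Lemma kron_le1 i j : `|kron R i j| <= 1.
Proof. by rewrite /kron; case: (_ == _); rewrite ?normr1 ?normr0. Qed.

Lemma pcoord_le t x y i : 0 < t ->
  `|pcoord x i - pcoord y i| <= 2 * Num.sqrt t * Num.sqrt (dist2 x y / (4 * t)).
Proof.
move=> t0; rewrite -sqrtr_sqr.
apply: (@le_trans _ _ (Num.sqrt (dist2 x y))); first by rewrite ler_wsqrtr// coord_dist2.
rewrite -[X in Num.sqrt X <= _](_ : (2 ^+ 2 * t) * (dist2 x y / (4 * t)) = _); last first.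
  by field; rewrite gt_eqF.
rewrite sqrtrM ?mulr_ge0 ?exprn_ge0 ?(ltW t0)// sqrtrM ?exprn_ge0//.
by rewrite sqrtr_sqr ger0_norm.
Qed.

(** With [w = sqrt rho], [p = sqrt (pp s)] and [a = sqrt t], the coordinates of [x - y]
    are at most [2 a w]; the two terms are then [p^3 (p w) / a] and
    [p^3 (p w)^3 / a] times [exp (- (p w)^2 / 2)], and the powers of [p w] are
    absorbed by the exponential.  The constant is [27/4 + 54] rounded up. *)
Lemma nrm_oseen_jet_inner i j k t x y s : 0 < t ->
  nrm (fun n => oseen_jet_inner m i j k t x y s n) <=
  61 / Num.sqrt t * oseen_bound_inner t x y s.
Proof.
move=> t0; set rho := dist2 x y / (4 * t).
have r0 : 0 <= rho by rewrite divr_ge0 ?dist2_ge0// mulr_ge0// ltW.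
set a := Num.sqrt t; have a0 : 0 < a by rewrite sqrtr_gt0.
have tE : t = a ^+ 2 by rewrite sqr_sqrtr// ltW.
set w := Num.sqrt rho; have w0 : 0 <= w by exact: sqrtr_ge0.
have rE : rho = w ^+ 2 by rewrite sqr_sqrtr.
have P0 := pp_ge0 s.
set p := Num.sqrt (pp s); have p0 : 0 <= p by exact: sqrtr_ge0.
have pE : pp s = p ^+ 2 by rewrite sqr_sqrtr.
have z1 l : `|pcoord x l - pcoord y l| <= 2 * a * w by exact: pcoord_le.
have aw0 : 0 <= 2 * a * w by rewrite !mulr_ge0// ltW.
have B1 : `|dz i j k x y| <= 3 * (2 * a * w).
  have K a' b' l : `|kron R a' b' * (pcoord x l - pcoord y l)| <= 2 * a * w.
    by rewrite normrM -[leRHS]mul1r; apply: ler_pM => //; exact: kron_le1.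
  rewrite (_ : 3 * (2 * a * w) = 2 * a * w + 2 * a * w + 2 * a * w); last by ring.
  apply: (le_trans (ler_normD _ _)); apply: lerD => //.
  by apply: (le_trans (ler_normD _ _)); apply: lerD.
have B2 : `|zzz i j k x y| <= (2 * a * w) ^+ 3.
  by rewrite !normrM exprS expr2 mulrA; apply: ler_pM => //; apply: ler_pM.
have pr0 : 0 <= pp s * rho by rewrite mulr_ge0.
rewrite /oseen_jet_inner -/rho jnormZ ger0_norm ?expR_ge0//.
have E (e : R) : e = p * w -> expR (- (pp s * rho)) * expR (1 / 2 * (pp s * rho)) * expR (e ^+ 2 / 4) =
     expR (- (pp s / 4 * rho)).
  move=> ->; rewrite -!expRD; congr expR; rewrite rE pE; by field.
have X1 : nrm (fun n => dz i j k x y * pp s ^+ 2 / (2 * t) * jm2 m (pp s * rho) n) <=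
    27 / 4 * p ^+ 3 / a * (expR (1 / 2 * (pp s * rho)) * expR ((p * w) ^+ 2 / 4)).
  rewrite jnormZ.
  apply: (@le_trans _ _ ((3 * p ^+ 3 / a * (p * w)) * (9 / 4 * expR (1 / 2 * (pp s * rho))))).
    apply: ler_pM => //; [exact: jnorm_ge0| |exact: nrm_jm2].
    rewrite (_ : 3 * p ^+ 3 / a * (p * w) = 3 * (2 * a * w) * (pp s ^+ 2 / (2 * t))); last first.
      by rewrite tE pE; field; rewrite gt_eqF.
    rewrite -mulrA normrM [X in _ * X]ger0_norm; last first.
      by rewrite divr_ge0 ?exprn_ge0// mulr_ge0// ltW.
    by apply: ler_wpM2r => //; rewrite divr_ge0 ?exprn_ge0// mulr_ge0// ltW.
  have h := le_expR_sqr4 (p * w).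
  have c0 : 0 <= 27 / 4 * p ^+ 3 / a * expR (1 / 2 * (pp s * rho)).
    by rewrite !mulr_ge0 ?exprn_ge0 ?expR_ge0// invr_ge0 ltW.
  have := ler_wpM2l c0 h.
  rewrite (_ : 27 / 4 * p ^+ 3 / a * expR (1 / 2 * (pp s * rho)) * (p * w) =
     3 * p ^+ 3 / a * (p * w) * (9 / 4 * expR (1 / 2 * (pp s * rho)))); last first.
    by field; rewrite gt_eqF.
  move=> /le_trans; apply; rewrite le_eqVlt; apply/orP; left; apply/eqP.
  by field; rewrite gt_eqF.
have X2 : nrm (fun n => zzz i j k x y * pp s ^+ 3 / (4 * t ^+ 2) * jm3 m (pp s * rho) n) <=
    54 * p ^+ 3 / a * (expR (1 / 2 * (pp s * rho)) * expR ((p * w) ^+ 2 / 4)).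
  rewrite jnormZ.
  apply: (@le_trans _ _ ((2 * p ^+ 3 / a * (p * w) ^+ 3) * (27 / 8 * expR (1 / 2 * (pp s * rho))))).
    apply: ler_pM => //; [exact: jnorm_ge0| |exact: nrm_jm3].
    rewrite (_ : 2 * p ^+ 3 / a * _ = (2 * a * w) ^+ 3 * (pp s ^+ 3 / (4 * t ^+ 2))); last first.
      by rewrite tE pE; field; rewrite gt_eqF.
    rewrite -mulrA normrM [X in _ * X]ger0_norm; last first.
      by rewrite divr_ge0 ?exprn_ge0// mulr_ge0 ?exprn_ge0// ltW.
    by apply: ler_wpM2r => //; rewrite divr_ge0 ?exprn_ge0// mulr_ge0 ?exprn_ge0// ltW.
  have h : (p * w) ^+ 3 <= 8 * expR ((p * w) ^+ 2 / 4).
    have h0 := le_expR_sqr12 (p * w); have pw0 : 0 <= p * w by rewrite mulr_ge0.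
    have -> : expR ((p * w) ^+ 2 / 4) = expR ((p * w) ^+ 2 / 12) ^+ 3.
      by rewrite -expRM_natl; congr expR; field.
    rewrite (_ : 8 = 2 ^+ 3); last by ring.
    rewrite -exprMn; apply: lerXn2r => //.
    by rewrite nnegrE mulr_ge0// expR_ge0.
  have c0 : 0 <= 27 / 4 * p ^+ 3 / a * expR (1 / 2 * (pp s * rho)).
    by rewrite !mulr_ge0 ?exprn_ge0 ?expR_ge0// invr_ge0 ltW.
  have := ler_wpM2l c0 h.
  rewrite (_ : 27 / 4 * p ^+ 3 / a * expR (1 / 2 * (pp s * rho)) * (p * w) ^+ 3 =
     2 * p ^+ 3 / a * (p * w) ^+ 3 * (27 / 8 * expR (1 / 2 * (pp s * rho)))); last first.
    by field; rewrite gt_eqF.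
  move=> /le_trans; apply; rewrite le_eqVlt; apply/orP; left; apply/eqP.
  by field; rewrite gt_eqF.
have X3 := le_trans (jnormB m0 mr N _ _) (lerD X1 X2).
apply: (le_trans (ler_wpM2l (expR_ge0 _) X3)).
rewrite -mulrDl mulrCA [expR _ * (_ * _)]mulrA (E (p * w))// /oseen_bound_inner -/p -/rho [leRHS]mulrA.
apply: ler_wpM2r; first exact: expR_ge0.
rewrite -subr_ge0 (_ : _ - _ = 1 / 4 * p ^+ 3 / a); last by field; rewrite gt_eqF.
by rewrite !mulr_ge0 ?exprn_ge0// invr_ge0 ltW.
Qed.

End bounds.
End jets.

Section jet_measurability.
Context (R : realType).
Local Notation lam := (@lebesgue_measure R).
Local Notation space := (measurableTypeR R * measurableTypeR R * measurableTypeR R)%type.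
Context d (T : measurableType d) (tq sq : T -> R) (xq yq : T -> space).
Hypotheses (mt : measurable_fun setT tq) (ms : measurable_fun setT sq)
  (mx : measurable_fun setT xq) (my : measurable_fun setT yq).
Local Notation inv := (@GRing.inv R).

Lemma measurable_invf (f : T -> R) : measurable_fun setT f ->
  measurable_fun setT (fun w => (f w)^-1).
Proof. exact: (measurableT_comp (@measurable_invR R)). Qed.

Lemma measurable_expNf (f : T -> R) : measurable_fun setT f ->
  measurable_fun setT (fun w => expR (- f w)).
Proof. by move=> mf; apply: measurableT_comp => //; exact: measurableT_comp. Qed.

Lemma measurable_coordB i : measurable_fun setT (fun w => pcoord (xq w) i - pcoord (yq w) i).
Proof.
apply: measurable_funB.
- exact: (measurableT_comp (@measurable_coord R i) mx).
- exact: (measurableT_comp (@measurable_coord R i) my).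
Qed.

Lemma measurable_rho : measurable_fun setT (fun w => dist2 (xq w) (yq w) / (4 * tq w)).
Proof.
apply: measurable_funM; last by apply: measurable_invf; exact: measurable_funM.
exact: (measurableT_comp (@measurable_dist2 R) (measurable_fun_pair mx my)).
Qed.

Lemma measurable_ct : measurable_fun setT (fun w => ct (tq w)).
Proof.
apply: (measurableT_comp (measurable_powR _)); exact: measurable_funM.
Qed.

Lemma measurable_jexp m n (f : T -> R) : measurable_fun setT f ->
  measurable_fun setT (fun w => jexp m (f w) n).
Proof.
move=> mf; case: n => [|n] /=.
  by apply: measurable_expNf; exact: measurable_funM.
by apply: measurable_funM => //; apply: measurable_funX; exact: measurableT_comp.
Qed.

Lemma measurable_jm1 m n (f : T -> R) : measurable_fun setT f ->
  measurable_fun setT (fun w => jmul (jone_plus m) (jexp m (f w)) n).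
Proof.
by move=> mf; apply: measurable_jmul => {}n //; exact: measurable_jexp.
Qed.

Lemma measurable_jm2 m n (f : T -> R) : measurable_fun setT f ->
  measurable_fun setT (fun w => jm2 m (f w) n).
Proof.
by move=> mf; apply: measurable_jmul => {}n //; exact: measurable_jm1.
Qed.

Lemma measurable_jm3 m n (f : T -> R) : measurable_fun setT f ->
  measurable_fun setT (fun w => jm3 m (f w) n).
Proof.
by move=> mf; apply: measurable_jmul => {}n //; exact: measurable_jm2.
Qed.

Lemma measurable_heat_jet m n : measurable_fun setT (fun w => heat_jet m (tq w) (xq w) (yq w) n).
Proof.
apply: measurable_funM; first exact: measurable_ct.
apply: measurable_funM; first by apply: measurable_expNf; exact: measurable_rho.
by apply: measurable_jm1; exact: measurable_rho.
Qed.

Let mpp : measurable_fun setT (fun w => pp (sq w)).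
Proof. exact: (measurableT_comp (@measurable_pp R) ms). Qed.

Let mpr : measurable_fun setT (fun w => pp (sq w) * (dist2 (xq w) (yq w) / (4 * tq w))).
Proof. by apply: measurable_funM => //; exact: measurable_rho. Qed.

Lemma measurable_oseen_jet_inner m i j k n :
  measurable_fun setT (fun w => oseen_jet_inner m i j k (tq w) (xq w) (yq w) (sq w) n).
Proof.
apply: measurable_funM; first by apply: measurable_expNf; exact: mpr.
apply: measurable_funB; apply: measurable_funM.
- apply: measurable_funM; last by apply: measurable_invf; exact: measurable_funM.
  apply: measurable_funM; last exact: measurable_funX.
  by apply: measurable_funD; first apply: measurable_funD; apply: measurable_funM => //;
    exact: measurable_coordB.
- by apply: measurable_jm2; exact: mpr.
- apply: measurable_funM; last first.
    by apply: measurable_invf; apply: measurable_funM => //; exact: measurable_funX.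
  apply: measurable_funM; last exact: measurable_funX.
  apply: measurable_funM; last exact: measurable_coordB.
  by apply: measurable_funM; exact: measurable_coordB.
- by apply: measurable_jm3; exact: mpr.
Qed.

Lemma measurable_oseen_bound_inner :
  measurable_fun setT (fun w => oseen_bound_inner (tq w) (xq w) (yq w) (sq w)).
Proof.
apply: measurable_funM.
  by apply: measurable_funX; exact: (measurableT_comp (@measurable_sqrtR R) mpp).
apply: measurable_expNf; apply: measurable_funM; last exact: measurable_rho.
exact: measurable_funM.
Qed.

End jet_measurability.

Section jet_bounds.
Context (R : realType).
Local Notation lam := (@lebesgue_measure R).
Local Notation space := (measurableTypeR R * measurableTypeR R * measurableTypeR R)%type.
Local Notation lam3 := (lam3 R).
Local Notation origin := (origin R).
Implicit Types (x y : space) (i j k : 'I_3).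

Lemma measurable_oseen_jet d (T : measurableType d) (tq : T -> R) (xq yq : T -> space) m i j k n :
  measurable_fun setT tq -> measurable_fun setT xq -> measurable_fun setT yq ->
  measurable_fun setT (fun w => oseen_jet m i j k (tq w) (xq w) (yq w) n).
Proof.
move=> mt mx my; apply: measurable_funM; first exact: measurable_ct.
apply: measurable_funB.
  apply: measurable_funM => //.
  apply: (@measurable_Rintegral1 _ _ _ _ _ lam (fun z => om z.2 * oseen_jet_inner m i j k (tq z.1) (xq z.1) (yq z.1) z.2 n)).
  apply: measurable_funM.
    exact: (measurableT_comp (@measurable_om R) measurable_snd).
  apply: measurable_oseen_jet_inner.
  - exact: (measurableT_comp mt measurable_fst).
  - exact: measurable_snd.
  - exact: (measurableT_comp mx measurable_fst).
  - exact: (measurableT_comp my measurable_fst).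
apply: measurable_funM; last by apply: measurable_jm2; exact: measurable_rho.
apply: measurable_funM; last by apply: measurable_expNf; exact: measurable_rho.
apply: measurable_funM => //.
apply: measurable_funM; first exact: measurable_coordB.
by apply: measurable_invf; exact: measurable_funM.
Qed.

(** Dominates the jets of the Oseen kernel, uniformly in [m] and in the truncation
    order. *)
Definition oseen_bound (t : R) x y : R := ct t / Num.sqrt t *
  (9 / 4 * expR (- (1 / 4 * (dist2 x y / (4 * t)))) +
   31 * \int[lam]_s (om s * oseen_bound_inner t x y s)).

Lemma measurable_oseen_bound d (T : measurableType d) (tq : T -> R) (xq yq : T -> space) :
  measurable_fun setT tq -> measurable_fun setT xq -> measurable_fun setT yq ->
  measurable_fun setT (fun w => oseen_bound (tq w) (xq w) (yq w)).
Proof.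
move=> mt mx my; apply: measurable_funM.
  apply: measurable_funM; first exact: measurable_ct.
  by apply: measurable_invf; exact: (measurableT_comp (@measurable_sqrtR R) mt).
apply: measurable_funD; apply: measurable_funM => //.
  by apply: measurable_expNf; apply: measurable_funM => //; exact: measurable_rho.
apply: (@measurable_Rintegral1 _ _ _ _ _ lam (fun z => om z.2 * oseen_bound_inner (tq z.1) (xq z.1) (yq z.1) z.2)).
apply: measurable_funM.
  exact: (measurableT_comp (@measurable_om R) measurable_snd).
apply: measurable_oseen_bound_inner.
- exact: (measurableT_comp mt measurable_fst).
- exact: measurable_snd.
- exact: (measurableT_comp mx measurable_fst).
- exact: (measurableT_comp my measurable_fst).
Qed.

Lemma obi_ge0 t x y s : 0 <= oseen_bound_inner t x y s.
Proof. by rewrite mulr_ge0 ?expR_ge0// exprn_ge0// sqrtr_ge0. Qed.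

Lemma obi_le1 t x y s : 0 < t -> oseen_bound_inner t x y s <= 1.
Proof.
move=> t0; rewrite -[leRHS]mul1r; apply: ler_pM; rewrite ?expR_ge0 ?exprn_ge0 ?sqrtr_ge0//.
  by rewrite exprn_ile1 ?sqrtr_ge0// -sqrtr1 ler_wsqrtr// pp_le1.
rewrite -[leRHS]expR0 ler_expR oppr_le0; apply: mulr_ge0.
  by apply: divr_ge0 => //; exact: pp_ge0.
by apply: divr_ge0; [exact: dist2_ge0|rewrite mulr_ge0// ltW].
Qed.

Lemma measurable_obi t x y : measurable_fun setT (oseen_bound_inner t x y).
Proof. exact: (@measurable_oseen_bound_inner R _ _ (fun=> t) id (fun=> x) (fun=> y)). Qed.

Lemma integrable_obi t x y : 0 < t ->
  lam.-integrable setT (EFin \o (fun s => om s * oseen_bound_inner t x y s)).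
Proof.
move=> t0; apply: (@integrable_omM _ _ 1); first exact: measurable_obi.
by move=> s; rewrite ger0_norm ?obi_ge0// obi_le1.
Qed.

Lemma nrm_oseen_jet m N i j k t x y : 0 < m -> m <= 1 / 2 -> 0 < t ->
  jnorm (1 / 2) m N (oseen_jet m i j k t x y) <= oseen_bound t x y.
Proof.
move=> m0 mr t0; have c0 := ct_gt0 t0.
set rho := dist2 x y / (4 * t).
have r0 : 0 <= rho by rewrite divr_ge0 ?dist2_ge0// mulr_ge0// ltW.
set a := Num.sqrt t; have a0 : 0 < a by rewrite sqrtr_gt0.
have tE : t = a ^+ 2 by rewrite sqr_sqrtr// ltW.
set w := Num.sqrt rho; have w0 : 0 <= w by exact: sqrtr_ge0.
have rE : rho = w ^+ 2 by rewrite sqr_sqrtr.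
rewrite /oseen_jet jnormZ ger0_norm ?(ltW c0)// /oseen_bound -/a -/rho -[leRHS]mulrA.
apply: ler_wpM2l; first exact: ltW.
apply: (le_trans (jnormB m0 mr N _ _)); rewrite addrC mulrDr; apply: lerD.
  rewrite jnormZ normrM (ger0_norm (expR_ge0 _)).
  have h1 : `|kron R i j * ((pcoord x k - pcoord y k) / (2 * t))| <= a^-1 * w.
    rewrite normrM -[leRHS]mul1r; apply: ler_pM => //; first exact: kron_le1.
    rewrite normrM [X in _ * X]ger0_norm ?invr_ge0 ?mulr_ge0 ?(ltW t0)//.
    rewrite ler_pdivrMr ?mulr_gt0// (_ : a^-1 * w * _ = 2 * a * w); first exact: pcoord_le.
    by rewrite tE; field; rewrite gt_eqF.
  have h2 := nrm_jm2 m0 mr N r0.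
  apply: (@le_trans _ _ (a^-1 * w * expR (- rho) * (9 / 4 * expR (1 / 2 * rho)))).
    apply: ler_pM; [by rewrite mulr_ge0// expR_ge0|exact: jnorm_ge0| |exact: h2].
    by apply: ler_wpM2r => //; exact: expR_ge0.
  have h3 := le_expR_sqr4 w.
  rewrite (_ : expR (- (1 / 4 * rho)) = expR (w ^+ 2 / 4) * (expR (- rho) * expR (1 / 2 * rho))); last first.
    by rewrite -!expRD; congr expR; rewrite rE; field.
  rewrite (_ : a^-1 * w * _ * _ = a^-1 * (9 / 4) * (expR (- rho) * expR (1 / 2 * rho)) * w); last by ring.
  rewrite (_ : a^-1 * (9 / 4 * _) = a^-1 * (9 / 4) * (expR (- rho) * expR (1 / 2 * rho)) * expR (w ^+ 2 / 4)); last by ring.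
  by apply: ler_wpM2l => //; rewrite !mulr_ge0 ?expR_ge0// invr_ge0 ltW.
rewrite jnormZ ger0_norm//.
pose f s n := om s * oseen_jet_inner m i j k t x y s n.
have mf n : measurable_fun setT (f ^~ n).
  apply: measurable_funM; first exact: measurable_om.
  exact: (@measurable_oseen_jet_inner R _ _ (fun=> t) id (fun=> x) (fun=> y)).
have If := integrable_obi x y t0.
have If2 := integrableRZ (61 / a) If.
have fC : (\int[lam]_s (jnorm (1 / 2) m N (f s))%:E <=
    (61 / a * \int[lam]_s (om s * oseen_bound_inner t x y s))%:E)%E.
  rewrite -RintegralZl// /Rintegral fineK; last exact: integrable_fin_num.
  apply: ge0_le_integral => //.
  - by move=> s _; rewrite lee_fin jnorm_ge0.
  - apply/measurable_EFinP; exact: (measurable_jnorm).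
  - exact: measurable_int If2.
  - move=> s _; rewrite lee_fin /f jnormZ (ger0_norm (om_ge0 s)) mulrCA.
    by apply: ler_wpM2l; [exact: om_ge0|exact: nrm_oseen_jet_inner].
have [_ H] := @jnorm_integral _ _ R lam (1 / 2) m N f _ m0 mr mf fC.
apply: (le_trans (ler_wpM2l _ H)) => //.
have I0 : 0 <= \int[lam]_s (om s * oseen_bound_inner t x y s).
  by apply: Rintegral_ge0 => s _; rewrite mulr_ge0 ?om_ge0 ?obi_ge0.
rewrite mulrA [leRHS]mulrA; apply: ler_wpM2r => //.
rewrite -subr_ge0 (_ : _ - _ = 1 / 2 / a); last by field; rewrite gt_eqF.
by rewrite divr_ge0// ltW.
Qed.

(** [9/4 * 8] from the Gaussian term and [31 * 8 * pi] from the superposition,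
    where [8 = (1/4)^(-3/2)] and [pi] bounds the integral of [om]. *)
Definition kernel_const : R := 18 + 248 * pi.

Lemma kernel_const_ge : 18 <= kernel_const.
Proof. by rewrite lerDl mulr_ge0// ltW// pi_gt0. Qed.

Lemma integral_heat_jet m N t x : 0 < m -> m <= 1 / 2 -> 0 < t ->
  (\int[lam3]_y (jnorm (1 / 2) m N (heat_jet m t x y))%:E <= kernel_const%:E)%E.
Proof.
move=> m0 mr t0; have c0 := ct_gt0 t0.
have b0 : 0 < 1 / 2 / (4 * t) by rewrite divr_gt0// mulr_gt0.
apply: (@le_trans _ _ (\int[lam3]_y ((3 / 2 * ct t)%:E * (gau3 (1 / 2 / (4 * t)) x y)%:E))%E).
  apply: ge0_le_integral => //.
  - by move=> y _; rewrite lee_fin jnorm_ge0.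
  - apply/measurable_EFinP; apply: measurable_jnorm => n.
    exact: (@measurable_heat_jet R _ _ (fun=> t) (fun=> x) id).
  - apply: emeasurable_funM => //; apply/measurable_EFinP; exact: measurable_gau3r.
  - by move=> y _; rewrite lee_fin nrm_heat_jet.
rewrite ge0_integralZl//; last 3 first.
- by apply/measurable_EFinP; exact: measurable_gau3r.
- by move=> y _; rewrite lee_fin gau3_ge0.
- by rewrite lee_fin mulr_ge0// ltW.
have k0 : 0 < 1 / 2 :> R by [].
rewrite integral_gau3// -EFinM lee_fin -[leLHS]mulrA (ct_gauss t0 k0).
apply: le_trans kernel_const_ge.
have s2 : 1 / 2 <= Num.sqrt (1 / 2) :> R.
  by rewrite -[leLHS]ger0_norm// -sqrtr_sqr ler_wsqrtr// expr2; lra.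
apply: (@le_trans _ _ (3 / 2 * (1 / 2) ^- 3)); last by rewrite -exprVn invf_div; lra.
rewrite ler_pM2l// lef_pV2 ?posrE ?exprn_gt0 ?sqrtr_gt0//.
by apply: lerXn2r; rewrite ?nnegrE ?sqrtr_ge0.
Qed.

(** For fixed [s] the factor [sqrt (pp s) ^ 3] cancels the mass of the widened
    Gaussian, so Tonelli leaves the integral of [om]. *)
Lemma integral_oseen_bound t x : 0 < t ->
  (\int[lam3]_y (oseen_bound t x y)%:E <= (kernel_const / Num.sqrt t)%:E)%E.
Proof.
move=> t0; have c0 := ct_gt0 t0.
have a0 : 0 < Num.sqrt t by rewrite sqrtr_gt0.
have s4 : Num.sqrt (1 / 4) = 1 / 2 :> R.
  by rewrite (_ : 1 / 4 = (1 / 2) ^+ 2) ?sqrtr_sqr ?ger0_norm//; field.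
have E1 (s : R) : (\int[lam3]_y (oseen_bound_inner t x y s)%:E <= (8 / ct t)%:E)%E.
  have p0 := pp_ge0 s; rewrite /oseen_bound_inner.
  move: p0; rewrite le_eqVlt => /predU1P[<-|p0].
    under eq_integral do rewrite sqrtr0 expr0n /= mul0r.
    by rewrite integral0 lee_fin divr_ge0// ltW.
  have b0 : 0 < pp s / 4 / (4 * t) by apply: divr_gt0; [exact: divr_gt0|exact: mulr_gt0].
  have k0 : 0 < pp s / 4 by rewrite divr_gt0.
  rewrite (eq_integral (fun y => ((Num.sqrt (pp s) ^+ 3)%:E * (gau3 (pp s / 4 / (4 * t)) x y)%:E)%E)); last first.
    by move=> y _; rewrite -EFinM /gau3; congr ((_ * expR (- _))%:E); ring.
  rewrite ge0_integralZl//; last 2 first.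
  - by apply/measurable_EFinP; exact: measurable_gau3r.
  - by move=> y _; rewrite lee_fin gau3_ge0.
  rewrite integral_gau3// -EFinM lee_fin ler_pdivlMr// mulrC mulrCA (ct_gauss t0 k0).
  rewrite (_ : pp s / 4 = pp s * (1 / 4)); last by rewrite mul1r.
  rewrite (sqrtrM (1 / 4) (pp_ge0 s)) s4.
  have sp : 0 < Num.sqrt (pp s) by rewrite sqrtr_gt0.
  by rewrite le_eqVlt; apply/orP; left; apply/eqP; field; rewrite gt_eqF.
have E2 : (\int[lam3]_y (\int[lam]_s (om s * oseen_bound_inner t x y s))%:E <= (8 / ct t * pi)%:E)%E.
  rewrite (eq_integral (fun y => \int[lam]_s (om s * oseen_bound_inner t x y s)%:E)%E); last first.
    move=> y _; rewrite /Rintegral fineK//; apply: integrable_fin_num => //.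
    exact: integrable_obi.
  have mj : measurable_fun setT (fun z : space * measurableTypeR R => om z.2 * oseen_bound_inner t x z.1 z.2).
    apply: measurable_funM; first exact: (measurableT_comp (@measurable_om R) measurable_snd).
    exact: (@measurable_oseen_bound_inner R _ _ (fun=> t) snd (fun=> x) fst).
  rewrite -(fubini_tonelli1 (fun z : space * measurableTypeR R => (om z.2 * oseen_bound_inner t x z.1 z.2)%:E)); last 2 first.
  - exact/measurable_EFinP.
  - by move=> z; rewrite lee_fin mulr_ge0 ?om_ge0 ?obi_ge0.
  apply: (@prodm_integral_le _ _ _ _ R lam3 lam _ _ (fun s => 8 / ct t * om s)) => //.
  - by move=> z; rewrite mulr_ge0 ?om_ge0 ?obi_ge0.
  - by apply: measurable_funM => //; exact: measurable_om.
  - move=> s; rewrite (eq_integral (fun y => ((om s)%:E * (oseen_bound_inner t x y s)%:E)%E)); last first.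
      by move=> y _; rewrite -EFinM.
    rewrite ge0_integralZl//; last 3 first.
    + apply/measurable_EFinP.
      exact: (@measurable_oseen_bound_inner R _ _ (fun=> t) (fun=> s) (fun=> x) id).
    + by move=> y _; rewrite lee_fin obi_ge0.
    + by rewrite lee_fin om_ge0.
    rewrite mulrC EFinM; apply: lee_wpmul2l; last exact: E1.
    by rewrite lee_fin om_ge0.
  - under eq_integral do rewrite EFinM.
    rewrite ge0_integralZl//; last 3 first.
    + by apply/measurable_EFinP; exact: measurable_om.
    + by move=> s _; rewrite lee_fin om_ge0.
    + by rewrite lee_fin divr_ge0// ltW.
    rewrite [leRHS]EFinM; apply: lee_wpmul2l; first by rewrite lee_fin divr_ge0// ltW.
    rewrite -integral_oneDV; apply: ge0_le_integral => //.
    + by move=> s _; rewrite lee_fin om_ge0.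
    + by apply/measurable_EFinP; exact: measurable_om.
    + by apply/measurable_EFinP; apply: measurable_invf; exact: measurable_oneD.
    + by move=> s _; rewrite lee_fin om_le.
have b0 : 0 < 1 / 4 / (4 * t) by rewrite divr_gt0// mulr_gt0.
have k0 : 0 < 1 / 4 :> R by [].
have I0 y : 0 <= \int[lam]_s (om s * oseen_bound_inner t x y s).
  by apply: Rintegral_ge0 => s _; rewrite mulr_ge0 ?om_ge0 ?obi_ge0.
have mI : measurable_fun setT (fun y => \int[lam]_s (om s * oseen_bound_inner t x y s)).
  apply: (@measurable_Rintegral1 _ _ _ _ _ lam (fun z : space * measurableTypeR R => om z.2 * oseen_bound_inner t x z.1 z.2)).
  apply: measurable_funM; first exact: (measurableT_comp (@measurable_om R) measurable_snd).
  exact: (@measurable_oseen_bound_inner R _ _ (fun=> t) snd (fun=> x) fst).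
rewrite (eq_integral (fun y => ((ct t / Num.sqrt t * (9 / 4))%:E * (gau3 (1 / 4 / (4 * t)) x y)%:E +
   (ct t / Num.sqrt t * 31)%:E * (\int[lam]_s (om s * oseen_bound_inner t x y s))%:E)%E)); last first.
  move=> y _; rewrite -!EFinM -EFinD /oseen_bound /gau3 mulrDr !mulrA; congr (_%:E).
  by congr (_ * expR (- _) + _); ring.
have ca : 0 <= ct t / Num.sqrt t by rewrite divr_ge0 ?ltW.
rewrite ge0_integralD//; last 4 first.
- by move=> y _; rewrite -EFinM lee_fin mulr_ge0 ?gau3_ge0// mulr_ge0.
- by apply: emeasurable_funM => //; apply/measurable_EFinP; exact: measurable_gau3r.
- by move=> y _; rewrite -EFinM lee_fin mulr_ge0// mulr_ge0.
- by apply: emeasurable_funM => //; exact/measurable_EFinP.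
rewrite !ge0_integralZl//; last 6 first.
- exact/measurable_EFinP.
- by move=> y _; rewrite lee_fin.
- by rewrite lee_fin mulr_ge0.
- by apply/measurable_EFinP; exact: measurable_gau3r.
- by move=> y _; rewrite lee_fin gau3_ge0.
- by rewrite lee_fin mulr_ge0.
rewrite integral_gau3//.
have -> : (kernel_const / Num.sqrt t)%:E = (((ct t / Num.sqrt t * (9 / 4))%:E * ((Num.sqrt pi / Num.sqrt (1 / 4 / (4 * t))) ^+ 3)%:E) +
   (ct t / Num.sqrt t * 31)%:E * (8 / ct t * pi)%:E)%E.
  rewrite -!EFinM -EFinD; congr (_%:E).
  have := ct_gauss t0 k0; rewrite s4; set X := _ ^+ 3 => H.
  rewrite (_ : ct t / Num.sqrt t * (9 / 4) * X = (9 / 4) / Num.sqrt t * (ct t * X)); last by ring.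
  rewrite H /kernel_const; by field; rewrite !gt_eqF.
by apply: leeD => //; apply: lee_wpmul2l => //; rewrite lee_fin mulr_ge0.
Qed.

End jet_bounds.

(** * The heat semigroup determines bounded functions *)

Section approximate_identity.
Context (R : realType).
Local Notation lam := (@lebesgue_measure R).
Local Notation space := (measurableTypeR R * measurableTypeR R * measurableTypeR R)%type.
Local Notation lam3 := (lam3 R).
Local Notation origin := (origin R).
Implicit Types (x y : space).

(** The heat kernel as a function of pairs of points. *)
Definition hk (e : R) x y : R := ct e * gau3 (4 * e)^-1 x y.

Lemma heat_kernel_hk e x y : heat_kernel e (vec3 x - vec3 y) = hk e x y.
Proof.
rewrite heat_kernelE sumsq_vec3B /hk /gau3; congr (_ * expR (- _)); exact: mulrC.
Qed.

Lemma hkC e x y : hk e x y = hk e y x.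
Proof. by rewrite /hk /gau3 !dist2E; congr (_ * expR _); ring. Qed.

Lemma measurable_hk e : measurable_fun setT (fun q : space * space => hk e q.1 q.2).
Proof. by apply: measurable_funM => //; exact: measurable_gau3. Qed.

Lemma measurable_hkr e x : measurable_fun setT (hk e x).
Proof. by apply: measurable_funM => //; exact: measurable_gau3r. Qed.

Variables (e : R) (e0 : 0 < e).

Lemma hk_ge0 x y : 0 <= hk e x y.
Proof. by rewrite mulr_ge0 ?gau3_ge0// ltW// ct_gt0. Qed.

Lemma ct_gau3 k x : 0 < k -> (\int[lam3]_y (ct e * gau3 (k / (4 * e)) x y)%:E = ((Num.sqrt k) ^- 3)%:E)%E.
Proof.
move=> k0; under eq_integral do rewrite EFinM.
rewrite ge0_integralZl//; last 3 first.
- by apply/measurable_EFinP; exact: measurable_gau3r.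
- by move=> y _; rewrite lee_fin gau3_ge0.
- by rewrite lee_fin ltW// ct_gt0.
rewrite integral_gau3; last by rewrite divr_gt0// mulr_gt0.
by rewrite -EFinM ct_gauss.
Qed.

Lemma integral_hk x : (\int[lam3]_y (hk e x y)%:E = 1)%E.
Proof.
transitivity (\int[lam3]_y (ct e * gau3 (1 / (4 * e)) x y)%:E)%E.
  by apply: eq_integral => y _; rewrite /hk div1r.
by rewrite ct_gau3// sqrtr1 expr1n invr1.
Qed.

Lemma integrable_hkM x (f : space -> R) (C : R) : measurable_fun setT f -> (forall y, `|f y| <= C) ->
  lam3.-integrable setT (EFin \o (fun y => hk e x y * f y)).
Proof.
move=> mf fC; have C0 : 0 <= C by apply: le_trans (fC origin).
apply: (@integrable_le _ _ _ lam3 _ (fun y => C * hk e x y) C).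
- by apply: measurable_funM => //; exact: measurable_hkr.
- by apply: measurable_funM => //; exact: measurable_hkr.
- by move=> y; rewrite normrM mulrC (ger0_norm (hk_ge0 _ _)) ler_wpM2r// hk_ge0.
- under eq_integral do rewrite EFinM.
  rewrite ge0_integralZl//; last 2 first.
  + by apply/measurable_EFinP; exact: measurable_hkr.
  + by move=> y _; rewrite lee_fin hk_ge0.
  by rewrite integral_hk mule1.
Qed.

Let le1 (y : space) : `|1 : R| <= 1. Proof. by rewrite normr1. Qed.

Variables (A : set space) (mA : measurable A).
Local Notation one := (\1_A : space -> R).

Let one01 x : 0 <= one x <= 1.
Proof. by rewrite indicE; case: (_ \in _); rewrite ?ler01 ?lexx. Qed.

Let mone : measurable_fun setT one.
Proof. exact: measurable_indic. Qed.

Definition smooth_indic x : R := \int[lam3]_y (hk e x y * one y).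

Let Ione x : lam3.-integrable setT (EFin \o (fun y => hk e x y * one y)).
Proof.
apply: (@integrable_hkM _ _ 1) => // y; have /andP[h1 h2] := one01 y.
by rewrite ger0_norm.
Qed.

Lemma smooth_indic_le1 x : 0 <= smooth_indic x <= 1.
Proof.
have I1 := @integrable_hkM x (fun=> 1) 1 (measurable_cst _) le1.
apply/andP; split.
  by apply: Rintegral_ge0 => y _; rewrite mulr_ge0 ?hk_ge0//; case/andP: (one01 y).
have -> : 1 = \int[lam3]_y (hk e x y * 1).
  by under eq_Rintegral do rewrite mulr1; rewrite /Rintegral integral_hk.
apply: le_Rintegral => // y _.
by apply: ler_wpM2l; [exact: hk_ge0|case/andP: (one01 y)].
Qed.

(** Chebyshev: little heat leaves a set that contains a ball. *)
Lemma smooth_indic_near x (r : R) : 0 < r -> (forall y, ~ A y -> r ^+ 2 <= dist2 x y) ->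
  1 - smooth_indic x <= 64 * e / r ^+ 2.
Proof.
move=> r0 Ar.
have I1 := @integrable_hkM x (fun=> 1) 1 (measurable_cst _) le1.
have -> : 1 - smooth_indic x = \int[lam3]_y (hk e x y * 1 - hk e x y * one y).
  rewrite RintegralB//; congr (_ - _).
  by under eq_Rintegral do rewrite mulr1; rewrite /Rintegral integral_hk.
have re : 0 <= 8 * e / r ^+ 2 by rewrite divr_ge0 ?exprn_ge0 ?mulr_ge0// ltW.
have k0 : 0 < 1 / 2 :> R by [].
have Ig : lam3.-integrable setT (EFin \o (fun y => ct e * gau3 (1 / 2 / (4 * e)) x y)).
  apply: (@integrable_le _ _ _ lam3 _ (fun y => ct e * gau3 (1 / 2 / (4 * e)) x y) ((Num.sqrt (1 / 2)) ^- 3)).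
  - by apply: measurable_funM => //; exact: measurable_gau3r.
  - by apply: measurable_funM => //; exact: measurable_gau3r.
  - by move=> y; rewrite ger0_norm// mulr_ge0 ?gau3_ge0// ltW// ct_gt0.
  - by rewrite ct_gau3.
apply: (@le_trans _ _ (\int[lam3]_y (8 * e / r ^+ 2 * (ct e * gau3 (1 / 2 / (4 * e)) x y)))).
  apply: le_Rintegral => //.
  - exact: integrableRB.
  - exact: integrableRZ.
  move=> y _; rewrite indicE.
  have cg : 0 <= ct e * gau3 (1 / 2 / (4 * e)) x y by rewrite mulr_ge0 ?gau3_ge0// ltW// ct_gt0.
  have [yA|yA] := boolP (y \in A).
    by rewrite subrr mulr_ge0.
  rewrite mulr0 subr0 mulr1 /hk mulrCA; apply: ler_wpM2l; first by rewrite ltW// ct_gt0.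
  have Ay : ~ A y by move/mem_set => h; rewrite h in yA.
  have h1 := Ar y Ay; have h2 := expR_ge1Dx (dist2 x y / (8 * e)).
  have -> : gau3 (1 / 2 / (4 * e)) x y = expR (dist2 x y / (8 * e)) * gau3 (4 * e)^-1 x y.
    rewrite /gau3 -expRD; congr expR; field; by rewrite gt_eqF.
  rewrite mulrA; apply: ler_peMl; first exact: gau3_ge0.
  apply: (@le_trans _ _ (8 * e / r ^+ 2 * (dist2 x y / (8 * e)))).
    rewrite (_ : _ * _ = dist2 x y / r ^+ 2); last by field; rewrite !gt_eqF.
    by rewrite ler_pdivlMr ?exprn_gt0// mul1r.
  by apply: ler_wpM2l => //; lra.
rewrite RintegralZl// [X in _ * X]/Rintegral ct_gau3//=.
rewrite (_ : 64 * e / r ^+ 2 = 8 * e / r ^+ 2 * 8); last by ring.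
apply: ler_wpM2l => //.
have s2 : 1 / 2 <= Num.sqrt (1 / 2) :> R.
  by rewrite -[leLHS]ger0_norm// -sqrtr_sqr ler_wsqrtr// expr2; lra.
have -> : 8 = ((1 / 2) ^+ 3)^-1 :> R by field.
rewrite lef_pV2 ?posrE ?exprn_gt0 ?sqrtr_gt0//.
by apply: lerXn2r; rewrite ?nnegrE ?sqrtr_ge0.
Qed.

Variables (a : R) (Aa : lam3 A = a%:E).

Lemma integral_one : lam3.-integrable setT (EFin \o one) /\ \int[lam3]_x one x = a.
Proof.
have E : (\int[lam3]_x (one x)%:E = a%:E)%E by rewrite integral_indic// setIT.
split; last by rewrite /Rintegral E.
apply: (@integrable_le _ _ _ lam3 _ one a) => //; last by rewrite E.
by move=> x; rewrite ger0_norm//; case/andP: (one01 x).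
Qed.

Lemma measurable_smooth_indic : measurable_fun setT smooth_indic.
Proof.
apply: (@measurable_Rintegral1 _ _ _ _ _ lam3 (fun q : space * space => hk e q.1 q.2 * one q.2)).
apply: measurable_funM; first exact: measurable_hk.
exact: (measurableT_comp mone measurable_snd).
Qed.

(** The heat flow is self-adjoint. *)
Lemma smooth_indic_dual (f : space -> R) (C : R) : measurable_fun setT f -> (forall y, `|f y| <= C) ->
  [/\ \int[lam3]_x (one x * \int[lam3]_y (hk e x y * f y)) = \int[lam3]_y (f y * smooth_indic y),
      lam3.-integrable setT (EFin \o (fun x => one x * \int[lam3]_y (hk e x y * f y))) &
      lam3.-integrable setT (EFin \o (fun y => f y * smooth_indic y))].
Proof.
move=> mf fC; have C0 : 0 <= C by apply: le_trans (fC origin).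
pose F (q : space * space) := one q.1 * (hk e q.1 q.2 * f q.2).
have mF : measurable_fun setT F.
  apply: measurable_funM; first exact: (measurableT_comp mone measurable_fst).
  apply: measurable_funM; first exact: measurable_hk.
  exact: (measurableT_comp mf measurable_snd).
have IF : (prodm lam3 lam3).-integrable setT (EFin \o F).
  apply: (@integrable_le _ _ _ (prodm lam3 lam3) _ (fun q => C * (one q.1 * hk e q.1 q.2)) (C * a)) => //.
  - apply: measurable_funM => //; apply: measurable_funM; last exact: measurable_hk.
    exact: (measurableT_comp mone measurable_fst).
  - move=> q; rewrite /F [leLHS]normrM [X in _ * X]normrM (ger0_norm (hk_ge0 _ _)) ger0_norm; last by case/andP: (one01 q.1).
    rewrite mulrA [leRHS]mulrC; apply: ler_wpM2l => //.
    by rewrite mulr_ge0 ?hk_ge0//; case/andP: (one01 q.1).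
  - rewrite (_ : (\int[_]_q _)%E = (\int[lam3]_x \int[lam3]_y (C * (one x * hk e x y))%:E)%E); last first.
      apply: (fubini_tonelli1 (fun q : space * space => (C * (one q.1 * hk e q.1 q.2))%:E)).
        apply/measurable_EFinP; apply: measurable_funM => //; apply: measurable_funM; last exact: measurable_hk.
        exact: (measurableT_comp mone measurable_fst).
      move=> q; rewrite lee_fin; apply: mulr_ge0 => //.
      by apply: mulr_ge0; [case/andP: (one01 q.1)|exact: hk_ge0].
    rewrite (eq_integral (fun x => (C%:E * (one x)%:E)%E)).
      rewrite ge0_integralZl//.
      - by rewrite integral_indic// setIT -[X in (_ * X)%E]/(lam3 A) Aa -EFinM.
      - exact/measurable_EFinP.
    move=> x _; rewrite (eq_integral (fun y => ((C * one x)%:E * (hk e x y)%:E)%E)); last first.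
      by move=> y _; rewrite -EFinM mulrA.
    rewrite ge0_integralZl//.
    - by rewrite integral_hk mule1 EFinM.
    - by apply/measurable_EFinP; exact: measurable_hkr.
    - by move=> y _; rewrite lee_fin hk_ge0.
    - by rewrite lee_fin mulr_ge0//; case/andP: (one01 x).
have E1 x : \int[lam3]_y F (x, y) = one x * \int[lam3]_y (hk e x y * f y).
  by rewrite /F /= RintegralZl//; exact: (integrable_hkM x mf fC).
have E2 y : \int[lam3]_x F (x, y) = f y * smooth_indic y.
  rewrite /smooth_indic -RintegralZl//; apply: eq_Rintegral => x _.
  by rewrite /F /= hkC; ring.
split.
  have := Rintegral_fubini IF.
  by under eq_Rintegral do rewrite E1; under [RHS]eq_Rintegral do rewrite E2.
  have := integrable_fine (integrable_fubini_F IF).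
  by apply: eq_integrable => // x _ /=; rewrite -E1.
have := integrable_fine (integrable_fubini_G IF).
by apply: eq_integrable => // x _ /=; rewrite -E2.
Qed.

(** The heat flow preserves the mass of [A], so what enters the complement is what
    leaves [A]. *)
Lemma smooth_indic_L1 : lam3.-integrable setT (EFin \o smooth_indic) /\
  \int[lam3]_x `|one x - smooth_indic x| = 2 * \int[lam3]_x (one x * (1 - smooth_indic x)).
Proof.
have [I1 E1] := integral_one.
have [D1 _ D2] := @smooth_indic_dual (fun=> 1) 1 (measurable_cst _) le1.
have E2 : \int[lam3]_x (one x * \int[lam3]_y (hk e x y * 1)) = a.
  rewrite -E1; apply: eq_Rintegral => x _.
  by under eq_Rintegral do rewrite mulr1; rewrite /Rintegral integral_hk mulr1.
rewrite E2 in D1.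
have Ig : lam3.-integrable setT (EFin \o smooth_indic).
  by apply: eq_integrable D2 => // x _ /=; rewrite mul1r.
split => //.
have Iog : lam3.-integrable setT (EFin \o (fun x => one x * (1 - smooth_indic x))).
  apply: (@integrable_le _ _ _ lam3 _ one a) => //.
  - apply: measurable_funM => //; apply: measurable_funB => //; exact: measurable_smooth_indic.
  - move=> x; have /andP[h1 h2] := one01 x; have /andP[h3 h4] := smooth_indic_le1 x.
    rewrite ger0_norm; last by rewrite mulr_ge0// subr_ge0.
    by apply: ler_piMr => //; lra.
  - by rewrite integral_indic// setIT -[X in (X <= _)%E]/(lam3 A) Aa.
transitivity (\int[lam3]_x (2 * (one x * (1 - smooth_indic x)) + (smooth_indic x - one x))).
  apply: eq_Rintegral => x _; have := smooth_indic_le1 x.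
  move: (smooth_indic x) => g /andP[h3 h4]; rewrite indicE; case: (_ \in _) => /=; first by rewrite ger0_norm; lra.
  by rewrite sub0r normrN ger0_norm//; ring.
rewrite RintegralD//; [|exact: integrableRZ|exact: integrableRB].
rewrite RintegralB// RintegralZl// E1.
have -> : \int[lam3]_x smooth_indic x = a.
  by rewrite D1; apply: eq_Rintegral => x _; rewrite mul1r.
by rewrite subrr addr0.
Qed.

End approximate_identity.

(** * Bounded open sets generate the measurable sets *)

Section boxes.
Context (R : realType).
Local Notation lam := (@lebesgue_measure R).
Local Notation space := (measurableTypeR R * measurableTypeR R * measurableTypeR R)%type.
Local Notation lam3 := (lam3 R).
Local Notation origin := (origin R).

Definition isopen (A : set space) := forall x, A x -> exists2 r : R, 0 < r &
  forall y, (forall i, `|pcoord x i - pcoord y i| < r) -> A y.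

Definition halfspace (i : 'I_3) (c : R) : set space := [set p | c < pcoord p i].
Definition cube (n : nat) : set space := [set p | forall i, `|pcoord p i| < n.+1%:R].

Definition bounded_open : set (set space) :=
  [set A | [/\ measurable A, isopen A & exists n, A `<=` cube n]].

Lemma pcoord_lt (x y : space) (i : 'I_3) (r : R) : `|pcoord x i - pcoord y i| < r ->
  pcoord x i < pcoord y i + r /\ pcoord y i < pcoord x i + r.
Proof. by rewrite ltr_norml => /andP[h1 h2]; split; lra. Qed.

Lemma measurable_halfspace i c : measurable (halfspace i c).
Proof.
rewrite (_ : halfspace i c = (fun p => pcoord p i) @^-1` `]c, +oo[%classic); last first.
  by apply/seteqP; split => p; rewrite /halfspace /= in_itv/= andbT.
rewrite -[X in measurable X]setTI; by apply: (@measurable_coord R i).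
Qed.

Lemma isopen_halfspace i c : isopen (halfspace i c).
Proof.
move=> x; rewrite /halfspace /= => cx; exists (pcoord x i - c); first by rewrite subr_gt0.
by move=> y /(_ i) /pcoord_lt []; lra.
Qed.

Lemma isopenI A B : isopen A -> isopen B -> isopen (A `&` B).
Proof.
move=> oA oB x [/oA[r r0 rA] /oB[s s0 sB]]; exists (Num.min r s).
  by rewrite lt_min r0.
move=> y h; split; [apply: rA|apply: sB] => i; have := h i; rewrite lt_min => /andP[] //.
Qed.

Lemma measurable_slice (i : 'I_3) (c : R) : measurable [set p : space | `|pcoord p i| < c].
Proof.
rewrite (_ : mkset _ = (fun p => pcoord p i) @^-1` `]- c, c[%classic); last first.
  by apply/seteqP; split => p /=; rewrite in_itv/= ltr_norml.
rewrite -[X in measurable X]setTI; by apply: (@measurable_coord R i).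
Qed.

Lemma measurable_cube n : measurable (cube n).
Proof.
rewrite (_ : cube n = [set p | `|pcoord p ord0| < n.+1%:R] `&`
  [set p | `|pcoord p (lift ord0 ord0)| < n.+1%:R] `&` [set p | `|pcoord p ord_max| < n.+1%:R]).
  by apply: measurableI; first apply: measurableI; exact: measurable_slice.
apply/seteqP; split => p /=; first by move=> h; split; [split|]; exact: h.
move=> [[h0 h1] h2] i.
by case: i => -[|[|[|//]]] ?; rewrite /pcoord /=; [exact: h0|exact: h1|exact: h2].
Qed.

Lemma isopen_cube n : isopen (cube n).
Proof.
move=> x xn; pose r (i : 'I_3) := n.+1%:R - `|pcoord x i|.
have r0 i : 0 < r i by rewrite subr_gt0.
exists (Num.min (Num.min (r ord0) (r (lift ord0 ord0))) (r ord_max)).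
  by rewrite !lt_min !r0.
move=> y h i.
have {}h : `|pcoord x i - pcoord y i| < r i.
  have := h i; rewrite !lt_min => /andP[/andP[h0 h1] h2].
  by case: i h0 h1 h2 => -[|[|[|//]]] ? h0 h1 h2;
   [move: h0|move: h1|move: h2]; rewrite /r /pcoord /=.
have h2 : `|pcoord y i| <= `|pcoord x i| + `|pcoord x i - pcoord y i|.
  by rewrite (le_trans _ (ler_normB _ _))// opprB addrC subrK.
by move: h h2; rewrite /r; lra.
Qed.

Lemma cube_patch n : bounded_open (cube n).
Proof. by split; [exact: measurable_cube|exact: isopen_cube|exists n]. Qed.

Lemma bounded_openI A B : bounded_open A -> bounded_open B -> bounded_open (A `&` B).
Proof.
move=> [mA oA [n nA]] [mB oB _]; split; [exact: measurableI|exact: isopenI|].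
by exists n => x [/nA].
Qed.

Lemma cube_exhaust (p : space) : exists n, cube n p.
Proof.
pose M := \sum_i `|@pcoord R p i|.
have hM i : `|pcoord p i| <= M by rewrite /M (bigD1 i)//= lerDl sumr_ge0.
exists (Num.truncn M) => i; apply: (le_lt_trans (hM i)).
exact: truncnS_gt.
Qed.

Lemma measurable_bounded_open : @measurable _ space = <<s bounded_open >>.
Proof.
apply/seteqP; split; last first.
  by apply: smallest_sub; [exact: sigma_algebra_measurable|move=> A []].
pose T := g_sigma_algebraType bounded_open.
have mc (i : 'I_3) : measurable_fun [set: T] (fun p : T => @pcoord R (p : space) i : measurableTypeR R).
  apply: (measurability _ (RGenOInfty.measurableE R)).
  move=> _ [_ [c ->] <-]; rewrite setTI.
  rewrite (_ : _ @^-1` _ = \bigcup_n (halfspace i c `&` cube n)).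
    apply: bigcup_measurable => n _; apply: sub_sigma_algebra.
    split; first by apply: measurableI; [exact: measurable_halfspace|exact: measurable_cube].
      by apply: isopenI; [exact: isopen_halfspace|exact: isopen_cube].
    by exists n => x [].
  apply/seteqP; split => p; rewrite /= in_itv/= andbT /halfspace.
    by have [n pn] := cube_exhaust p => cp; exists n.
  by case=> n _ [].
have mid : measurable_fun [set: T] (fun p : T => (p : space)).
  have : measurable_fun [set: T] (fun p : T => ((pcoord (p : space) ord0, pcoord (p : space) (lift ord0 ord0), pcoord (p : space) ord_max) : space)).
    by apply: measurable_fun_pair; first apply: measurable_fun_pair; exact: mc.
  by apply: eq_measurable_fun => -[[? ?] ?] _.
move=> A mA; have := mid measurableT A mA.
by rewrite setTI.
Qed.

End boxes.

(** Replacing [one] by [g] in the pairing with [f] costs at most [C] times their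
    distance in the mean. *)
Lemma integral_replace d (T : measurableType d) (R : realType) (mu : {measure set T -> \bar R})
  (one f g S : T -> R) (C de : R) :
  mu.-integrable setT (EFin \o one) ->
  mu.-integrable setT (EFin \o (fun x => f x * one x)) ->
  mu.-integrable setT (EFin \o g) ->
  mu.-integrable setT (EFin \o (fun x => f x * g x)) ->
  mu.-integrable setT (EFin \o (fun x => one x * S x)) ->
  \int[mu]_x (one x * S x) = \int[mu]_x (f x * g x) ->
  {ae mu, forall x, `|S x| <= de} -> 0 <= de -> 0 <= C -> (forall x, `|f x| <= C) ->
  (forall x, 0 <= one x) ->
  `|\int[mu]_x (f x * one x)| <= (\int[mu]_x one x) * de + C * \int[mu]_x `|one x - g x|.
Proof.
move=> I1 If1 Ig Ifg IS E Sd de0 C0 fC one0.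
have Id : mu.-integrable setT (EFin \o (fun x => f x * (one x - g x))).
  have := integrableRB If1 Ifg; apply: eq_integrable => // x _ /=; by rewrite mulrBr.
have -> : \int[mu]_x (f x * one x) =
   \int[mu]_x (one x * S x) + \int[mu]_x (f x * (one x - g x)).
  rewrite E -RintegralD//; apply: eq_Rintegral => x _; ring.
apply: (le_trans (ler_normD _ _)); apply: lerD.
  apply: (le_trans (le_normr_Rintegral measurableT IS)).
  rewrite mulrC -RintegralZl//.
  have IN : mu.-integrable setT (EFin \o (fun x => `|one x * S x|)) := integrable_norm IS.
  have IZ := integrableRZ de I1.
  rewrite /Rintegral fine_le//; [exact: integrable_fin_num|exact: integrable_fin_num|].
  apply: ae_ge0_le_integral => //.
  - exact: measurable_int IN.
  - by move=> x _; rewrite lee_fin mulr_ge0.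
  - exact: measurable_int IZ.
  apply: filterS Sd => x Sx _.
  by rewrite lee_fin normrM [leRHS]mulrC ger0_norm// ler_wpM2l.
apply: (le_trans (le_normr_Rintegral measurableT Id)).
have Ib : mu.-integrable setT (EFin \o (fun x => `|one x - g x|)).
  exact: (integrable_norm (integrableRB I1 Ig)).
rewrite -RintegralZl//.
apply: le_Rintegral => //.
- exact: integrable_norm Id.
- exact: integrableRZ.
- by move=> x _; rewrite normrM ler_wpM2r.
Qed.

Section determination.
Context (R : realType).
Local Notation lam := (@lebesgue_measure R).
Local Notation space := (measurableTypeR R * measurableTypeR R * measurableTypeR R)%type.
Local Notation lam3 := (lam3 R).
Local Notation origin := (origin R).

Lemma cube_finite n : (lam3 (cube n) < +oo)%E.
Proof.
pose N : R := n.+1%:R; have N0 : 0 < N by [].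
pose b := (3 * N ^+ 2)^-1; have b0 : 0 < b by rewrite invr_gt0 mulr_gt0// exprn_gt0.
have mC := @measurable_cube R n.
rewrite -(setIT (cube n)) -integral_indic//.
apply: (@le_lt_trans _ _ (\int[lam3]_p ((expR 1)%:E * (gau3 b origin p)%:E))%E).
  apply: ge0_le_integral => //.
  - by apply/measurable_EFinP; exact: measurable_indic.
  - by apply: emeasurable_funM => //; apply/measurable_EFinP; exact: measurable_gau3r.
  - move=> p _; rewrite -EFinM lee_fin indicE.
    have [/set_mem pC|_] := boolP (p \in cube n); last by rewrite mulr_ge0 ?expR_ge0.
    rewrite /gau3 -expRD -[leLHS]expR0 ler_expR subr_ge0.
    rewrite /b mulrC ler_pdivrMr ?mul1r; last by rewrite mulr_gt0// exprn_gt0.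
    have h i : (pcoord origin i - pcoord p i) ^+ 2 <= N ^+ 2.
      have -> : pcoord origin i = 0 :> R by case: i => -[|[|[|//]]].
      by rewrite sub0r sqrrN -[leLHS]real_normK ?num_real// lerXn2r ?nnegrE// ltW//; exact: pC.
    rewrite /dist2 !big_ord_recl big_ord0 addr0.
    have := h ord0; have := h (lift ord0 ord0); have := h (lift ord0 (lift ord0 ord0)).
    by lra.
rewrite ge0_integralZl//; last 2 first.
- by apply/measurable_EFinP; exact: measurable_gau3r.
- by move=> y _; rewrite lee_fin gau3_ge0.
by rewrite integral_gau3// -EFinM ltry.
Qed.

Lemma patch_finite A : bounded_open A -> exists a : R, lam3 A = a%:E.
Proof.
move=> [mA _ [n An]]; exists (fine (lam3 A)); rewrite fineK// ge0_fin_numE//.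
apply: le_lt_trans (cube_finite n); apply: le_measure => //; rewrite inE//.
exact: measurable_cube.
Qed.

Variables (f : space -> R) (C : R).
Hypotheses (mf : measurable_fun setT f) (fC : forall x, `|f x| <= C).
Hypothesis small : forall de e0, 0 < de -> 0 < e0 -> exists e : R, 0 < e < e0 /\
  {ae lam3, forall x, `|\int[lam3]_y (hk e x y * f y)| <= de}.

(** The integral of [f] over [A] differs from its pairing with the smoothed
    indicator by the heat that has left [A], which tends to [0] by dominated
    convergence; the pairing is the integral over [A] of the heat flow of [f],
    which is small. *)
Lemma patch_integral A : bounded_open A -> lam3.-integrable setT (EFin \o (fun x => f x * \1_A x)) /\
  \int[lam3]_x (f x * \1_A x) = 0.
Proof.
move=> pA; have [mA oA _] := pA; have [a Aa] := patch_finite pA.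
have C0 : 0 <= C by apply: le_trans (fC origin).
have one01 x : 0 <= (\1_A x : R) <= 1 by rewrite indicE; case: (_ \in _); rewrite ?ler01 ?lexx.
have m1 : measurable_fun setT (\1_A : space -> R) by exact: measurable_indic.
have [I1 E1] := @integral_one R A mA a Aa.
have If1 : lam3.-integrable setT (EFin \o (fun x => f x * \1_A x)).
  have := integrableRZ C I1.
  apply: le_integrable => //.
    by apply/measurable_EFinP; exact: measurable_funM.
  move=> x _ /=; rewrite lee_fin normrM [leRHS]normrM; apply: ler_wpM2r => //.
  by rewrite (le_trans (fC x))// ler_norm.
split => //.
have ex n : exists e : R, 0 < e < n.+1%:R^-1 /\
    {ae lam3, forall x, `|\int[lam3]_y (hk e x y * f y)| <= n.+1%:R^-1}.
  by apply: small; rewrite invr_gt0.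
have [e He] := choice ex.
have e0 n : 0 < e n by case: (He n) => /andP[].
pose g n := smooth_indic (e n) A.
have g01 n x : 0 <= g n x <= 1 by exact: smooth_indic_le1.
have mg n : measurable_fun setT (g n) by exact: measurable_smooth_indic.
have Ig n : lam3.-integrable setT (EFin \o g n) by case: (smooth_indic_L1 (e0 n) mA Aa).
pose s n := \int[lam3]_x (\1_A x * (1 - g n x)).
have s0 : s @ \oo --> 0.
  have [|||||_ _ cv] := @dominated_convergence _ _ _ lam3 setT measurableT
    (fun n x => (\1_A x * (1 - g n x))%:E) (cst 0%E) (EFin \o \1_A).
  - move=> n; apply/measurable_EFinP; apply: measurable_funM => //.
    exact: measurable_funB.
  - exact: measurable_cst.
  - apply: aeW => x _.
    have [xA|xA] := pselect (A x); last first.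
      rewrite indicE memNset//; under eq_fun do rewrite mul0r; exact: cvg_cst.
    have [r r0 rA] := oA _ xA.
    have B n : 1 - g n x <= 64 / r ^+ 2 * n.+1%:R^-1.
      apply: (@le_trans _ _ (64 * e n / r ^+ 2)).
        apply: smooth_indic_near => // y yA.
        have /existsNP[i /negP] : ~ (forall i, `|pcoord x i - pcoord y i| < r).
          by move=> h; exact/yA/rA.
        rewrite -leNgt => h; apply: le_trans (coord_dist2 x y i).
        by rewrite -[leRHS]real_normK ?num_real// lerXn2r ?nnegrE// ltW.
      rewrite [leLHS]mulrAC; apply: ler_wpM2l; first by rewrite divr_ge0// exprn_ge0// ltW.
      by case: (He n) => /andP[_ /ltW].
    apply: cvg_EFin; first exact: nearW.
    rewrite (_ : (fine \o _) = (fun n => \1_A x * (1 - g n x))); last by [].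
    apply: (@squeeze_cvgr _ _ _ _ (fun=> 0) (fun n => 64 / r ^+ 2 * n.+1%:R^-1)).
    + apply: nearW => n; have /andP[g0 g1] := g01 n x.
      by rewrite indicE mem_set// mul1r subr_ge0 g1 B.
    + exact: cvg_cst.
    + rewrite -[X in _ --> X](mulr0 (64 / r ^+ 2)); apply: cvgMr.
      exact: cvg_harmonic.
  - exact: I1.
  - apply: aeW => x n _ /=; have /andP[h1 h2] := one01 x; have /andP[h3 h4] := g01 n x.
    rewrite lee_fin ger0_norm; last by rewrite mulr_ge0// subr_ge0.
    by apply: ler_piMr => //; lra.
  have -> : s = (fun n => fine (\int[lam3]_x ((\1_A x * (1 - g n x))%:E))%E) by [].
  rewrite integral0 in cv; exact: (fine_cvg cv).
have bound n : `|\int[lam3]_x (f x * \1_A x)| <= a * n.+1%:R^-1 + C * (2 * s n).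
  have [D1 D2 D3] := smooth_indic_dual (e0 n) mA Aa mf fC.
  have [L1 L2] := smooth_indic_L1 (e0 n) mA Aa.
  have [_ Sn] := He n.
  have n0 k : 0 < k.+1%:R^-1 :> R by rewrite invr_gt0.
  rewrite -E1 -L2.
  exact: (integral_replace I1 If1 L1 D3 D2 D1 Sn (ltW (n0 n)) C0 fC (fun x => proj1 (andP (one01 x)))).
apply/eqP; rewrite -normr_le0.
have cv : (fun n => a * n.+1%:R^-1 + C * (2 * s n)) @ \oo --> a * 0 + C * (2 * 0).
  apply: cvgD; apply: cvgMr; first exact: cvg_harmonic.
  exact: cvgMr.
rewrite !mulr0 addr0 in cv.
apply: (ler_cvg_to (cvg_cst _) cv); exact: nearW.
Qed.

(** Bounded open sets form a pi-system generating the measurable sets. *)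
Lemma determined : {ae lam3, forall x, f x = 0}.
Proof.
have K n : {ae lam3, forall x, f x * \1_(cube n) x = 0}.
  have [In En] := patch_integral (@cube_patch R n).
  pose h x := (f x * \1_(cube n) x)%:E.
  have P : forall S, <<s @bounded_open R >> S -> (\int[lam3]_(x in S) h x)%E = 0%E.
    apply: dynkin_induction.
    - exact: measurable_bounded_open.
    - exact: bounded_openI.
    - by rewrite -[RHS](_ : (0 : R)%:E = 0%E)// -En /Rintegral fineK//; exact: integrable_fin_num.
    - move=> A pA; rewrite integral_mkcond.
      have [IA EA] := patch_integral (bounded_openI pA (@cube_patch R n)).
      rewrite -[RHS](_ : (0 : R)%:E = 0%E)// -EA /Rintegral fineK; last exact: integrable_fin_num.
      apply: eq_integral => x _; rewrite /h patchE indicI /=.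
      by rewrite [\1_A x]indicE; case: ifPn => _; rewrite /= ?mul1r// mul0r mulr0.
    - move=> S mS PS.
      have E := @integral_setU _ _ _ lam3 S (~` S) h mS (measurableC mS).
      rewrite setUv in E; move: E => /(_ _ _).
      rewrite PS add0e => <-.
      + by rewrite -[RHS](_ : (0 : R)%:E = 0%E)// -En /Rintegral fineK//; exact: integrable_fin_num.
      + exact: measurable_int In.
      + by apply/disj_setPS; rewrite setICr.
    - move=> F mF tF PF; rewrite integral_bigcup//; last first.
        by apply: integrableS In => //; exact: bigcup_measurable.
      by rewrite eseries0.
  have ae0 := @integral_ae_eq _ _ _ lam3 setT measurableT (cst 0%E) h In (measurable_cst _).
  have /ae0 : forall E, E `<=` setT -> measurable E ->
    (\int[lam3]_(x in E) h x = \int[lam3]_(x in E) (cst 0%E x))%E.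
    move=> E _ mE; rewrite integral0; apply: P.
    by have := mE; rewrite measurable_bounded_open.
  by apply: filterS => x /(_ Logic.I) [].
have := ae_foralln K.
apply: filterS => x hx.
have [n xn] := cube_exhaust x.
by have := hx n; rewrite indicE mem_set// mulr1.
Qed.

End determination.

(** * Backward uniqueness for the Navier-Stokes kernels *)

Section uniqueness.
Context (R : realType).
Local Notation lam := (@lebesgue_measure R).
Local Notation space := (measurableTypeR R * measurableTypeR R * measurableTypeR R)%type.
Local Notation lam3 := (lam3 R).

Definition oseen_xy (i j k : 'I_3) (t : R) (x y : space) : R := oseen t i j k (@reflect_pt R x y).

(** At [m = 0] the jet takes the value of the kernel, also for degenerate times; this
    transfers its measurability. *)
Lemma oseen_xy_jet i j k t x y : oseen_xy i j k t x y = oseen_jet 0 i j k t x y 0.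
Proof.
have dE : dist2 (@reflect_pt R x y) (origin R) = dist2 x y by rewrite !dist2E /= !subr0.
have e0 (c : R) : expR (- (0 * c)) = 1 by rewrite mul0r oppr0 expR0.
rewrite /oseen_xy /oseen /oseen_jet dE pcoord_reflect /jm2 /= e0 !mulr1 addr0 !mulr1.
congr (_ * (_ * _ - _)); apply: eq_Rintegral => s _.
rewrite /oseen_inner /oseen_jet_inner dE !pcoord_reflect /jm3 /jm2 /= e0 /dz /zzz; congr (_ * _); ring.
Qed.

Lemma measurable_oseen_xy d (T : measurableType d) (tq : T -> R) (xq yq : T -> space) i j k :
  measurable_fun setT tq -> measurable_fun setT xq -> measurable_fun setT yq ->
  measurable_fun setT (fun w => oseen_xy i j k (tq w) (xq w) (yq w)).
Proof.
move=> mt mx my; rewrite (_ : (fun w => _) = fun w => oseen_jet 0 i j k (tq w) (xq w) (yq w) 0).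
  exact: measurable_oseen_jet.
by apply/funext => w; rewrite oseen_xy_jet.
Qed.

Let mt : measurable_fun setT (fun q : (space * measurableTypeR R) * space => q.1.2 : R).
Proof. exact: (measurableT_comp measurable_snd measurable_fst). Qed.
Let mx : measurable_fun setT (fun q : (space * measurableTypeR R) * space => q.1.1).
Proof. exact: (measurableT_comp measurable_fst measurable_fst). Qed.
Let my : measurable_fun setT (fun q : (space * measurableTypeR R) * space => q.2).
Proof. exact: measurable_snd. Qed.

Definition duhamel_term (V : 'I_3 -> R -> space -> R) i (s t : R) (x : space) : R :=
  \int[lam]_(tau in `[s, t]) \int[lam3]_y
    (\sum_j \sum_k oseen_xy i j k (t - tau) x y * (V j tau y * V k tau y)).

(** The rescaling with [m = 1/2] serves here only to write the Duhamel term as one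
    absolutely convergent integral over space-time. *)
Definition duhamel_density (V : 'I_3 -> R -> space -> R) i (s t : R) (x : space)
  (z : space * measurableTypeR R) : R :=
  duhi (oseen_jet (1 / 2)) (resc (1 / 2) s V) (resc (1 / 2) s V) i ((t - s) * (1 + 1 / 2)) x z 0.

Lemma duhamel_space_time V M i s t x : umeas V -> bounded_by M V -> 0 <= M -> s < t ->
  [/\ (prodm lam3 lam).-integrable setT (EFin \o duhamel_density V i s t x),
      duhamel_term V i s t x = Num.sqrt (1 + 1 / 2) * \int[prodm lam3 lam]_z duhamel_density V i s t x z &
      `|duhamel_term V i s t x| <= Num.sqrt (1 + 1 / 2) * (9 * (M * M) *
         (kernel_const R * (2 * Num.sqrt ((t - s) * (1 + 1 / 2)))))].
Proof.
move=> mV bV M0 st.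
have th0 : 0 < (t - s) * (1 + 1 / 2) by rewrite mulr_gt0 ?subr_gt0.
have [|||||||I1 I2 I3] := @duhamel_rescaled _ space R lam3 'I_3 oseen_xy (@oseen_jet R) (@oseen_bound R)
   (kernel_const R) _ _ _ _ _ _ V M (1 / 2) s ((t - s) * (1 + 1 / 2)) i x mV bV M0 _ th0.
- by apply: le_trans (kernel_const_ge R); rewrite ler1n.
- by move=> m i' j k n; exact: (measurable_oseen_jet m i' j k n mt mx my).
- exact: (measurable_oseen_bound mt mx my).
- by move=> m N i' j k t' x' y /andP[m0 mr] t0; exact: nrm_oseen_jet.
- by move=> t' x' t0; exact: integral_oseen_bound.
- by move=> m i' j k t' x' y m0 t0; rewrite oseen_jet0.
- by rewrite lexx andbT.
have tE : s + (t - s) * (1 + 1 / 2) / (1 + 1 / 2) = t by field.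
rewrite tE in I2; rewrite card_ord in I3.
have E : duhamel_term V i s t x = Num.sqrt (1 + 1 / 2) * \int[prodm lam3 lam]_z duhamel_density V i s t x z by exact: I2.
split => //; rewrite E normrM ger0_norm ?sqrtr_ge0//.
apply: ler_wpM2l; first exact: sqrtr_ge0.
by apply: (le_trans I3); rewrite -natrX.
Qed.

Lemma mild_unique (T M : R) (u v : 'I_3 -> R -> space -> R) :
  mild lam3 (@hk R) oseen_xy T u -> mild lam3 (@hk R) oseen_xy T v ->
  umeas u -> umeas v -> bounded_by M u -> bounded_by M v -> 0 <= M -> 0 < T ->
  {ae lam3, forall x i, u i T x = v i T x} ->
  forall t, 0 <= t <= T -> {ae lam3, forall x i, u i t x = v i t x}.
Proof.
move=> hu hv umu umv bu bv M0 T0 uvT.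
apply: (@backward_uniqueness _ space R lam3 'I_3 (@hk R) oseen_xy
  (@heat_jet R) (@oseen_jet R) (@oseen_bound R) (kernel_const R)
  _ _ _ _ _ _ _ _ _ _ _ _ T M u v hu umu bu hv umv bv M0 T0 uvT).
- by apply: le_trans (kernel_const_ge R); rewrite ler1n.
- by move=> m n; exact: (measurable_heat_jet mt mx my).
- by move=> m i j k n; exact: (measurable_oseen_jet m i j k n mt mx my).
- exact: (measurable_oseen_bound mt mx my).
- by move=> m N t x /andP[m0 mr] t0; exact: integral_heat_jet.
- by move=> m N i j k t x y /andP[m0 mr] t0; exact: nrm_oseen_jet.
- by move=> t x t0; exact: integral_oseen_bound.
- by move=> m t x y m0 t0; rewrite heat_jet0// heat_kernel_hk.
- by move=> m i j k t x y m0 t0; rewrite oseen_jet0.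
- by move=> *; exact: heat_jetS.
- by move=> *; exact: oseen_jetS.
- by move=> f C mf fC small; exact: (determined mf fC small).
Qed.

End uniqueness.

(** * Null sets in products *)

Section ae_product.
Context d1 d2 (T1 : measurableType d1) (T2 : measurableType d2) (R : realType)
  (m1 : {sigma_finite_measure set T1 -> \bar R})
  (m2 : {sigma_finite_measure set T2 -> \bar R}).

Lemma ae_indic d (T : measurableType d) (mu : {measure set T -> \bar R}) (E : set T) :
  measurable E -> {ae mu, forall x, E x} <-> (\int[mu]_x (\1_(~` E) x : R)%:E = 0)%E.
Proof.
move=> mE; rewrite integral_indic ?setIT//; last exact: measurableC.
split => [[N [mN N0 EN]]|E0].
  by apply: (subset_measure0 _ mN EN N0); exact: measurableC.
by exists (~` E); split => //; exact: measurableC.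
Qed.

Lemma ae_int0 d (T : measurableType d) (mu : {measure set T -> \bar R}) (f : T -> \bar R) :
  measurable_fun setT f -> (forall x, 0 <= f x)%E ->
  (\int[mu]_x f x = 0)%E <-> {ae mu, forall x, f x = 0%E}.
Proof.
move=> mf f0; have := @ae_eq_integral_abs _ _ _ mu setT measurableT f mf.
rewrite (_ : (\int[mu]_x `|f x|)%E = (\int[mu]_x f x)%E); last first.
  by apply: eq_integral => x _; rewrite gee0_abs.
move=> [h1 h2]; split.
  by move=> /h1; apply: filterS => x /(_ Logic.I).
by move=> H; apply: h2; apply: filterS H => x ->.
Qed.

Variables (E : set (T1 * T2)) (mE : measurable E).

Let f (z : T1 * T2) : \bar R := (\1_(~` E) z : R)%:E.

Let mf : measurable_fun setT f.
Proof. by apply/measurable_EFinP; apply: measurable_indic; exact: measurableC. Qed.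

Let f0 z : (0 <= f z)%E.
Proof. by rewrite lee_fin. Qed.

(** Fubini for null sets, in the two orders of integration. *)
Lemma ae_prod12 : {ae prodm m1 m2, forall z, E z} <->
  {ae m1, forall x, {ae m2, forall y, E (x, y)}}.
Proof.
apply: (iff_trans (ae_indic (prodm m1 m2) mE)).
rewrite (fubini_tonelli1 f)//.
apply: (iff_trans (ae_int0 m1 _ _)).
- exact: (measurable_fun_fubini_tonelli_F f).
- by move=> x; apply: integral_ge0.
have K x : (\int[m2]_y f (x, y))%E = 0%E <-> {ae m2, forall y, E (x, y)}.
  have mEx : measurable [set y | E (x, y)].
    by rewrite -[X in measurable X]setTI; exact: (measurable_pair1 x).
  exact: (iff_sym (ae_indic m2 mEx)).
by split; apply: filterS => x /K.
Qed.

Lemma ae_prod21 : {ae prodm m1 m2, forall z, E z} <->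
  {ae m2, forall y, {ae m1, forall x, E (x, y)}}.
Proof.
apply: (iff_trans (ae_indic (prodm m1 m2) mE)).
rewrite (fubini_tonelli2 f)//.
apply: (iff_trans (ae_int0 m2 _ _)).
- exact: (measurable_fun_fubini_tonelli_G f).
- by move=> y; apply: integral_ge0.
have K y : (\int[m1]_x f (x, y))%E = 0%E <-> {ae m1, forall x, E (x, y)}.
  have mEy : measurable [set x | E (x, y)].
    by rewrite -[X in measurable X]setTI; exact: (measurable_pair2 y).
  exact: (iff_sym (ae_indic m1 mEy)).
by split; apply: filterS => y /K.
Qed.

End ae_product.

Lemma Lnorm_infty_ae d (T : measurableType d) (R : realType) (mu : {measure set T -> \bar R})
  (g : T -> R) : ('N[mu]_+oo[EFin \o g] < +oo)%E ->
  exists2 M : R, 0 <= M & {ae mu, forall x, `|g x| <= M}.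
Proof.
rewrite unlock; case: ifPn => [mu0 h|mu0 _]; last first.
  exists 0 => //; exists setT; split => //.
  by apply/eqP; rewrite eq_le measure_ge0 andbT leNgt.
have := ess_sup_inf.ess_sup_ge mu (abse \o (EFin \o g)).
move: h; case: (ess_sup_inf.ess_sup _ _) => [r|//|] _ H.
- exists (Num.max 0 r); first by rewrite le_max lexx.
  by apply: filterS H => x /=; rewrite lee_fin le_max orbC => ->.
- exists 0 => //; apply: filterS H => x /=.
  by rewrite leeNy_eq.
Qed.

(** * Reduction to everywhere bounded, jointly measurable fields *)

Section reduction.
Context (R : realType).
Local Notation lam := (@lebesgue_measure R).
Local Notation space := (measurableTypeR R * measurableTypeR R * measurableTypeR R)%type.
Local Notation lam3 := (lam3 R).

Definition clip (M a : R) : R := Num.max (- M) (Num.min M a).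

Lemma clip_bound M a : 0 <= M -> `|clip M a| <= M.
Proof.
move=> M0; rewrite ler_norml /clip le_max lexx /= ge_max ge_min lexx /= andbT.
by rewrite -subr_ge0 opprK addr_ge0.
Qed.

Lemma clip_id M a : `|a| <= M -> clip M a = a.
Proof.
by rewrite ler_norml => /andP[h1 h2]; rewrite /clip min_r// max_r.
Qed.

Lemma measurable_clip M : measurable_fun setT (clip M).
Proof. by apply: measurable_maxr => //; exact: measurable_minr. Qed.

Lemma Rintegral_ae d (X : measurableType d) (m : {measure set X -> \bar R}) (F G : X -> R) :
  measurable_fun setT F -> measurable_fun setT G -> {ae m, forall x, F x = G x} ->
  \int[m]_x F x = \int[m]_x G x.
Proof.
move=> mF mG FG; rewrite /Rintegral; congr fine; apply: ae_eq_integral => //.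
- exact/measurable_EFinP.
- exact/measurable_EFinP.
- by apply: filterS FG => x /= ->.
Qed.

Lemma Rintegral_itv_ae (s t : R) (F G : R -> R) :
  measurable_fun (`]s, t[%classic : set R) F -> measurable_fun (`]s, t[%classic : set R) G ->
  {ae lam, forall x : measurableTypeR R, s < (x : R) < t -> F x = G x} ->
  \int[lam]_(x in `[s, t]) F x = \int[lam]_(x in `[s, t]) G x.
Proof.
move=> mF mG FG.
have mF' : measurable_fun (`]s, t[%classic : set R) (EFin \o F) by exact/measurable_EFinP.
have mG' : measurable_fun (`]s, t[%classic : set R) (EFin \o G) by exact/measurable_EFinP.
rewrite /Rintegral [X in fine X = _](integral_itv_bndoo _ _ mF').
rewrite [X in _ = fine X](integral_itv_bndoo _ _ mG').
congr fine; apply: ae_eq_integral => //.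
apply: filterS FG => x /= h; rewrite in_itv/= => /h ->//.
Qed.

Section velocity.
Variables (T : R) (T0 : 0 < T) (u : R -> 'rV[R]_3 -> 'rV[R]_3).
Hypotheses (bu : bounded_field T u) (mu : mild_formula T u).

Let U i (t : R) (x : space) : R := u t (vec3 x) 0 i.

(** The velocity, modified by [g] in the slab and extended by zero. *)
Definition extension (g : R -> R) i (t : R) (x : space) : R :=
  if 0 <= t <= T then g (U i t x) else 0.

Lemma extension_umeas (g : R -> R) : measurable_fun [set: R] g -> g 0 = 0 -> umeas (extension g).
Proof.
move=> mg g0 i; have [mU _ _] := bu.
have mS : measurable (slab T).
  rewrite (_ : slab T = snd @^-1` `[0, T]%classic); last first.
    by apply/seteqP; split => q; rewrite /slab /= in_itv.
  by rewrite -[X in measurable X]setTI; apply: measurable_snd => //; exact: measurable_itv.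
have := (measurable_restrictT _ mS).1 (mU i) => /(measurableT_comp mg).
apply: eq_measurable_fun => z _ /=; rewrite /extension patchE.
have -> : (z \in slab T) = (0 <= (z.2 : R) <= T) by apply/idP/idP; rewrite inE.
by case: ifP.
Qed.

Let U0 := extension id.

Let mU0 : umeas U0. Proof. exact: extension_umeas. Qed.

Lemma enorm_coord (x : 'rV[R]_3) i : `|x 0 i| <= enorm x.
Proof.
rewrite -sqrtr_sqr ler_wsqrtr// (bigD1 i)//= lerDl.
by apply: sumr_ge0 => l _; exact: sqr_ge0.
Qed.

Lemma slice_bound t : 0 <= t <= T -> exists2 M : R, 0 <= M &
  {ae lam3, forall x, forall i, `|U i t x| <= M}.
Proof.
move=> tT; have [_ _ /(_ t tT) /Lnorm_infty_ae [M M0 H]] := bu.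
exists M => //; apply: filterS H => x h i.
exact: (le_trans (enorm_coord _ _) (le_trans (ler_norm _) h)).
Qed.

Lemma slab_bound : exists2 M : R, 0 <= M &
  {ae lam, forall t : measurableTypeR R, 0 <= (t : R) <= T -> {ae lam3, forall x, forall i, `|U i t x| <= M}}.
Proof.
have [_ /Lnorm_infty_ae [M M0 [N [mN N0 HN]]] _] := bu.
exists M => //.
have /ae_prod21 : {ae prodm lam3 lam, forall z, (~` N) z}.
  by exists N; split => //; rewrite setCK.
move=> /(_ (measurableC mN)); apply: filterS => t Ht tT.
apply: filterS Ht => x Nx i.
have h : `|((fun q : space * measurableTypeR R => enorm (u q.2 (vec3 q.1))) \_ (slab T)) (x, t)| <= M.
  by apply: contrapT => /HN.
rewrite patchE mem_set// in h.
exact: (le_trans (enorm_coord _ _) (le_trans (ler_norm _) h)).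
Qed.

Lemma mild_coordinates s t : 0 <= s -> s < t -> t <= T -> {ae lam3, forall x, forall i,
  U i t x = \int[lam3]_y (hk (t - s) x y * U i s y) -
    \int[lam]_(tau in `[s, t]) heat_leray_div (t - tau) (tensor (u tau)) (vec3 x) 0 i}.
Proof.
move=> s0 st tT; apply: filterS (mu s0 (ltW st) tT) => x Ex i.
rewrite /U Ex !mxE; congr (_ - _).
rewrite /heat gt_eqF ?subr_gt0// mxE leb3E.
by apply: eq_Rintegral => y _; rewrite heat_kernel_hk.
Qed.

Lemma measurable_duhamel_slice (W : 'I_3 -> R -> space -> R) i t x : umeas W ->
  measurable_fun setT (fun tau : measurableTypeR R => \int[lam3]_y
    (\sum_j \sum_k oseen_xy i j k (t - (tau : R)) x y * (W j tau y * W k tau y))).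
Proof.
move=> mW.
have mW2 j : measurable_fun setT (fun q : measurableTypeR R * space => W j q.1 q.2).
  exact: (measurableT_comp (mW j) (@measurable_swap _ _ _ _)).
apply: (@measurable_Rintegral1 _ _ _ _ _ lam3 (fun q : measurableTypeR R * space =>
  \sum_j \sum_k oseen_xy i j k (t - (q.1 : R)) x q.2 * (W j q.1 q.2 * W k q.1 q.2))).
apply: measurable_sum => j; apply: measurable_sum => k.
apply: measurable_funM; last exact: measurable_funM.
apply: measurable_oseen_xy => //.
apply: measurable_funB => //.
Qed.

(** The Duhamel term sees the field only up to null sets in space, for almost
    every time. *)
Lemma duhamel_replace (W : 'I_3 -> R -> space -> R) s t x i : umeas W ->
  0 <= s -> s < t -> t <= T ->
  {ae lam, forall tau : measurableTypeR R, 0 <= (tau : R) <= T -> {ae lam3, forall y, forall j, U j tau y = W j tau y}} ->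
  \int[lam]_(tau in `[s, t]) heat_leray_div (t - tau) (tensor (u tau)) (vec3 x) 0 i =
  duhamel_term W i s t x.
Proof.
move=> mW s0 st tT UW.
have mWd := measurable_duhamel_slice i t x mW.
have mUd := measurable_duhamel_slice i t x mU0.
have in_slab tau : (`]s, t[%classic : set R) tau -> 0 <= tau <= T.
  by rewrite /= in_itv/= => /andP[h1 h2]; apply/andP; split; [exact: (le_trans s0 (ltW h1))|exact: (le_trans (ltW h2))].
have E tau : (`]s, t[%classic : set R) tau ->
  heat_leray_div (t - tau) (tensor (u tau)) (vec3 x) 0 i =
  \int[lam3]_y (\sum_j \sum_k oseen_xy i j k (t - tau) x y * (U0 j tau y * U0 k tau y)).
  move=> /[dup] h /in_slab h2; rewrite mxE leb3E; apply: eq_Rintegral => y _.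
  apply: eq_bigr => j _; apply: eq_bigr => k _.
  have -> : vec3 x - vec3 y = vec3 (@reflect_pt R x y).
    by apply/rowP => l; rewrite !mxE; case: l => -[|[|[|//]]].
  have tt : 0 < t - tau by move: h; rewrite /= in_itv/= => /andP[_]; rewrite subr_gt0.
  rewrite oseen_kernelE// /oseen_xy; congr (_ * _).
  by rewrite /tensor !mxE big_ord1 !mxE /U0 /extension h2.
have mo : measurable (`]s, t[%classic : set (measurableTypeR R)) by exact: measurable_itv.
apply: Rintegral_itv_ae.
- apply: eq_measurable_fun (measurable_funTS mUd) => tau.
  by rewrite inE => /E ->.
- exact: measurable_funTS.
apply: filterS UW => tau H htau'; have htau : (`]s, t[%classic : set R) tau by rewrite /= in_itv.
rewrite (E _ htau).
have h2 := in_slab _ htau.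
have mk (W' : 'I_3 -> R -> space -> R) : umeas W' -> measurable_fun setT (fun y =>
    \sum_j \sum_k oseen_xy i j k (t - tau) x y * (W' j tau y * W' k tau y)).
  move=> mW'; have mS j := umeas_slice tau j mW'.
  apply: measurable_sum => j; apply: measurable_sum => k.
  by apply: measurable_funM; [exact: (measurable_oseen_xy _ _ _ (tq := fun=> t - tau) (xq := fun=> x) (yq := id))|exact: measurable_funM].
apply: Rintegral_ae; [exact: mk|exact: mk|].
apply: filterS (H h2) => y Hy.
by apply: eq_bigr => j _; apply: eq_bigr => k _; rewrite /U0 /extension h2 !Hy.
Qed.


Lemma heat_bound_slice s t x i (M : R) : 0 <= s <= T -> s < t -> 0 <= M ->
  {ae lam3, forall y, forall j, `|U j s y| <= M} ->
  `|\int[lam3]_y (hk (t - s) x y * U i s y)| <= M.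
Proof.
move=> sT st M0 UM; have ts : 0 < t - s by rewrite subr_gt0.
have mUs : measurable_fun setT (fun y => U i s y).
  have := umeas_slice s i mU0; apply: eq_measurable_fun => y _.
  by rewrite /U0 /extension sT.
have mh := @measurable_hkr R (t - s) x.
apply: Rintegral_le; first exact: measurable_funM.
apply: (@le_trans _ _ (\int[lam3]_y (M%:E * (hk (t - s) x y)%:E))%E).
  apply: ae_ge0_le_integral => //.
  - by apply/measurable_EFinP; apply: measurableT_comp => //; exact: measurable_funM.
  - by move=> y _; rewrite -EFinM lee_fin mulr_ge0// hk_ge0.
  - by apply: emeasurable_funM => //; exact/measurable_EFinP.
  apply: filterS UM => y Hy _; rewrite -EFinM lee_fin normrM mulrC (ger0_norm (hk_ge0 ts _ _)).
  by apply: ler_wpM2r; [exact: (hk_ge0 ts)|exact: Hy].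
rewrite ge0_integralZl//.
- by rewrite integral_hk// mule1.
- exact/measurable_EFinP.
- by move=> y _; rewrite lee_fin hk_ge0.
Qed.

(** The bound of the space-time essential supremum holds for almost every time only.
    At the other times the mild formula started at time [0] bounds the slice by
    the initial slice and the Duhamel term, which involves almost every time. *)
Lemma uniform_bound : exists2 M : R, 0 <= M &
  forall t, 0 <= t <= T -> {ae lam3, forall x, forall i, `|U i t x| <= M}.
Proof.
have [M1 M10 H1] := slab_bound.
have [M2 M20 H2] : exists2 M : R, 0 <= M & {ae lam3, forall x, forall i, `|U i 0 x| <= M}.
  by apply: slice_bound; rewrite lexx ltW.
pose W := extension (clip M1).
have c0 : clip M1 0 = 0 by rewrite clip_id// normr0.
have mW : umeas W := extension_umeas (measurable_clip M1) c0.
have bW : bounded_by M1 W.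
  by move=> i t x; rewrite /W /extension; case: ifP => _; [exact: clip_bound|rewrite normr0].
have UW : {ae lam, forall tau : measurableTypeR R, 0 <= (tau : R) <= T -> {ae lam3, forall y, forall j, U j tau y = W j tau y}}.
  apply: filterS H1 => tau H tT; apply: filterS (H tT) => y Hy j.
  by rewrite /W /extension tT clip_id.
pose B t := Num.sqrt (1 + 1 / 2) * (9 * (M1 * M1) *
         (kernel_const R * (2 * Num.sqrt ((t - 0) * (1 + 1 / 2))))).
have B0 t : 0 <= B t.
  rewrite /B; apply: mulr_ge0; first exact: sqrtr_ge0.
  apply: mulr_ge0; first by rewrite mulr_ge0// mulr_ge0.
  apply: mulr_ge0; first by apply: le_trans (kernel_const_ge R).
  by rewrite mulr_ge0// sqrtr_ge0.
exists (M2 + B T); first by rewrite addr_ge0.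
move=> t /andP[t0 tT]; move: t0; rewrite le_eqVlt => /predU1P[<-|t0].
  by apply: filterS H2 => x h i; rewrite (le_trans (h i))// lerDl.
apply: filterS (mild_coordinates (lexx 0) t0 tT) => x Ex i.
rewrite Ex (duhamel_replace _ _ mW (lexx 0) t0 tT UW).
apply: (le_trans (ler_normB _ _)); apply: lerD.
  by apply: heat_bound_slice => //; rewrite lexx ltW.
have [_ _ D] := duhamel_space_time i x mW bW M10 t0.
apply: (le_trans D); rewrite -/(B t) /B; apply: ler_wpM2l; first exact: sqrtr_ge0.
apply: ler_wpM2l; first by rewrite mulr_ge0// mulr_ge0.
apply: ler_wpM2l; first by apply: le_trans (kernel_const_ge R).
by rewrite ler_pM2l// ler_wsqrtr// ler_wpM2r// lerD2r.
Qed.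

(** Clipping at the uniform bound changes each slice on a null set only. *)
Lemma bounded_version : exists (V : 'I_3 -> R -> space -> R) (M : R),
  [/\ 0 <= M, umeas V, bounded_by M V, mild lam3 (@hk R) (@oseen_xy R) T V &
   forall t, 0 <= t <= T -> {ae lam3, forall x, forall i, u t (vec3 x) 0 i = V i t x}].
Proof.
have [M M0 HM] := uniform_bound.
pose V := extension (clip M).
have c0 : clip M 0 = 0 by rewrite clip_id// normr0.
have mV : umeas V := extension_umeas (measurable_clip M) c0.
have UV t : 0 <= t <= T -> {ae lam3, forall y, forall j, U j t y = V j t y}.
  by move=> tT; apply: filterS (HM t tT) => y Hy j; rewrite /V /extension tT clip_id.
exists V, M; split => //.
- by move=> i t x; rewrite /V /extension; case: ifP => _; [exact: clip_bound|rewrite normr0].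
- move=> s t s0 st tT.
  have tT' : 0 <= t <= T by rewrite tT (le_trans s0 (ltW st)).
  have sT' : 0 <= s <= T by rewrite s0 (le_trans (ltW st) tT).
  apply: filterS2 (UV t tT') (mild_coordinates s0 st tT) => x Vx Ex i.
  rewrite -Vx Ex (duhamel_replace _ _ mV s0 st tT); last first.
    by apply: aeW => tau; exact: UV.
  congr (_ - _).
  have mh := @measurable_hkr R (t - s) x.
  apply: Rintegral_ae.
  + apply: measurable_funM => //.
    have := umeas_slice s i mU0; apply: eq_measurable_fun => y _.
    by rewrite /U0 /extension sT'.
  + by apply: measurable_funM => //; exact: umeas_slice.
  + by apply: filterS (UV s sT') => y ->.
Qed.

End velocity.
End reduction.

(** * Reflections in vertical planes *)

Section reflection.
Context (R : realType).
Local Notation lam := (@lebesgue_measure R).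
Local Notation space := (measurableTypeR R * measurableTypeR R * measurableTypeR R)%type.
Local Notation lam3 := (lam3 R).
Local Notation origin := (origin R).
Variables (c s : R).

(** The matrix of the reflection [refl], orthogonal and symmetric when [c^2 + s^2 = 1]. *)
Definition oent (i j : 'I_3) : R :=
  (nth [::] [:: [:: c; s; 0]; [:: s; - c; 0]; [:: 0; 0; 1]] i)`_j.

Definition refl (p : space) : space :=
  (c * (p.1.1 : R) + s * (p.1.2 : R), s * (p.1.1 : R) - c * (p.1.2 : R), p.2 : R).

Definition ovec (W : 'I_3 -> R) (i : 'I_3) : R := \sum_l oent i l * W l.

Definition dot (W Z : 'I_3 -> R) : R := \sum_l W l * Z l.

Lemma sum3 (f : 'I_3 -> R) : \sum_l f l = f ord0 + f (lift ord0 ord0) + f ord_max.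
Proof.
rewrite !big_ord_recl big_ord0 addr0 addrA; congr (_ + _ + f _); exact: val_inj.
Qed.

Lemma ord3P (P : 'I_3 -> Prop) : P ord0 -> P (lift ord0 ord0) -> P ord_max -> forall i, P i.
Proof.
move=> h0 h1 h2; case=> -[|[|[|//]]] h.
- by rewrite (_ : Ordinal h = ord0)//; exact: val_inj.
- by rewrite (_ : Ordinal h = lift ord0 ord0)//; exact: val_inj.
- by rewrite (_ : Ordinal h = ord_max)//; exact: val_inj.
Qed.

Lemma pcoord_refl p i : pcoord (refl p) i = ovec (pcoord p) i.
Proof. by move: i; apply: ord3P; rewrite /ovec sum3 /oent /pcoord /=; ring. Qed.

Lemma reflect_refl x y : @reflect_pt R (refl x) (refl y) = refl (@reflect_pt R x y).
Proof. by rewrite /refl /reflect_pt /=; congr (_, _, _); ring. Qed.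

Lemma measurable_refl : measurable_fun setT refl.
Proof.
have m1 : measurable_fun setT (fun p : space => p.1.1 : R).
  exact: (measurableT_comp measurable_fst measurable_fst).
have m2 : measurable_fun setT (fun p : space => p.1.2 : R).
  exact: (measurableT_comp measurable_snd measurable_fst).
apply: measurable_fun_pair; last exact: measurable_snd.
apply: measurable_fun_pair; first by apply: measurable_funD; exact: measurable_funM.
by apply: measurable_funB; exact: measurable_funM.
Qed.

Hypothesis cs1 : c ^+ 2 + s ^+ 2 = 1.

Lemma ovecK W : ovec (ovec W) =1 W.
Proof.
have s2 : s ^+ 2 = 1 - c ^+ 2 by rewrite -cs1 addrC addKr.
apply: ord3P; rewrite /ovec !sum3 /oent /=.
- transitivity ((c ^+ 2 + s ^+ 2) * W ord0); first by ring.
  by rewrite cs1 mul1r.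
- transitivity ((c ^+ 2 + s ^+ 2) * W (lift ord0 ord0)); first by ring.
  by rewrite cs1 mul1r.
- by ring.
Qed.

Lemma dot_ovec W Z : dot (ovec W) (ovec Z) = dot W Z.
Proof.
rewrite /dot /ovec !sum3 /oent /=.
transitivity ((c ^+ 2 + s ^+ 2) * (W ord0 * Z ord0 + W (lift ord0 ord0) * Z (lift ord0 ord0)) + W ord_max * Z ord_max).
  by ring.
by rewrite cs1 mul1r.
Qed.

Lemma dist2_refl x y : dist2 (refl x) (refl y) = dist2 x y.
Proof.
rewrite !dist2E /=.
transitivity ((c ^+ 2 + s ^+ 2) * (((x.1.1 : R) - y.1.1) ^+ 2 + ((x.1.2 : R) - y.1.2) ^+ 2) + ((x.2 : R) - y.2) ^+ 2).
  by ring.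
by rewrite cs1 mul1r.
Qed.

Lemma refl_origin : refl origin = origin.
Proof. by rewrite /refl /origin /= !mulr0 addr0 subr0. Qed.

Lemma dist2_refl0 z : dist2 (refl z) origin = dist2 z origin.
Proof. by rewrite -{1}refl_origin dist2_refl. Qed.

(** A plane reflection is a composition of shears and a coordinate reflection. *)
Lemma preserves_refl2 : preserves (prodm lam lam)
  (fun p : measurableTypeR R * measurableTypeR R =>
    (c * (p.1 : R) + s * (p.2 : R), s * (p.1 : R) - c * (p.2 : R)) : measurableTypeR R * measurableTypeR R).
Proof.
have aff (a b : R) : `|a| = 1 -> preserves lam (fun x : measurableTypeR R => b + a * (x : R) : measurableTypeR R).
  exact: preserves_affine.
have [s0|s0] := eqVneq s 0.
  have c1 : `|c| = 1.
    apply/eqP; rewrite -(@eqrXn2 _ 2)// real_normK ?num_real// expr1n.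
    by apply/eqP; move: cs1; rewrite s0 expr0n /= addr0.
  have Hc := @aff c 0 c1; have Hc' : `|- c| = 1 by rewrite normrN.
  have Hd := @aff (- c) 0 Hc'.
  have := preserves_pair Hc Hd; congr preserves; apply/funext => p /=.
  by rewrite s0; congr (_, _); ring.
pose k := (1 - c) / s.
have one : `|1 : R| = 1 by rewrite normr1.
have P1 : preserves (prodm lam lam) (fun p : measurableTypeR R * measurableTypeR R =>
   ((- (k * (p.2 : R)) + 1 * (p.1 : R) : measurableTypeR R), p.2)).
  apply: (@preserves_swap _ _ _ _ R lam lam (fun x y => - (k * (y : R)) + 1 * (x : R) : measurableTypeR R) id).
  - exact: preserves_id.
  - by apply: measurable_funD; [apply: measurableT_comp => //; apply: measurable_funM|apply: measurable_funM].
  - by move=> y; exact: aff.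
have P2 : preserves (prodm lam lam) (fun p : measurableTypeR R * measurableTypeR R =>
   (p.1, (s * (p.1 : R) + 1 * (p.2 : R) : measurableTypeR R))).
  apply: (@preserves_skew _ _ _ _ R lam lam id (fun x y => s * (x : R) + 1 * (y : R) : measurableTypeR R)).
  - exact: preserves_id.
  - by apply: measurable_funD; apply: measurable_funM.
  - by move=> x; exact: aff.
have mone : `|-1 : R| = 1 by rewrite normrN1.
have P3 := preserves_pair (preserves_id lam) (@aff (-1) 0 mone).
have := preserves_comp P1 (preserves_comp P2 (preserves_comp P1 P3)).
congr preserves; apply/funext => p /=.
have c2 : (1 - c) * (1 + c) = s ^+ 2 by rewrite -subr_sqr expr1n -cs1 addrC addKr.
have k1 : k * s = 1 - c by rewrite /k mulfVK.
have k2 : k * (1 + c) = s by rewrite /k mulrAC c2 expr2 mulfK.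
have sE : s * k = 1 - c by rewrite mulrC.
rewrite !add0r !mul1r !mulN1r; congr (_, _).
- transitivity ((1 - k * s) * (p.1 : R) + k * (1 + (1 - k * s)) * (p.2 : R)); first by ring.
  by rewrite k1 (_ : 1 - (1 - c) = c) ?k2//; ring.
- transitivity (s * (p.1 : R) - (1 - k * s) * (p.2 : R)); first by ring.
  by rewrite k1; ring.
Qed.

Lemma preserves_refl : preserves lam3 refl.
Proof.
have := preserves_pair preserves_refl2 (preserves_id lam).
by congr preserves; apply/funext => -[[]].
Qed.

(** The quadratic field applied to one vector field is built from scalar
    products, which makes its covariance visible. *)
Definition oseen_quad (t : R) (z : space) (W : 'I_3 -> R) (i : 'I_3) : R :=
  \sum_j \sum_k oseen t i j k z * (W j * W k).

(** The kernel is built from [kron], the coordinates and three functions of the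
    distance. *)
Lemma oseen_scalars t (rho2 : R) : exists a1 a2 a3 : R, 0 < t -> 0 <= rho2 ->
  forall z, dist2 z origin = rho2 -> forall i j k,
  oseen t i j k z = (kron R i j * pcoord z k + kron R i k * pcoord z j + kron R j k * pcoord z i) * a2
    - pcoord z i * pcoord z j * pcoord z k * a3 - kron R i j * pcoord z k * a1.
Proof.
pose e s := om s * expR (- (pp s * (rho2 / (4 * t)))).
pose a2 := ct t * (2^-1 * \int[lam]_s (om s * (expR (- (pp s * (rho2 / (4 * t)))) * (pp s ^+ 2 / (2 * t))))).
pose a3 := ct t * (2^-1 * \int[lam]_s (om s * (expR (- (pp s * (rho2 / (4 * t)))) * (pp s ^+ 3 / (4 * t ^+ 2))))).
exists (ct t / (2 * t) * expR (- (rho2 / (4 * t)))), a2, a3 => t0 r0 z zr i j k.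
have rt : 0 <= rho2 / (4 * t) by rewrite divr_ge0// mulr_ge0// ltW.
have I2 : lam.-integrable setT (EFin \o (fun s => om s * (expR (- (pp s * (rho2 / (4 * t)))) * (pp s ^+ 2 / (2 * t))))).
  have := integrable_om_poly 0 (2 * t)^-1 0 rt; apply: eq_integrable => // x _ /=; congr (_%:E); ring.
have I3 : lam.-integrable setT (EFin \o (fun s => om s * (expR (- (pp s * (rho2 / (4 * t)))) * (pp s ^+ 3 / (4 * t ^+ 2))))).
  have := integrable_om_poly 0 0 (4 * t ^+ 2)^-1 rt; apply: eq_integrable => // x _ /=; congr (_%:E); ring.
pose dzz := kron R i j * pcoord z k + kron R i k * pcoord z j + kron R j k * pcoord z i.
pose zz := pcoord z i * pcoord z j * pcoord z k.
rewrite /oseen zr -/dzz -/zz.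
have -> : \int[lam]_s (om s * oseen_inner t i j k z s) =
  dzz * \int[lam]_s (om s * (expR (- (pp s * (rho2 / (4 * t)))) * (pp s ^+ 2 / (2 * t))))
  - zz * \int[lam]_s (om s * (expR (- (pp s * (rho2 / (4 * t)))) * (pp s ^+ 3 / (4 * t ^+ 2)))).
  rewrite -RintegralZl// -[X in _ = _ - X]RintegralZl// -RintegralB//; [|exact: integrableRZ|exact: integrableRZ].
  by apply: eq_Rintegral => x _; rewrite /oseen_inner zr -/dzz -/zz; ring.
rewrite /a2 /a3; ring.
Qed.

Lemma oseen_quadE (z : space) (W : 'I_3 -> R) t a1 a2 a3 :
  (forall i j k,
  oseen t i j k z = (kron R i j * pcoord z k + kron R i k * pcoord z j + kron R j k * pcoord z i) * a2
    - pcoord z i * pcoord z j * pcoord z k * a3 - kron R i j * pcoord z k * a1) ->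
  forall i, oseen_quad t z W i = W i * dot (pcoord z) W * (2 * a2 - a1) +
    pcoord z i * (dot W W * a2 - dot (pcoord z) W ^+ 2 * a3).
Proof.
move=> E i; rewrite /oseen_quad.
under eq_bigr do under eq_bigr do rewrite E.
move: i; apply: ord3P; rewrite /dot !sum3 /kron /=; ring.
Qed.

Lemma oseen_quad_refl t z W i : 0 < t ->
  ovec (oseen_quad t (refl z) W) i = oseen_quad t z (ovec W) i.
Proof.
move=> t0; have [a1 [a2 [a3 H]]] := oseen_scalars t (dist2 z origin).
have Hz := H t0 (dist2_ge0 _ _) z erefl.
have Hr := H t0 (dist2_ge0 _ _) (refl z) (dist2_refl0 z).
have E1 := oseen_quadE W Hr; have E2 := oseen_quadE (ovec W) Hz.
have pE : pcoord (refl z) =1 ovec (pcoord z) by move=> l; exact: pcoord_refl.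
have dE : dot (pcoord (refl z)) W = dot (pcoord z) (ovec W).
  rewrite -(dot_ovec (pcoord z)) /dot; apply: eq_bigr => l _.
  by rewrite pE ovecK.
have dW : dot (ovec W) (ovec W) = dot W W by exact: dot_ovec.
rewrite E2 dW -dE; set A := dot (pcoord (refl z)) W in E1 *.
transitivity (ovec (fun l => W l * (A * (2 * a2 - a1)) + pcoord (refl z) l * (dot W W * a2 - A ^+ 2 * a3)) i).
  by rewrite /ovec; apply: eq_bigr => l _; rewrite E1 mulrA.
have pz := ovecK (pcoord z) i.
have -> : pcoord z i = ovec (pcoord (refl z)) i.
  by rewrite -pz /ovec; apply: eq_bigr => l _; rewrite pE.
rewrite /ovec !sum3; ring.
Qed.

(** ** Reflected solutions *)

Variables (T M : R) (V : 'I_3 -> R -> space -> R).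
Hypotheses (mV : umeas V) (bV : bounded_by M V) (M0 : 0 <= M)
  (miV : mild lam3 (@hk R) (@oseen_xy R) T V).

Definition reflected i t x : R := ovec (fun l => V l t (refl x)) i.

Lemma oent_le i j : `|oent i j| <= 1.
Proof.
have c1 : `|c| <= 1.
  rewrite -(@ler_pXn2r _ 2)// ?nnegrE// real_normK ?num_real// expr1n -cs1.
  by rewrite lerDl sqr_ge0.
have s1 : `|s| <= 1.
  rewrite -(@ler_pXn2r _ 2)// ?nnegrE// real_normK ?num_real// expr1n -cs1.
  by rewrite lerDr sqr_ge0.
by move: i j; apply: ord3P; apply: ord3P; rewrite /oent /= ?normrN ?normr0 ?normr1.
Qed.

Lemma reflected_umeas : umeas reflected.
Proof.
move=> i; apply: measurable_sum => l; apply: measurable_funM => //.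
have mg : measurable_fun setT (fun z : space * measurableTypeR R => (refl z.1, z.2)).
  apply: measurable_fun_pair => //.
  exact: (measurableT_comp measurable_refl measurable_fst).
exact: (measurableT_comp (mV l) mg).
Qed.

Lemma reflected_bound : bounded_by (3 * M) reflected.
Proof.
move=> i t x; rewrite /reflected /ovec sum3.
have h l : `|oent i l * V l t (refl x)| <= M.
  by rewrite normrM -[leRHS]mul1r; apply: ler_pM => //; exact: oent_le.
rewrite (_ : 3 * M = M + M + M); last by ring.
apply: (le_trans (ler_normD _ _)); apply: lerD => //.
by apply: (le_trans (ler_normD _ _)); apply: lerD.
Qed.

Lemma hk_refl e x y : hk e (refl x) (refl y) = hk e x y.
Proof. by rewrite /hk /gau3 dist2_refl. Qed.

Lemma reflected_heat i r t x : r < t ->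
  ovec (fun l => \int[lam3]_y (hk (t - r) (refl x) y * V l r y)) i =
  \int[lam3]_y (hk (t - r) x y * reflected i r y).
Proof.
move=> rt; have e0 : 0 < t - r by rewrite subr_gt0.
have mVr l := umeas_slice r l mV.
have I l : lam3.-integrable setT (EFin \o (fun y => hk (t - r) (refl x) y * V l r y)).
  by apply: (integrable_hkM e0 _ (mVr l)) => y; exact: bV.
have [I2 E2] := @Rintegral_sum _ _ R lam3 'I_3 (index_enum 'I_3)
  (fun l y => oent i l * (hk (t - r) (refl x) y * V l r y)) (fun l => integrableRZ _ (I l)).
rewrite /ovec; transitivity (\sum_l \int[lam3]_y (oent i l * (hk (t - r) (refl x) y * V l r y))).
  by apply: eq_bigr => l _; rewrite RintegralZl.
rewrite -E2 -(preserves_integral preserves_refl); last first.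
  apply: measurable_sum => l; apply: measurable_funM => //; apply: measurable_funM => //.
  exact: measurable_hkr.
apply: eq_Rintegral => y _; rewrite /reflected /ovec mulr_sumr.
by apply: eq_bigr => l _; rewrite hk_refl mulrCA.
Qed.

Lemma reflected_density i r t x y sg :
  ovec (fun l => duhamel_density V l r t (refl x) (refl y, sg)) i = duhamel_density reflected i r t x (y, sg).
Proof.
rewrite /duhamel_density /duhi /=; set th := (t - r) * (1 + 1 / 2).
case: ifPn => [/andP[sg0 sgt]|_]; last by rewrite /ovec; apply: big1 => l _; rewrite mulr0.
have ts : 0 < th - sg by rewrite subr_gt0.
have m0 : 0 < 1 / 2 :> R by [].
have tau0 : 0 < (th - sg) / (1 + 1 / 2) by rewrite divr_gt0.
pose W l := (Num.sqrt (1 + 1 / 2))^-1 * V l (r + sg / (1 + 1 / 2)) (refl y).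
have := oseen_quad_refl (@reflect_pt R x y) W i tau0.
move=> /(congr1 (fun a => (Num.sqrt (1 + 1 / 2))^-1 * a)).
rewrite /ovec mulr_sumr /oseen_quad => E.
transitivity (\sum_l (Num.sqrt (1 + 1 / 2))^-1 * (oent i l *
   \sum_j \sum_k oseen ((th - sg) / (1 + 1 / 2)) l j k (refl (reflect_pt x y)) * (W j * W k))).
  apply: eq_bigr => l _; rewrite [RHS]mulrCA; congr (_ * _).
  rewrite mulr_sumr; apply: eq_bigr => j _; rewrite mulr_sumr; apply: eq_bigr => k _.
  by rewrite oseen_jet0// reflect_refl -[LHS]mulrA.
rewrite E mulr_sumr; apply: eq_bigr => j _; rewrite mulr_sumr; apply: eq_bigr => k _.
rewrite oseen_jet0// -[RHS]mulrA; congr (_ * (_ * (_ * _))).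
- by rewrite /resc /reflected /ovec mulr_sumr; apply: eq_bigr => l _; rewrite /W mulrCA.
- by rewrite /resc /reflected /ovec mulr_sumr; apply: eq_bigr => l _; rewrite /W mulrCA.
Qed.

Lemma reflected_duhamel i r t x : r < t ->
  ovec (fun l => duhamel_term V l r t (refl x)) i = duhamel_term reflected i r t x.
Proof.
move=> rt.
have M30 : 0 <= 3 * M by rewrite mulr_ge0.
have [_ -> _] := duhamel_space_time i x reflected_umeas reflected_bound M30 rt.
have I l : (prodm lam3 lam).-integrable setT (EFin \o duhamel_density V l r t (refl x)).
  by case: (duhamel_space_time l (refl x) mV bV M0 rt).
have E l : duhamel_term V l r t (refl x) = Num.sqrt (1 + 1 / 2) * \int[prodm lam3 lam]_z duhamel_density V l r t (refl x) z.
  by case: (duhamel_space_time l (refl x) mV bV M0 rt).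
have [I2 E2] := @Rintegral_sum _ _ R (prodm lam3 lam) 'I_3 (index_enum 'I_3)
  (fun l z => oent i l * duhamel_density V l r t (refl x) z) (fun l => integrableRZ _ (I l)).
transitivity (Num.sqrt (1 + 1 / 2) * \sum_l \int[prodm lam3 lam]_z (oent i l * duhamel_density V l r t (refl x) z)).
  rewrite mulr_sumr; apply: eq_bigr => l _; rewrite E RintegralZl//; ring.
congr (_ * _).
have P : preserves (prodm lam3 lam) (fun z => (refl z.1, z.2)).
  exact: (preserves_pair preserves_refl (preserves_id lam)).
rewrite -E2 -(preserves_integral P); last first.
  by apply/measurable_EFinP; exact: measurable_int I2.
by apply: eq_Rintegral => -[y sg] _; rewrite -reflected_density.
Qed.

(** Both terms of the mild formula commute with the reflection. *)
Lemma reflected_mild : mild lam3 (@hk R) (@oseen_xy R) T reflected.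
Proof.
move=> r t r0 rt tT; have := preserves_ae preserves_refl (miV r0 rt tT).
apply: filterS => x Ex i.
rewrite -[X in _ = _ - X]/(duhamel_term reflected i r t x) -reflected_duhamel// -reflected_heat//.
by rewrite /reflected /ovec -sumrB; apply: eq_bigr => l _; rewrite Ex mulrBr.
Qed.

End reflection.

(** * Axial symmetry *)

Section axial.
Context (R : realType).
Local Notation lam := (@lebesgue_measure R).
Local Notation space := (measurableTypeR R * measurableTypeR R * measurableTypeR R)%type.
Local Notation lam3 := (lam3 R).

Definition axis_dist (p : space) : R := Num.sqrt ((p.1.1 : R) ^+ 2 + (p.1.2 : R) ^+ 2).

Lemma cyl_r_vec3 (p : space) : cyl_r (vec3 p) = axis_dist p.
Proof. by rewrite /cyl_r !mxE. Qed.

Lemma cyl_z_vec3 (p : space) : cyl_z (vec3 p) = p.2.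
Proof. by rewrite /cyl_z !mxE. Qed.

Definition radial (p : space) : 'I_3 -> R :=
  fun i => [:: (p.1.1 : R) / axis_dist p; (p.1.2 : R) / axis_dist p; 0]`_i.
Definition azimuthal (p : space) : 'I_3 -> R :=
  fun i => [:: - ((p.1.2 : R) / axis_dist p); (p.1.1 : R) / axis_dist p; 0]`_i.
Definition axial (i : 'I_3) : R := [:: 0; 0; 1]`_i.

Lemma e_r_vec3 p i : e_r (vec3 p) 0 i = radial p i.
Proof. by rewrite mxE cyl_r_vec3 !mxE. Qed.

Lemma e_theta_vec3 p i : e_theta (vec3 p) 0 i = azimuthal p i.
Proof. by rewrite mxE cyl_r_vec3 !mxE. Qed.

Lemma e_z_axial i : e_z R 0 i = axial i.
Proof. by move: i; apply: ord3P; rewrite /e_z mxE. Qed.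

Definition cylindrical (v : 'I_3 -> space -> R) (vr vt vz : R -> R -> R) (p : space) :=
  forall i, v i p = vr (axis_dist p) p.2 * radial p i
    + vt (axis_dist p) p.2 * azimuthal p i + vz (axis_dist p) p.2 * axial i.

Lemma axis_dist_refl (c s : R) (p : space) : c ^+ 2 + s ^+ 2 = 1 ->
  axis_dist (refl c s p) = axis_dist p.
Proof.
move=> cs; rewrite /axis_dist /=; congr Num.sqrt.
by rewrite -[RHS]mul1r -cs; ring.
Qed.

(** The radial and vertical frame fields are invariant under reflection, and without
    swirl the azimuthal component is zero. *)
Lemma swirl_free_reflected (v : 'I_3 -> space -> R) vr vt vz (c s : R) (p : space) :
  c ^+ 2 + s ^+ 2 = 1 -> cylindrical v vr vt vz p -> cylindrical v vr vt vz (refl c s p) ->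
  dot (v ^~ p) (azimuthal p) = 0 -> dot (v ^~ (refl c s p)) (azimuthal (refl c s p)) = 0 ->
  forall i, v i p = ovec c s (v ^~ (refl c s p)) i.
Proof.
move=> cs E Er S Sr.
have vt0 (a b t : R) : t * (a ^+ 2 + b ^+ 2) = 0 -> t * a = 0 /\ t * b = 0.
  move=> /eqP; rewrite mulf_eq0 => /orP[/eqP->|]; first by rewrite !mul0r.
  rewrite paddr_eq0 ?sqr_ge0// !sqrf_eq0 => /andP[/eqP-> /eqP->].
  by rewrite !mulr0.
have K q : cylindrical v vr vt vz q -> dot (v ^~ q) (azimuthal q) = 0 ->
  forall i, v i q = vr (axis_dist q) q.2 * radial q i + vz (axis_dist q) q.2 * axial i.
  move=> Eq; rewrite /dot sum3 !Eq /radial /azimuthal /axial /=.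
  set a := _ / axis_dist q; set b := _ / axis_dist q; set r1 := vr _ _; set t1 := vt _ _ => h.
  have [ta tb] : t1 * a = 0 /\ t1 * b = 0.
    by apply: vt0; rewrite -h; ring.
  apply: ord3P; rewrite Eq /radial /azimuthal /axial /= -/a -/b -/r1 -/t1.
  - by rewrite mulrN tb; ring.
  - by rewrite ta; ring.
  - by ring.
have Kp := K p E S; have Kr := K _ Er Sr.
apply: ord3P; rewrite /ovec sum3 /oent /= !Kr Kp /radial /axial /= axis_dist_refl//.
- transitivity ((c ^+ 2 + s ^+ 2) * (vr (axis_dist p) p.2 * ((p.1.1 : R) / axis_dist p))).
    by rewrite cs; ring.
  by ring.
- transitivity ((c ^+ 2 + s ^+ 2) * (vr (axis_dist p) p.2 * ((p.1.2 : R) / axis_dist p))).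
    by rewrite cs; ring.
  by ring.
- by ring.
Qed.

Lemma ae_off_axis : {ae lam3, forall p, axis_dist p != 0}.
Proof.
have m0 : measurable [set x : measurableTypeR R | (x : R) != 0].
  rewrite (_ : mkset _ = ~` [set (0 : R)]); first by apply: measurableC; exact: measurable_set1.
  by apply/seteqP; split => x /= /eqP.
have H1 : {ae lam, forall x : measurableTypeR R, (x : R) != 0}.
  exists [set (0 : R)]; split.
  - exact: measurable_set1.
  - exact: lebesgue_measure_set1.
  - by move=> x /= /negP; rewrite negbK => /eqP.
have H2 : {ae prodm lam lam, forall z : measurableTypeR R * measurableTypeR R, (z.1 : R) != 0}.
  apply/(@ae_prod12 _ _ _ _ R lam lam [set z | (z.1 : R) != 0]).
    rewrite (_ : mkset _ = fst @^-1` [set x : measurableTypeR R | (x : R) != 0])//.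
    by rewrite -[X in measurable X]setTI; apply: measurable_fst.
  by apply: filterS H1 => x x0; apply: aeW.
have H3 : {ae lam3, forall p : space, (p.1.1 : R) != 0}.
  apply/(@ae_prod12 _ _ _ _ R (prodm lam lam) lam [set p : space | (p.1.1 : R) != 0]).
    rewrite (_ : mkset _ = (fun p : space => p.1.1) @^-1` [set x : measurableTypeR R | (x : R) != 0])//.
    rewrite -[X in measurable X]setTI.
    by apply: (measurableT_comp measurable_fst measurable_fst).
  by apply: filterS H2 => z z0; apply: aeW.
apply: filterS H3 => p p0; rewrite /axis_dist sqrtr_eq0 -ltNge.
by rewrite ltr_wpDr ?sqr_ge0// exprn_even_gt0.
Qed.

Lemma polar_angle (a b : R) : a ^+ 2 + b ^+ 2 = 1 -> exists t, cos t = a /\ sin t = b.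
Proof.
move=> ab.
have a1 : -1 <= a <= 1.
  have h : a ^+ 2 <= 1 by rewrite -ab lerDl sqr_ge0.
  by rewrite -ler_norml -(@ler_pXn2r _ 2)// ?nnegrE// real_normK ?num_real// expr1n.
have bE : 1 - a ^+ 2 = b ^+ 2 by rewrite -ab addrC addKr.
have [b0|b0] := leP 0 b.
  exists (acos a); rewrite acosK// sin_acos// bE sqrtr_sqr ger0_norm//.
exists (- acos a); rewrite cosN sinN acosK// sin_acos// bE sqrtr_sqr ltr0_norm// opprK//.
Qed.

Variable v : 'I_3 -> space -> R.
Hypothesis mv : forall i, measurable_fun setT (v i).
Hypothesis sym : forall c s : R, c ^+ 2 + s ^+ 2 = 1 ->
  {ae lam3, forall x, forall i, v i x = ovec c s (fun l => v l (refl c s x)) i}.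

Let E : set (space * measurableTypeR R) := [set z | forall i, v i z.1 =
  ovec (cos (z.2 : R)) (sin (z.2 : R)) (fun l => v l (refl (cos (z.2 : R)) (sin (z.2 : R)) z.1)) i].

Let mE : measurable E.
Proof.
pose W i (z : space * measurableTypeR R) : R :=
  ovec (cos (z.2 : R)) (sin (z.2 : R)) (fun l => v l (refl (cos (z.2 : R)) (sin (z.2 : R)) z.1)) i.
have mcos : measurable_fun setT (fun z : space * measurableTypeR R => cos (z.2 : R)).
  by apply: (measurableT_comp _ measurable_snd); apply: continuous_measurable_fun; exact: continuous_cos.
have msin : measurable_fun setT (fun z : space * measurableTypeR R => sin (z.2 : R)).
  by apply: (measurableT_comp _ measurable_snd); apply: continuous_measurable_fun; exact: continuous_sin.
have m1 : measurable_fun setT (fun z : space * measurableTypeR R => z.1.1.1 : R).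
  exact: (measurableT_comp (measurableT_comp measurable_fst measurable_fst) measurable_fst).
have m2 : measurable_fun setT (fun z : space * measurableTypeR R => z.1.1.2 : R).
  exact: (measurableT_comp (measurableT_comp measurable_snd measurable_fst) measurable_fst).
have m3 : measurable_fun setT (fun z : space * measurableTypeR R => z.1.2 : R).
  exact: (measurableT_comp measurable_snd measurable_fst).
have mr : measurable_fun setT (fun z : space * measurableTypeR R => refl (cos (z.2 : R)) (sin (z.2 : R)) z.1).
  apply: measurable_fun_pair => //.
  apply: measurable_fun_pair; first by apply: measurable_funD; exact: measurable_funM.
  by apply: measurable_funB; exact: measurable_funM.
have mo i l : measurable_fun setT (fun z : space * measurableTypeR R => oent (cos (z.2 : R)) (sin (z.2 : R)) i l).
  move: i l; apply: ord3P; apply: ord3P; rewrite /oent /= => //.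
  exact: measurableT_comp.
have mW i : measurable_fun setT (W i).
  apply: measurable_sum => l; apply: measurable_funM; first exact: mo.
  exact: (measurableT_comp (mv l) mr).
have mEi i : measurable [set z : space * measurableTypeR R | v i z.1 == W i z].
  rewrite (_ : mkset _ = (fun z => v i z.1 == W i z) @^-1` [set true]) //.
  rewrite -[X in measurable X]setTI.
  by apply: (measurable_fun_eqr (measurableT_comp (mv i) measurable_fst) (mW i)).
rewrite (_ : E = [set z | v ord0 z.1 == W ord0 z] `&` [set z | v (lift ord0 ord0) z.1 == W (lift ord0 ord0) z]
   `&` [set z | v ord_max z.1 == W ord_max z]).
  by apply: measurableI => //; exact: measurableI.
apply/seteqP; split => z; rewrite /E /=.
  by move=> h; split; [split|]; apply/eqP; exact: h.
by move=> [[/eqP h0 /eqP h1] /eqP h2]; exact: ord3P.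
Qed.

Let ae_angle : {ae lam3, forall x, {ae lam, forall a : measurableTypeR R, E (x, a)}}.
Proof.
apply/(ae_prod12 lam3 lam mE)/(ae_prod21 lam3 lam mE).
by apply: aeW => a; exact: (sym (cos2Dsin2 (a : R))).
Qed.

Let polar (r a z : R) : space := (r * cos a, r * sin a, z).

(* The velocity at angle [a] on a horizontal circle, reflected by the plane that exchanges
   this angle with the angle 0. *)
Let turned (r z a : R) : 'I_3 -> R := ovec (cos a) (sin a) (fun l => v l (polar r a z)).

Let profiles r z : set ('I_3 -> R) :=
  [set w | {ae lam, forall a : measurableTypeR R, forall i, turned r z a i = w i}].

Let profiles_unique r z w w' : profiles r z w -> profiles r z w' -> w = w'.
Proof.
move=> h h'; apply/funext => i.
have lam0 : (0 < lam setT)%E.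
  have lamT : lam setT = +oo%E by rewrite -set_itvNyy lebesgue_measure_itv.
  by rewrite [X in (_ < X)%E]lamT.
have PF := ae_properfilter_algebraOfSetsType lam0.
have [a [ha ha']] := filter_ex (filterI h h').
by rewrite -ha -ha'.
Qed.

(** At almost every point [p], of angle [b], the symmetry holds for almost every
    reflection; the reflection of parameter [b + a] moves [p] to the angle [a].  So [turned r z a]
    is for almost every [a] the velocity at [p] expressed in the frame of [p]; in
    particular the latter depends on [r] and [z] only. *)
Lemma axial_profiles : exists vr vt vz : R -> R -> R,
  {ae lam3, forall p, cylindrical v vr vt vz p}.
Proof.
pose q r z := xget (fun=> 0) (profiles r z).
exists (fun r z => q r z ord0), (fun r z => q r z (lift ord0 ord0)), (fun r z => q r z ord_max).
apply: filterS2 ae_off_axis ae_angle => p r0 Ep.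
set r := axis_dist p in r0 *.
have [b [cb sb]] : exists b, cos b = (p.1.1 : R) / r /\ sin b = (p.1.2 : R) / r.
  apply: polar_angle; rewrite !exprMn -mulrDl -[X in X * _](@sqr_sqrtr _ _) ?addr_ge0 ?sqr_ge0//.
  by rewrite -/(axis_dist p) -/r exprVn divff// expf_neq0.
have p1 : (p.1.1 : R) = r * cos b by rewrite cb mulrC divfK.
have p2 : (p.1.2 : R) = r * sin b by rewrite sb mulrC divfK.
pose w := fun i : 'I_3 => [:: cos b * v ord0 p + sin b * v (lift ord0 ord0) p;
   - sin b * v ord0 p + cos b * v (lift ord0 ord0) p; v ord_max p]`_i.
have cs b' : cos b' ^+ 2 + sin b' ^+ 2 = 1 :> R by exact: cos2Dsin2.
have Pw : profiles r p.2 w.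
  have tr : preserves lam (fun a : measurableTypeR R => b + 1 * (a : R) : measurableTypeR R).
    by apply: preserves_affine; rewrite normr1.
  apply: filterS (preserves_ae tr Ep) => a; rewrite /E /= mul1r => Ea.
  have RE : refl (cos (b + a)) (sin (b + a)) p = polar r a p.2.
    rewrite /refl /polar p1 p2 cosD sinD; congr (_, _, _).
    - transitivity (r * ((cos b ^+ 2 + sin b ^+ 2) * cos a)); first by ring.
      by rewrite cs mul1r.
    - transitivity (r * ((cos b ^+ 2 + sin b ^+ 2) * sin a)); first by ring.
      by rewrite cs mul1r.
  rewrite RE in Ea; apply: ord3P.
  - rewrite /w /= !Ea /turned /ovec !sum3 /oent /= cosD sinD.
    set W0 := v _ _; set W1 := v _ _; set W2 := v _ _.
    transitivity ((cos b ^+ 2 + sin b ^+ 2) * (cos a * W0 + sin a * W1)); last by ring.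
    by rewrite cs; ring.
  - rewrite /w /= !Ea /turned /ovec !sum3 /oent /= cosD sinD.
    set W0 := v _ _; set W1 := v _ _; set W2 := v _ _.
    transitivity ((cos b ^+ 2 + sin b ^+ 2) * (sin a * W0 - cos a * W1)); last by ring.
    by rewrite cs; ring.
  - by rewrite /w /= !Ea /turned /ovec !sum3 /oent /=; ring.
have qE : q r p.2 = w.
  by apply: (profiles_unique (z := p.2) (r := r)) => //; exact: (xgetPex _ (ex_intro _ w Pw)).
apply: ord3P; rewrite /radial /azimuthal /axial /= -/r qE /w /=.
- rewrite -cb -sb; transitivity ((cos b ^+ 2 + sin b ^+ 2) * v ord0 p); last by ring.
  by rewrite cs mul1r.
- rewrite -cb -sb; transitivity ((cos b ^+ 2 + sin b ^+ 2) * v (lift ord0 ord0) p); last by ring.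
  by rewrite cs mul1r.
- by ring.
Qed.

(** The reflection in one vertical plane reverses the swirl. *)
Lemma no_swirl : {ae lam3, forall p, dot (v ^~ p) (azimuthal p) = 0}.
Proof.
have [vr [vt [vz H]]] := axial_profiles.
have cs : (1 : R) ^+ 2 + 0 ^+ 2 = 1 by rewrite expr1n expr0n /= addr0.
have Hr := preserves_ae (preserves_refl cs) H.
apply: filterS3 H Hr (sym cs) => p Hp Hrp Sp.
have S0 := Sp ord0; have S1 := Sp (lift ord0 ord0).
move: S0 S1; rewrite /ovec !sum3 /oent /= !Hrp !Hp /dot sum3 !Hp /radial /azimuthal /axial /=.
rewrite axis_dist_refl//.
set r := axis_dist p; set A := vr _ _; set B := vt _ _; set C := vz _ _.
move=> h0 h1.
have e0 : B * ((p.1.2 : R) / r) = 0 by move: h0; lra.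
have e1 : B * ((p.1.1 : R) / r) = 0 by move: h1; lra.
transitivity ((B * ((p.1.2 : R) / r)) * ((p.1.2 : R) / r) + (B * ((p.1.1 : R) / r)) * ((p.1.1 : R) / r)).
  by ring.
by rewrite e0 e1 !mul0r addr0.
Qed.

End axial.

Theorem mainTheorem3 (R : realType) (T : R) (u : R -> 'rV[R]_3 -> 'rV[R]_3) :
  0 < T ->
  bounded_mild_solution T u ->
  axisymmetric (u T) /\ swirl_free (u T) ->
  forall t : R, 0 <= t <= T -> axisymmetric (u t) /\ swirl_free (u t).
Proof.
move=> T0 [bu _ _ mu] [[vr [vt [vz aT]]] sT] t tT.
have [V [M [M0 mV bV miV uV]]] := bounded_version T0 bu mu.
have TT : 0 <= T <= T by rewrite lexx ltW.
have rowE (A B C : R) (x y z : 'rV[R]_3) i :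
    (A *: x + B *: y + C *: z) 0 i = A * x 0 i + B * y 0 i + C * z 0 i.
  by rewrite !mxE.
have swE (v : 'rV[R]_3 -> 'rV[R]_3) p : swirl v (vec3 p) = dot (fun i => v (vec3 p) 0 i) (azimuthal p).
  by apply: eq_bigr => i _; rewrite e_theta_vec3.
have cylT : {ae lam3 R, forall p, cylindrical (fun i => V i T) vr vt vz p}.
  apply: filterS2 (uV T TT) aT => p Vp Ep i.
  by rewrite -Vp Ep rowE e_r_vec3 e_theta_vec3 e_z_axial cyl_r_vec3 cyl_z_vec3.
have swT : {ae lam3 R, forall p, dot (fun i => V i T p) (azimuthal p) = 0}.
  apply: filterS2 (uV T TT) sT => p Vp; rewrite swE => <-.
  by apply: eq_bigr => i _; rewrite Vp.
have sym (c s : R) : c ^+ 2 + s ^+ 2 = 1 ->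
    {ae lam3 R, forall p, forall i, V i t p = reflected c s V i t p}.
  move=> cs; have P := preserves_refl cs.
  have bV3 : bounded_by (3 * M) V.
    by move=> i r x; apply: (le_trans (bV i r x)); lra.
  have M30 : 0 <= 3 * M by lra.
  have HT : {ae lam3 R, forall p, forall i, V i T p = reflected c s V i T p}.
    apply: filterS2 (filterI cylT (preserves_ae P cylT)) (filterI swT (preserves_ae P swT)).
    move=> p [c1 c2] [s1 s2] i.
    exact: (swirl_free_reflected cs c1 c2 s1 s2).
  exact: (mild_unique miV (reflected_mild cs mV bV M0 miV) mV (reflected_umeas c s mV)
    bV3 (reflected_bound cs bV) M30 T0 HT tT).
have mVt i := umeas_slice t i mV.
split.
  have [wr [wt [wz H]]] := axial_profiles mVt sym.
  exists wr, wt, wz; apply: filterS2 (uV t tT) H => p Vp Hp.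
  apply/rowP => i.
  by rewrite Vp Hp rowE e_r_vec3 e_theta_vec3 e_z_axial cyl_r_vec3 cyl_z_vec3.
have := no_swirl mVt sym.
apply: filterS2 (uV t tT) => p Vp; rewrite swE => <-.
by apply: eq_bigr => i _; rewrite Vp.
Qed.
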